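(* Let $\{B^H(t):t\in[0,1]\}$ be a $d$-dimensional fractional Brownian motion of Hurst index $H\in(0,1)$ such that $Hd<1$. Let $f:[0,1]\to\mathbb{R}^d$ be an $H$-Hölder continuous function. Then there exist two Borel subsets $E_1$ and $E_2$ of $\mathbf{I}$ such that $\dim(E_1)=\dim(E_2)=Hd$ and for all $x\in\mathbb{R}^d$ $$\mathbb{P}\{\exists s\in E_1:(B^H+f)(s)=x\}=0\quad\text{and}\quad\mathbb{P}\{\exists s\in E_2:(B^H+f)(s)=x\}>0.$$
   Context: $\mathbf{I}=[a,b]$ with fixed $0<a<b\le 1$; $\dim$ is the Hausdorff dimension for the Euclidean metric. A real fractional Brownian motion $B_0^H$ is a centered Gaussian process with continuous paths and covariance $\frac12(|t|^{2H}+|s|^{2H}-|t-s|^{2H})$; $B^H$ has $d$ independent copies of $B_0^H$ as components and is defined on a complete probability space $(\Omega,\mathcal{F},\mathbb{P})$. *)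

(* Defs.v *)
From HB Require Import structures.
From mathcomp Require Import all_boot all_order all_algebra.
From mathcomp Require Import all_classical all_reals all_analysis.
Import Order.TTheory GRing.Theory Num.Theory.
Import numFieldNormedType.Exports.

Set Implicit Arguments.
Unset Strict Implicit.
Unset Printing Implicit Defensive.

Local Open Scope classical_set_scope.
Local Open Scope ring_scope.

Section hausdorff_dimension.
Context {R : realType}.
Implicit Types (A U : set R) (s delta : R).

Definition diam U : \bar R := ereal_sup [set `|x - y|%:E | x in U & y in U].

(* |U|^s, with |set0|^s = 0 for every s, also s = 0, so that empty sets are
   free in a cover; a singleton has |U|^0 = 0 `^ 0 = 1. *)
Definition diam_pow s U : \bar R :=
  if U == set0 then 0%E else poweR (diam U) s.

Definition hausdorff_premeasure s delta A : \bar R :=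
  ereal_inf [set (\sum_(0 <= k <oo) diam_pow s (U k))%E | U in
    [set U : nat -> set R |
      A `<=` \bigcup_k U k /\ forall k, (diam (U k) <= delta%:E)%E]].

Definition hausdorff_measure s A : \bar R :=
  ereal_sup [set hausdorff_premeasure s delta A | delta in [set delta | 0 < delta]].

Definition hausdorff_dim A : \bar R :=
  ereal_inf [set s%:E | s in [set s | 0 <= s /\ hausdorff_measure s A = 0%E]].

End hausdorff_dimension.

Section hoelder.
Context {R : realType} {d : nat}.

(* The library norm on row vectors is the maximum norm. *)
Definition euclidean_norm (x : 'rV[R]_d) : R :=
  Num.sqrt (\sum_(i < d) x ord0 i ^+ 2).

Definition hoelder_on01 (H : R) (f : R -> 'rV[R]_d) : Prop :=
  exists C : R, forall s t : R, s \in `[0, 1] -> t \in `[0, 1] ->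
    euclidean_norm (f s - f t) <= C * `|s - t| `^ H.

End hoelder.

Section processes.
Context {disp : measure_display} {T : measurableType disp} {R : realType}.
Variable P : probability T R.

(* Point masses count as Gaussian laws; they are treated apart because
   [normal_prob m 0] is by convention the uniform law on [0, 1]. *)
Definition gaussian_rv (X : T -> R) : Prop :=
  exists m sigma : R, 0 <= sigma /\
    forall A : set R, measurable A ->
      P (X @^-1` A) = if sigma == 0 then \d_m A else normal_prob m sigma A.

(* All processes below have time set [0, 1]: their values at other times are
   unconstrained. *)
Definition gaussian_process (X : R -> {RV P >-> R}) : Prop :=
  forall (n : nat) (t c : 'I_n -> R), (forall j, t j \in `[0, 1]) ->
    gaussian_rv (fun w => \sum_(j < n) c j * X (t j) w).

Definition is_real_fbm (H : R) (X : R -> {RV P >-> R}) : Prop :=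
  [/\ gaussian_process X,
      forall t : R, t \in `[0, 1] -> ('E_P[X t])%E = 0%E,
      forall s t : R, s \in `[0, 1] -> t \in `[0, 1] ->
        covariance P (X s) (X t) =
        (2^-1 * (`|t| `^ (2 * H) + `|s| `^ (2 * H) - `|t - s| `^ (2 * H)))%:E
    & forall w : T, {within `[0, 1], continuous (fun t : R => X t w)}].

Definition process_sigma_algebra (X : R -> {RV P >-> R}) : set (set T) :=
  <<s \bigcup_(t in `[0, 1]) preimage_set_system setT (X t) measurable >>.

Definition independent_processes (d : nat) (B : 'I_d -> R -> {RV P >-> R}) :
    Prop :=
  forall (J : {set 'I_d}) (A : 'I_d -> set T),
    (forall i, i \in J -> process_sigma_algebra (B i) (A i)) ->
    P (\bigcap_(i in [set` J]) A i) = (\prod_(i in J) P (A i))%E.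

(* The components are copies of one another, since the law of a centered
   Gaussian process is determined by its covariance. *)
Definition is_fbm (d : nat) (H : R) (B : 'I_d -> R -> {RV P >-> R}) : Prop :=
  (forall i, is_real_fbm H (B i)) /\ independent_processes B.

Definition hitting_event (d : nat) (B : 'I_d -> R -> {RV P >-> R})
    (f : R -> 'rV[R]_d) (E : set R) (x : 'rV[R]_d) : set T :=
  [set w | exists2 s : R, E s & \row_(i < d) B i s w + f s = x].

End processes.

(* Main.v *)
(* Both sets are closures of ranges of g(u) = a + sum_j delta_j floor(2^j u), 0 <= u < 1,
   where delta_j = kappa lambda^j w_j, lambda^(Hd) = 1/2 and the weight w_j is a power of
   j + 1.  Such a set is covered by 2^n intervals of length O(sum_(j > n) delta_j 2^(j - n)),
   and u -> g(u) has a Hoelder inverse, so its dimension is Hd whatever the power is; the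
   power decides whether the Hd-dimensional capacity vanishes.

   For w_j = (j + 1)^(-q) with q H >= 2, chaining over the nodes g(i / 2^n) shows that, off
   an event of probability O(2^(-n)), B + f oscillates by O(theta_n) on the pieces of
   level n, with theta_n^d = 2^(-n) (n + 1)^(-d).  Each piece is then hit with probability
   O(theta_n^d), and summing over the 2^n pieces gives 0.

   For w_j = (j + 1)^q with q H d >= 2, the Hd-energy of the uniform measure on the nodes is
   bounded.  The two-point estimate P(|X s - y| <= e, |X t - z| <= e) = O(e^2 / |t - s|^H)
   and the second moment method bound from below, uniformly in e, the probability of coming
   e-close to x at some node; compactness of the set yields the hit. *)
Require Import Defs.
From mathcomp Require Import all_boot all_order all_algebra.
From mathcomp Require Import all_classical all_reals all_analysis.
From mathcomp Require Import measurable_realfun lebesgue_integral_under.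
From mathcomp Require Import ring lra zify.
Import Order.TTheory GRing.Theory Num.Theory.
Import numFieldNormedType.Exports.

Local Open Scope classical_set_scope.
Local Open Scope ring_scope.

Set Implicit Arguments.
Unset Strict Implicit.
Unset Printing Implicit Defensive.

(** * Gaussian integrals *)

(** A Gaussian process is given through the laws of its linear combinations, so a pair of values
    comes with a characteristic function rather than a density. Hence the two-point estimate is made
    on the Fourier side: a nonnegative trigonometric polynomial dominates the indicator of a small
    box, and its expectation is a finite sum of Gaussian exponentials. These are small because the
    variance of [p X s + q (X t - X s)] is at least a constant times [p^2 + q^2 |t - s|^(2 H)].

    Upper bounds at fixed times are uniform in the centre of the ball and lower bounds are uniform
    over bounded centres, which takes care of [x] and of the drift [f]; between times [f] varies on
    the same scale [|t - s|^H] as [B]. The dimension [d] enters through independence, as a [d]-th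
    power.

    Under [q H >= 2] the [H]-th power of the length of a level-n piece is O(2^(-n/d) (n + 1)^(-2)).
    One factor [n + 1] pays for a Gaussian tail that beats the number of pieces, the other makes the
    total hitting probability vanish. Under [q H d >= 2] the energy series is dominated by the sum
    of the inverse squares. Neither set depends on [f] or [x]. *)

Lemma integral_derivative_vanishing (R : realType) (F F' : R -> R) (K : R) :
  (forall x : R, is_derive x 1 F (F' x)) -> continuous F' ->
  lebesgue_measure.-integrable [set: R] (EFin \o F') ->
  (forall x, `|x| * `|F x| <= K) ->
  \int[lebesgue_measure]_x F' x = 0.
Proof.
move=> dF cF' iF' FK.
pose I (n : nat) : set R := [set` `[- n.+1%:R, n.+1%:R]].
have mI n : measurable (I n) by exact: measurable_itv.
have mF' : measurable_fun [set: R] (EFin \o F') by exact: measurable_int iF'.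
have intI n : (\int[lebesgue_measure]_(x in I n) (F' x)%:E =
    (F n.+1%:R - F (- n.+1%:R))%:E)%E.
  rewrite EFinB; apply: continuous_FTC2.
  - by rewrite (@lt_trans _ _ 0)// ?oppr_lt0 ltr0n.
  - by apply: continuous_subspaceT => x; exact: cF'.
  - have cF x : {for x, continuous F}.
      have [/derivable1_diffP /differentiable_continuous] := dF x.
      by [].
    split.
    + by move=> x _; have [] := dF x.
    + by apply: cvg_at_right_filter; exact: cF.
    + by apply: cvg_at_left_filter; exact: cF.
  - by move=> x _; rewrite derive1E; apply: derive_val.
have cv1 : (\int[lebesgue_measure]_x ((EFin \o F') \_ (I n)) x)%E @[n --> \oo]
    --> (\int[lebesgue_measure]_x (F' x)%:E)%E.
  apply: (@dominated_cvg _ _ _ lebesgue_measure _ measurableT _ _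
      (fun x => `|(F' x)%:E|%E)) => //.
  - by move=> n; apply/(measurable_restrictT (EFin \o F')) => //; exact: measurable_funTS.
  - move=> x _; apply: cvg_near_cst.
    near=> n; rewrite patchE ifT// inE /I/= in_itv/= -ler_norml.
    apply: (@le_trans _ _ n%:R); last by rewrite ler_nat.
    by near: n; exact: nbhs_infty_ger.
  - exact: integrable_abse.
  - move=> n x _; rewrite patchE; case: ifP => // _.
    by rewrite abse0.
(* By the fundamental theorem the same integrals are boundary terms, at most [2 K / (n + 1)] by the
   decay of [F]; the two limits must agree. *)
have cv2 : (\int[lebesgue_measure]_x ((EFin \o F') \_ (I n)) x)%E @[n --> \oo]
    --> (0 : R)%:E.
  under eq_fun do rewrite -integral_mkcond intI.
  apply: cvg_EFin; first exact: nearW.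
  apply/norm_cvg0P.
  apply: (@squeeze_cvgr _ _ _ _ (fun=> 0) (fun n => (K + K) * n.+1%:R^-1)).
  - near=> n; rewrite normr_ge0/=.
    rewrite (le_trans (ler_normB _ _))// ler_pdivlMr ?ltr0n// mulrDl.
    have := FK n.+1%:R; have := FK (- n.+1%:R).
    rewrite normrN !normr_nat => h1 h2.
    by rewrite lerD// mulrC.
  - exact: cvg_cst.
  - rewrite -[X in _ --> X](mulr0 (K + K)); apply: cvgMr.
    exact: cvg_harmonic.
by rewrite /Rintegral (cvg_unique _ cv1 cv2).
Unshelve. all: by end_near. Qed.

Section normal_integrals.
Context {R : realType}.
Variables (m s : R).
Hypothesis s0 : s != 0.
Notation mu := (@lebesgue_measure R).
Notation p := (normal_pdf m s).

Let s2gt0 : 0 < s ^+ 2. Proof. by rewrite exprn_even_gt0. Qed.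

Lemma is_derive_normal_pdf (x : R) :
  is_derive x 1 p (- ((x - m) / s ^+ 2) * p x).
Proof.
rewrite normal_pdfE//.
have -> : (fun y : R => normal_peak s * normal_fun m s y) =
  (normal_peak s \*: (expR \o (fun y : R => - ((s ^+ 2 *+ 2)^-1) * (y - m) ^+ 2))).
  apply/funext => y/=; rewrite /normal_fun; congr (_ * expR _).
  by rewrite mulNr mulNr mulrC.
apply: is_derive_eq.
rewrite /GRing.scale/= /normal_fun.
have -> : - (s ^+ 2 *+ 2)^-1 * (x - m) ^+ 2 = - (x - m) ^+ 2 / (s ^+ 2 *+ 2).
  by rewrite mulNr mulNr mulrC.
rewrite -[s ^+ 2 *+ 2]mulr_natr invfM.
field.
by rewrite s0.
Qed.

Definition normal_dom_cst : R := 2 * (1 + 8 * s ^+ 2 / 3).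

(** Doubling the standard deviation leaves a surplus factor [exp (- z)] with
    [z = 3 (x - m)^2 / (8 s^2)], which absorbs the quadratic factor through [1 + z <= exp z].
    Integrability against quadratic growth is thus inherited from another normal density. *)
Lemma normal_pdf_dom (x : R) :
  (1 + (x - m) ^+ 2) * p x <= normal_dom_cst * normal_pdf m (2 * s) x.
Proof.
have s20 : 2 * s != 0 by rewrite mulf_neq0// pnatr_eq0.
rewrite !normal_pdfE// /normal_fun.
have -> : normal_peak (2 * s) = 2^-1 * normal_peak s.
  rewrite /normal_peak; rewrite exprMn -mulrA -mulrnAr sqrtrM ?sqr_ge0// invfM.
  by rewrite sqrtr_sqr ger0_norm.
set y := (x - m) ^+ 2.
have y0 : 0 <= y by exact: sqr_ge0.
pose z := y * (3 / (8 * s ^+ 2)).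
have z0 : 0 <= z by rewrite mulr_ge0// divr_ge0// mulr_ge0// ltW.
have -> : - y / (s ^+ 2 *+ 2) = - z + - y / ((2 * s) ^+ 2 *+ 2).
  by rewrite /z -[s ^+ 2 *+ 2]mulr_natr -[_ ^+ 2 *+ 2]mulr_natr; field; rewrite s0.
rewrite expRD.
have h1 : (1 + y) * expR (- z) <= 1 + 8 * s ^+ 2 / 3.
  have -> : y = (8 * s ^+ 2 / 3) * z by rewrite /z; field; rewrite s0.
  rewrite expRN ler_pdivrMr ?expR_gt0//.
  apply: (@le_trans _ _ ((1 + 8 * s ^+ 2 / 3) * (1 + z))).
    have : 0 <= 8 * s ^+ 2 / 3 by rewrite divr_ge0// mulr_ge0// ltW.
    nra.
  rewrite ler_wpM2l// ?expR_ge1Dx//.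
  by rewrite addr_ge0// divr_ge0// mulr_ge0// ltW.
have pk : 0 <= normal_peak s * expR (- y / ((2 * s) ^+ 2 *+ 2)).
  by rewrite mulr_ge0 ?normal_peak_ge0 ?expR_ge0.
rewrite /normal_dom_cst.
have -> : (1 + y) * (normal_peak s * (expR (- z) * expR (- y / ((2 * s) ^+ 2 *+ 2))))
  = ((1 + y) * expR (- z)) * (normal_peak s * expR (- y / ((2 * s) ^+ 2 *+ 2))).
  by ring.
have -> : 2 * (1 + 8 * s ^+ 2 / 3) *
   (2^-1 * normal_peak s * expR (- y / ((2 * s) ^+ 2 *+ 2))) =
   (1 + 8 * s ^+ 2 / 3) * (normal_peak s * expR (- y / ((2 * s) ^+ 2 *+ 2))).
  by field.
exact: ler_wpM2r.
Qed.

Lemma integrable_normal_mul (f : R -> R) (C : R) :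
  measurable_fun [set: R] f -> (forall x, `|f x| <= C * (1 + (x - m) ^+ 2)) ->
  mu.-integrable [set: R] (fun x => (f x * p x)%:E).
Proof.
move=> mf fC.
have mp := measurable_normal_pdf m s.
apply: (@le_integrable _ _ _ mu _ measurableT _
   (fun x => ((C * normal_dom_cst)%:E * (normal_pdf m (2 * s) x)%:E)%E)).
- by apply/measurable_EFinP; exact: measurable_funM.
- move=> x _; rewrite -EFinM !abse_EFin lee_fin.
  apply: le_trans (ler_norm _).
  rewrite normrM (ger0_norm (normal_pdf_ge0 m s x)).
  have C0 : 0 <= C.
    have := le_trans (normr_ge0 _) (fC m).
    by rewrite subrr expr0n/= addr0 mulr1.
  apply: (@le_trans _ _ (C * (1 + (x - m) ^+ 2) * p x)).
    by rewrite ler_wpM2r ?normal_pdf_ge0.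
  by rewrite -[leLHS]mulrA -[leRHS]mulrA ler_wpM2l//; exact: normal_pdf_dom.
- by apply: integrableZl => //; exact: integrable_normal_pdf.
Qed.

(** Supplies the decay that kills the boundary terms in the integration by parts below. *)
Lemma normal_pdf_decay (f : R -> R) (C : R) :
  (forall x, `|f x| <= C * (1 + `|x - m|)) ->
  exists K, forall x, `|x| * `|f x * p x| <= K.
Proof.
move=> fC.
have C0 : 0 <= C.
  have := le_trans (normr_ge0 _) (fC m).
  by rewrite subrr normr0 addr0 mulr1.
exists (2 * (1 + `|m|) * C * normal_dom_cst * normal_peak (2 * s)) => x.
have s20 : 2 * s != 0 by rewrite mulf_neq0// pnatr_eq0.
have p0 := normal_pdf_ge0 m s x.
rewrite normrM (ger0_norm p0) mulrA.
set y := `|x - m|.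
have hx : `|x| <= (1 + `|m|) * (1 + y).
  have -> : x = (x - m) + m by rewrite subrK.
  rewrite (le_trans (ler_normD _ _))// -/y.
  have : 0 <= `|m| by []. have : 0 <= y by rewrite /y.
  nra.
have y2 : (x - m) ^+ 2 = y ^+ 2 by rewrite /y -normrX ger0_norm ?sqr_ge0.
apply: (@le_trans _ _ ((1 + `|m|) * (1 + y) * (C * (1 + y)) * p x)).
  by rewrite ler_wpM2r// ler_pM.
have h2 : (1 + y) ^+ 2 <= 2 * (1 + (x - m) ^+ 2).
  by rewrite y2; have := sqr_ge0 (1 - y); rewrite !expr2; nra.
apply: (@le_trans _ _ ((1 + `|m|) * C * (2 * ((1 + (x - m) ^+ 2) * p x)))).
  have -> : (1 + `|m|) * (1 + y) * (C * (1 + y)) * p x =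
    (1 + `|m|) * C * ((1 + y) ^+ 2 * p x) by ring.
  rewrite ler_wpM2l ?mulr_ge0 ?addr_ge0//.
  by rewrite mulrA ler_wpM2r.
have -> : 2 * (1 + `|m|) * C * normal_dom_cst * normal_peak (2 * s) =
   (1 + `|m|) * C * (2 * (normal_dom_cst * normal_peak (2 * s))) by ring.
rewrite ler_wpM2l ?mulr_ge0 ?addr_ge0// ler_wpM2l//.
apply: le_trans (normal_pdf_dom x) _.
rewrite ler_wpM2l ?normal_pdf_ub//.
by rewrite /normal_dom_cst mulr_ge0// addr_ge0// divr_ge0// mulr_ge0// ltW.
Qed.

Lemma continuous_normal_mul (f : R -> R) : continuous f ->
  continuous (fun x => f x * p x).
Proof.
move=> cf x; apply: cvgM; first exact: cf.
exact: continuous_normal_pdf.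
Qed.

(** Stein's identity, obtained by integrating the derivative of [f * p] over the line. The mean, the
    variance and the differential equation of the characteristic function are all instances of
    it. *)
Lemma integral_normal_stein (f f' : R -> R) (C : R) :
  (forall x : R, is_derive x 1 f (f' x)) -> continuous f' ->
  (forall x, `|f x| <= C * (1 + `|x - m|)) ->
  (forall x, `|f' x| <= C) ->
  \int[mu]_x (f x * (x - m) * p x) = s ^+ 2 * \int[mu]_x (f' x * p x).
Proof.
move=> df cf' fC f'C.
have cf : continuous f.
  by move=> x; have [/derivable1_diffP /differentiable_continuous] := df x.
have C0 : 0 <= C by exact: le_trans (f'C m).
have mcont (g : R -> R) : continuous g -> measurable_fun [set: R] g.
  by move=> cg; exact: continuous_measurable_fun.
have cxm : continuous (fun x : R => x - m).
  by move=> x; apply: cvgB; [exact: cvg_id|exact: cvg_cst].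
have sq (y : R) : 0 <= y -> 2 * y <= 1 + y ^+ 2.
  by move=> _; have := sqr_ge0 (1 - y); rewrite !expr2; nra.
have if' : mu.-integrable [set: R] (fun x => (f' x * p x)%:E).
  apply: (@integrable_normal_mul _ C); first exact: mcont.
  move=> x; apply: le_trans (f'C x) _.
  by rewrite ler_peMr// lerDl sqr_ge0.
have ifx : mu.-integrable [set: R] (fun x => (f x * (x - m) * p x)%:E).
  apply: (@integrable_normal_mul _ (2 * C)).
    by apply: mcont => x; apply: cvgM; [exact: cf|exact: cxm].
  move=> x; rewrite normrM.
  have := fC x; set y := `|x - m| => h.
  have y0 : 0 <= y by rewrite /y.
  have -> : (x - m) ^+ 2 = y ^+ 2 by rewrite /y -normrX ger0_norm ?sqr_ge0.
  apply: (@le_trans _ _ (C * (1 + y) * y)); first by rewrite ler_wpM2r.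
  rewrite -[leLHS]mulrA [2 * C]mulrC -[leRHS]mulrA ler_wpM2l//.
  by have := sq _ y0; rewrite expr2; nra.
have [K hK] := normal_pdf_decay fC.
have key : \int[mu]_x (f' x * p x - s ^- 2 * (f x * (x - m) * p x)) = 0.
  apply: (@integral_derivative_vanishing _ (fun x => f x * p x) _ K) => //.
  - move=> x.
    have := is_deriveM (df x) (is_derive_normal_pdf x).
    move=> H; apply: (is_derive_eq H); rewrite /GRing.scale/=; ring.
  - move=> x; apply: cvgB; first exact: continuous_normal_mul.
    apply: cvgM; first exact: cvg_cst.
    apply: (@continuous_normal_mul (fun y => f y * (y - m))) => y.
    by apply: cvgM; [exact: cf|exact: cxm].
  - have -> : EFin \o (fun x => f' x * p x - s ^- 2 * (f x * (x - m) * p x)) =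
      (fun x => (f' x * p x)%:E - (s ^- 2)%:E * (f x * (x - m) * p x)%:E)%E.
      by apply/funext => x /=; rewrite EFinB EFinM.
    by apply: integrableB => //; exact: integrableZl.
rewrite RintegralB// in key; last first.
  have -> : EFin \o (fun x => s ^- 2 * (f x * (x - m) * p x)) =
      (fun x => (s ^- 2)%:E * (f x * (x - m) * p x)%:E)%E.
    by apply/funext => x /=; rewrite EFinM.
  exact: integrableZl.
move/eqP: key; rewrite subr_eq0 => /eqP ->.
by rewrite RintegralZl// mulrA divff ?mul1r// expf_neq0.
Qed.

Lemma integral_normal_1 : \int[mu]_x p x = 1.
Proof. by rewrite /Rintegral integral_normal_pdf. Qed.

Lemma integral_normal_mean : \int[mu]_x ((x - m) * p x) = 0.
Proof.
have := @integral_normal_stein (cst 1) (cst 0) 1.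
rewrite /cst => H.
transitivity (\int[mu]_x (1 * (x - m) * p x)).
  by apply: eq_Rintegral => x _; rewrite mul1r.
rewrite H//.
- under eq_Rintegral do rewrite mul0r.
  by rewrite Rintegral_cst// mul0r mulr0.
- by move=> x; exact: cvg_cst.
- by move=> x; rewrite normr1 mul1r lerDl.
- by move=> x; rewrite normr0.
Qed.

Lemma integral_normal_variance : \int[mu]_x ((x - m) ^+ 2 * p x) = s ^+ 2.
Proof.
transitivity (\int[mu]_x ((x - m) * (x - m) * p x)).
  by apply: eq_Rintegral => x _; rewrite expr2.
have d (x : R) : is_derive x 1 (fun x : R => x - m) 1.
  by apply: is_derive_eq; rewrite subr0.
apply: (etrans (@integral_normal_stein (fun x => x - m) (cst 1) 1 d _ _ _)).
- by move=> x; exact: cvg_cst.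
- by move=> x; rewrite mul1r lerDr.
- by move=> x; rewrite normr1.
- rewrite /cst; under eq_Rintegral do rewrite mul1r.
  by rewrite integral_normal_1 mulr1.
Qed.

(** The real part of [exp (i phi)] times the characteristic function of the centred normal law; the
    free phase replaces complex numbers. *)
Definition normal_cos (phi t : R) := \int[mu]_x (cos (t * (x - m) + phi) * p x).

Lemma integral_normal_sin (phi t : R) :
  \int[mu]_x (sin (t * (x - m) + phi) * (x - m) * p x) =
  s ^+ 2 * (t * normal_cos phi t).
Proof.
have d (x : R) : is_derive x 1 (fun x : R => sin (t * (x - m) + phi))
    (t * cos (t * (x - m) + phi)).
  have h : is_derive x 1 (fun x : R => t * (x - m) + phi) t.
    by apply: is_derive_eq; rewrite /GRing.scale/=; ring.
  have := @is_derive1_comp _ sin (fun x : R => t * (x - m) + phi) x _ _ (is_derive_sin (t * (x - m) + phi)) h.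
  by rewrite mulrC.
apply: (etrans (@integral_normal_stein _ _ (1 + `|t|) d _ _ _)).
- move=> x; apply: cvgM; first exact: cvg_cst.
  apply: continuous_comp; last exact: continuous_cos.
  apply: cvgD; last exact: cvg_cst.
  apply: cvgM; first exact: cvg_cst.
  by apply: cvgB; [exact: cvg_id|exact: cvg_cst].
- move=> x; apply: (@le_trans _ _ 1).
    by rewrite ler_norml sin_geN1 sin_le1.
  have h1 : 0 <= `|t| by []. have h2 : 0 <= `|x - m| by [].
  nra.
- move=> x; rewrite normrM; apply: (@le_trans _ _ `|t|); last by rewrite lerDr.
  by rewrite ler_piMr// ler_norml cos_geN1 cos_le1.
congr (_ * _); rewrite /normal_cos -RintegralZl//.
  by apply: eq_Rintegral => x _; rewrite mulrA.
apply: (@integrable_normal_mul _ 1).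
  apply: continuous_measurable_fun => x.
  apply: continuous_comp; last exact: continuous_cos.
  apply: cvgD; last exact: cvg_cst.
  apply: cvgM; first exact: cvg_cst.
  by apply: cvgB; [exact: cvg_id|exact: cvg_cst].
move=> x; rewrite mul1r; apply: (@le_trans _ _ 1); last by rewrite lerDl sqr_ge0.
by rewrite ler_norml cos_geN1 cos_le1.
Qed.

(** Differentiation under the integral produces a sine times [x - m], and Stein's identity turns it
    back into the cosine: the linear equation [y' = - s^2 t y], whatever the phase. *)
Lemma is_derive_normal_cos (phi t : R) :
  is_derive t 1 (normal_cos phi) (- (s ^+ 2 * t * normal_cos phi t)).
Proof.
have lin (x u : R) : is_derive u 1 (fun t : R => cos (t * (x - m) + phi) * p x)
    (- (sin (u * (x - m) + phi) * (x - m) * p x)).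
  have h : is_derive u 1 (fun u : R => u * (x - m) + phi) (x - m).
    by apply: is_derive_eq; rewrite /GRing.scale/=; ring.
  have h2 := @is_derive1_comp _ cos (fun u : R => u * (x - m) + phi) u _ _ (is_derive_cos (u * (x - m) + phi)) h.
  have := is_deriveM h2 (is_derive_cst (p x) u 1).
  move=> H; apply: (is_derive_eq H); rewrite /GRing.scale/=; ring.
pose f (t x : R) := cos (t * (x - m) + phi) * p x.
have d1f u x : (f ^~ x)^`()%classic u = - (sin (u * (x - m) + phi) * (x - m) * p x).
  by rewrite derive1E; apply: derive_val.
have ccos (u : R) : continuous (fun x : R => cos (u * (x - m) + phi)).
  move=> x; apply: continuous_comp; last exact: continuous_cos.
  apply: cvgD; last exact: cvg_cst.
  apply: cvgM; first exact: cvg_cst.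
  by apply: cvgB; [exact: cvg_id|exact: cvg_cst].
have It : [set` `]t - 1, t + 1[] t.
  by rewrite /= in_itv/= ltrBlDr ltrDl ltr01.
have intf (u : R) : [set` `]t - 1, t + 1[] u -> mu.-integrable [set: R] (EFin \o f u).
  move=> _; apply: (@integrable_normal_mul _ 1).
    by apply: continuous_measurable_fun; exact: ccos.
  move=> x; rewrite mul1r; apply: (@le_trans _ _ 1); last by rewrite lerDl sqr_ge0.
  by rewrite ler_norml cos_geN1 cos_le1.
have derf (u x : R) : [set` `]t - 1, t + 1[] u -> [set: R] x -> derivable (f ^~ x) u 1.
  by move=> _ _; have [] := lin x u.
(* Dominates the derivative in [t] for every [t], so the width of the neighbourhood is
   immaterial. *)
pose G (x : R) := (1 + (x - m) ^+ 2) * p x.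
have G0 x : 0 <= G x.
  by rewrite /G mulr_ge0 ?normal_pdf_ge0 ?addr_ge0 ?sqr_ge0.
have intG : mu.-integrable [set: R] (EFin \o G).
  apply: (@integrable_normal_mul _ 1).
    apply: continuous_measurable_fun => x; apply: cvgD; first exact: cvg_cst.
    rewrite expr2; apply: cvgM; by apply: cvgB; [exact: cvg_id|exact: cvg_cst].
  by move=> x; rewrite mul1r ger0_norm// addr_ge0 ?sqr_ge0.
have Gub (u x : R) : [set` `]t - 1, t + 1[] u -> [set: R] x ->
    `|partial1of2 f u x| <= G x.
  move=> _ _; rewrite /partial1of2 d1f normrN normrM (ger0_norm (normal_pdf_ge0 _ _ _)).
  rewrite ler_wpM2r ?normal_pdf_ge0// normrM.
  apply: (@le_trans _ _ `|x - m|).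
    by rewrite ler_piMl// ler_norml sin_geN1 sin_le1.
  have -> : (x - m) ^+ 2 = `|x - m| ^+ 2 by rewrite -normrX ger0_norm ?sqr_ge0.
  have := sqr_ge0 (1 - `|x - m|); have : 0 <= `|x - m| by [].
  by rewrite !expr2; nra.
have dd := @derivable_under_integral _ _ _ mu f _ measurableT _ _ _ It intf derf
  G G0 intG Gub.
have dv := @differentiation_under_integral _ _ _ mu f _ measurableT _ _ _ It intf derf
  G G0 intG Gub.
apply: DeriveDef; first exact: dd.
rewrite -derive1E [LHS]dv /=.
under eq_Rintegral do rewrite /partial1of2 d1f -mulN1r.
rewrite RintegralZl//; last first.
  apply: (@integrable_normal_mul _ 1).
    apply: continuous_measurable_fun => x; apply: cvgM.
      apply: continuous_comp; last exact: continuous_sin.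
      apply: cvgD; last exact: cvg_cst.
      apply: cvgM; first exact: cvg_cst.
      by apply: cvgB; [exact: cvg_id|exact: cvg_cst].
    by apply: cvgB; [exact: cvg_id|exact: cvg_cst].
  move=> x; rewrite normrM mul1r; apply: (@le_trans _ _ `|x - m|).
    by rewrite ler_piMl// ler_norml sin_geN1 sin_le1.
  have -> : (x - m) ^+ 2 = `|x - m| ^+ 2 by rewrite -normrX ger0_norm ?sqr_ge0.
  have := sqr_ge0 (1 - `|x - m|); have : 0 <= `|x - m| by [].
  by rewrite !expr2; nra.
by rewrite integral_normal_sin mulN1r mulrA.
Qed.

(** Multiplying by [expR (s^2 t^2 / 2)] gives a function with zero derivative, which keeps its value
    at [t = 0]. *)
Lemma normal_cosE (phi t : R) :
  normal_cos phi t = cos phi * expR (- (s ^+ 2 * t ^+ 2 / 2)).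
Proof.
pose h (u : R) := normal_cos phi u * expR (s ^+ 2 * u ^+ 2 / 2).
have dh (u : R) : is_derive u 1 h 0.
  have d1 : is_derive u 1 (fun u : R => s ^+ 2 * u ^+ 2 / 2) (s ^+ 2 * u).
    by apply: is_derive_eq; rewrite /GRing.scale/=; field.
  have d2 := @is_derive1_comp _ expR (fun u : R => s ^+ 2 * u ^+ 2 / 2) u _ _ (is_derive_expR (s ^+ 2 * u ^+ 2 / 2)) d1.
  have := is_deriveM (is_derive_normal_cos phi u) d2.
  move=> H; apply: (is_derive_eq H); rewrite /GRing.scale/=; ring.
have := is_derive_0_is_cst t 0 dh; rewrite /h.
rewrite expr0n/= mulr0 mul0r expR0 mulr1 {2}/normal_cos.
have -> : \int[mu]_x (cos (0 * (x - m) + phi) * p x) = cos phi.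
  under eq_Rintegral do rewrite mul0r add0r.
  rewrite RintegralZl//; last exact: integrable_normal_pdf.
  by rewrite integral_normal_1 mulr1.
by move=> <-; rewrite expRN mulfK// gt_eqF// expR_gt0.
Qed.

End normal_integrals.

(** * Moments and characteristic functions of Gaussian random variables *)

Section gaussian.
Context {disp : measure_display} {T : measurableType disp} {R : realType}.
Variable P : probability T R.
Notation mu := (@lebesgue_measure R).

Lemma Rintegral_prob_cst (c : R) : \int[P]_w c = c.
Proof.
transitivity (fine 'E_P[cst c])%E; first by rewrite unlock.
by rewrite expectation_cst.
Qed.

Lemma ge0_integral_law_normal (X : T -> R) (m s : R) (g : R -> \bar R) :
  measurable_fun [set: T] X -> s != 0 ->
  (forall A, measurable A -> P (X @^-1` A) = normal_prob m s A) ->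
  measurable_fun [set: R] g -> (forall x, 0 <= g x)%E ->
  (\int[P]_w g (X w) = \int[mu]_x (g x * (normal_pdf m s x)%:E))%E.
Proof.
move=> mX s0 PX mg g0.
pose U : measurableType _ := measurableTypeR R.
have mX' : @measurable_fun _ _ T U [set: T] X by [].
pose X' : {mfun T >-> U} := @mfun_Sub _ _ T U X (mem_set mX').
transitivity (\int[distribution P X']_x g x)%E.
  by rewrite /distribution ge0_integral_pushforward.
transitivity (\int[normal_prob m s]_x g x)%E.
  by apply: (eq_measure_integral (normal_prob m s)) => A mA _; exact: PX.
(* The density enters as a Radon-Nikodym derivative; it agrees almost everywhere with [normal_pdf]
   because both have the same integral over every measurable set. *)
have dom := normal_prob_dominates m s.
rewrite -(Radon_Nikodym_SigmaFinite.change_of_variables dom)//.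
have mRN : measurable_fun [set: R]
    (Radon_Nikodym_SigmaFinite.f (normal_prob m s) mu).
  exact: measurable_int (Radon_Nikodym_SigmaFinite.f_integrable dom).
have mp : measurable_fun [set: R] (fun x => (normal_pdf m s x)%:E).
  by apply/measurable_EFinP; exact: measurable_normal_pdf.
apply: ae_eq_integral => //.
- exact: emeasurable_funM.
- exact: emeasurable_funM.
- apply: ae_eqe_mul2l; apply: integral_ae_eq => //.
  + exact: Radon_Nikodym_SigmaFinite.f_integrable.
  + by move=> E _ mE; rewrite -Radon_Nikodym_SigmaFinite.f_integral.
Qed.

Lemma integral_law_normal (X : T -> R) (m s : R) (f : R -> R) (C : R) :
  measurable_fun [set: T] X -> s != 0 ->
  (forall A, measurable A -> P (X @^-1` A) = normal_prob m s A) ->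
  measurable_fun [set: R] f -> (forall x, `|f x| <= C * (1 + (x - m) ^+ 2)) ->
  P.-integrable [set: T] (fun w => (f (X w))%:E) /\
  \int[P]_w f (X w) = \int[mu]_x (f x * normal_pdf m s x).
Proof.
move=> mX s0 PX mf fC.
have C0 : 0 <= C.
  have := le_trans (normr_ge0 _) (fC m).
  by rewrite subrr expr0n/= addr0 mulr1.
(* Both [f + h] and [h] are nonnegative, so the signed case follows from the nonnegative one by
   subtraction. *)
pose h (x : R) := C * (1 + (x - m) ^+ 2).
have h0 x : 0 <= h x by rewrite mulr_ge0// addr_ge0// sqr_ge0.
have mh : measurable_fun [set: R] h.
  apply: continuous_measurable_fun => x; apply: cvgM; first exact: cvg_cst.
  apply: cvgD; first exact: cvg_cst.
  by rewrite expr2; apply: cvgM; (apply: cvgB; [exact: cvg_id|exact: cvg_cst]).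
have ge0 (k : R -> R) (D : R) : measurable_fun [set: R] k ->
    (forall x, 0 <= k x) -> (forall x, `|k x| <= D * (1 + (x - m) ^+ 2)) ->
    P.-integrable [set: T] (fun w => (k (X w))%:E) /\
    \int[P]_w k (X w) = \int[mu]_x (k x * normal_pdf m s x).
  move=> mk k0 kD.
  have mkX : measurable_fun [set: T] (fun w => k (X w)).
    exact: measurableT_comp.
  have E : (\int[P]_w (k (X w))%:E = \int[mu]_x (k x * normal_pdf m s x)%:E)%E.
    rewrite (@ge0_integral_law_normal _ m s (EFin \o k))//.
    exact/measurable_EFinP.
  split; last by rewrite /Rintegral E.
  apply/integrableP; split; first exact/measurable_EFinP.
  under eq_integral do rewrite abse_EFin ger0_norm//.
  rewrite E.
  have /integrableP[_] := integrable_normal_mul s0 mk kD.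
  apply: le_lt_trans; apply: ge0_le_integral => //.
  - by move=> x _; rewrite lee_fin mulr_ge0 ?normal_pdf_ge0.
  - by apply/measurable_EFinP/measurable_funM => //; exact: measurable_normal_pdf.
  - apply: measurableT_comp => //.
    by apply/measurable_EFinP/measurable_funM => //; exact: measurable_normal_pdf.
  - by move=> x _; rewrite lee_fin ler_norm.
have hD x : `|h x| <= C * (1 + (x - m) ^+ 2) by rewrite ger0_norm.
have [ih Eh] := ge0 h C mh h0 hD.
have fh0 x : 0 <= f x + h x.
  by have := fC x; rewrite ler_norml => /andP[+ _]; rewrite -/(h x) -subr_ge0 opprK.
have fhD x : `|f x + h x| <= (2 * C) * (1 + (x - m) ^+ 2).
  rewrite -mulrA -/(h x) mulr_natl mulr2n (le_trans (ler_normD _ _))//.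
  by rewrite lerD// ?fC// ger0_norm.
have [ifh Efh] := ge0 (fun x => f x + h x) _ (measurable_funD mf mh) fh0 fhD.
have ifX : P.-integrable [set: T] (fun w => (f (X w))%:E).
  have -> : (fun w => (f (X w))%:E) =
      (fun w => (f (X w) + h (X w))%:E - (h (X w))%:E)%E.
    by apply/funext => w; rewrite -EFinB addrK.
  exact: integrableB.
split => //.
transitivity (\int[P]_w ((f (X w) + h (X w)) - h (X w))).
  by apply: eq_Rintegral => w _; rewrite addrK.
rewrite RintegralB// Efh Eh -RintegralB//.
- by apply: eq_Rintegral => x _; rewrite -mulrBl addrK.
- exact: (integrable_normal_mul s0 (measurable_funD mf mh) fhD).
- exact: (integrable_normal_mul s0 mh hD).
Qed.

(** Collects what is used of a Gaussian law, point masses included. The last clause bounds the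
    characteristic function in modulus, the phase standing for its argument; for a point mass it is
    the trivial bound by 1. *)
Lemma gaussian_rv_spec (X : T -> R) :
  measurable_fun [set: T] X -> gaussian_rv P X ->
  exists m s : R, [/\ 0 <= s,
    (forall A : set R, measurable A ->
      P (X @^-1` A) = if s == 0 then \d_m A else normal_prob m s A),
    P.-integrable [set: T] (fun w => (X w)%:E) /\
    P.-integrable [set: T] (fun w => (X w ^+ 2)%:E),
    \int[P]_w X w = m /\ \int[P]_w (X w - m) ^+ 2 = s ^+ 2 &
    forall phi, `|\int[P]_w cos (X w + phi)| <= expR (- (s ^+ 2 / 2))].
Proof.
move=> mX [m [s [s0 PX]]]; exists m, s.
have mcos phi : measurable_fun [set: R] (fun x : R => cos (x + phi)).
  apply: continuous_measurable_fun => x.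
  apply: continuous_comp; last exact: continuous_cos.
  by apply: cvgD; [exact: cvg_id|exact: cvg_cst].
have icos phi : P.-integrable [set: T] (fun w => (cos (X w + phi))%:E).
  apply: (@le_integrable _ _ _ P _ measurableT _ (cst 1%E)).
  - by apply/measurable_EFinP; exact: (measurableT_comp (mcos phi)).
  - by move=> w _; rewrite !abse_EFin lee_fin normr1 ler_norml cos_geN1 cos_le1.
  - exact: finite_measure_integrable_cst.
(* In the degenerate case [X] equals [m] almost surely, so every integral of [g (X w)] is [g m]. *)
have [s00|sn0] := eqVneq s 0.
  have PXm : P (X @^-1` [set~ m]) = 0%E.
    rewrite PX; last exact: measurableC.
    by rewrite s00 eqxx diracE memNset//=; apply.
  have XmE : ae_eq P [set: T] X (cst m).
    exists (X @^-1` [set~ m]); split => //.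
    - rewrite -[X in measurable X]setTI; apply: mX => //.
      exact: measurableC.
    - by move=> w /=; apply: contra_not => ->.
  have aeI (g : R -> R) : measurable_fun [set: R] g ->
      P.-integrable [set: T] (fun w => (g (X w))%:E) /\ \int[P]_w g (X w) = g m.
    move=> mg.
    have E : ae_eq P [set: T] (fun w => (g (X w))%:E) (cst (g m)%:E).
      by apply: filterS XmE => w /= + _ => ->.
    have mgX : measurable_fun [set: T] (fun w => (g (X w))%:E).
      by apply/measurable_EFinP; exact: measurableT_comp.
    split.
      apply/integrableP; split => //.
      rewrite (ae_eq_integral (cst `|(g m)%:E|%E))//; last 2 first.
      - exact: measurableT_comp.
      - apply: filterS E => w /= H ?.
        by rewrite -abse_EFin H.
      have /integrableP[]// : P.-integrable [set: T] (EFin \o cst (g m)).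
      exact: finite_measure_integrable_cst.
    rewrite /Rintegral (ae_eq_integral (cst (g m)%:E))//.
    exact: Rintegral_prob_cst.
  split => //.
  - by rewrite s00 eqxx in PX *.
  - split; first by case: (aeI id).
    by case: (aeI (fun x => x ^+ 2)) => //; exact: exprn_measurable.
  - split; first by case: (aeI id).
    rewrite s00 expr0n/=; case: (aeI (fun x => (x - m) ^+ 2)).
      by apply: measurable_funX; exact: measurable_funB.
    by move=> _ ->; rewrite subrr expr0n.
  - move=> phi; case: (aeI (fun x => cos (x + phi))) => // _ ->.
    by rewrite s00 expr0n/= mul0r oppr0 expR0 ler_norml cos_geN1 cos_le1.
have {}PX A : measurable A -> P (X @^-1` A) = normal_prob m s A.
  by move=> mA; rewrite PX// (negbTE sn0).
have cB : continuous (fun x : R => x - m).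
  by move=> x; apply: cvgB; [exact: cvg_id|exact: cvg_cst].
have sq (y : R) : `|y| <= 1 + y ^+ 2.
  have -> : y ^+ 2 = `|y| ^+ 2 by rewrite -normrX ger0_norm ?sqr_ge0.
  have := sqr_ge0 (1 - `|y|); have : 0 <= `|y| by [].
  by rewrite !expr2; nra.
have m1 : measurable_fun [set: R] (fun x : R => x - m) by exact: continuous_measurable_fun.
have b1 (x : R) : `|x - m| <= 1 * (1 + (x - m) ^+ 2) by rewrite mul1r.
have b2 (x : R) : `|(x - m) ^+ 2| <= 1 * (1 + (x - m) ^+ 2).
  by rewrite mul1r ger0_norm ?sqr_ge0// lerDr.
have bc phi (x : R) : `|cos (x + phi)| <= 1 * (1 + (x - m) ^+ 2).
  rewrite mul1r (@le_trans _ _ 1)//; last by rewrite lerDl sqr_ge0.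
  by rewrite ler_norml cos_geN1 cos_le1.
have [iB EB] := integral_law_normal mX sn0 PX m1 b1.
have [i2 E2] := integral_law_normal mX sn0 PX (measurable_funX 2 m1) b2.
have icst (c : R) : P.-integrable [set: T] (fun w => c%:E).
  exact: finite_measure_integrable_cst.
have iX : P.-integrable [set: T] (fun w => (X w)%:E).
  have -> : (fun w => (X w)%:E) = (fun w => (X w - m)%:E + m%:E)%E.
    by apply/funext => w; rewrite -EFinD subrK.
  exact: integrableD.
split => //.
- split => //.
  have -> : (fun w => (X w ^+ 2)%:E) =
      (fun w => ((X w - m) ^+ 2)%:E + ((2 * m)%:E * (X w)%:E - (m ^+ 2)%:E))%E.
    apply/funext => w; rewrite -EFinM -EFinB -EFinD; congr EFin; ring.
  apply: integrableD => //; apply: integrableB => //; exact: integrableZl.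
- split; last by rewrite E2 integral_normal_variance.
  transitivity (\int[P]_w ((X w - m) + m)).
    by apply: eq_Rintegral => w _; rewrite subrK.
  rewrite (@RintegralD _ _ _ P _ (fun w => X w - m) (fun=> m))//; last exact: icst.
  rewrite EB integral_normal_mean// add0r.
  exact: Rintegral_prob_cst.
- move=> phi.
  have [_ ->] := integral_law_normal mX sn0 PX (mcos phi) (bc phi).
  have -> : \int[mu]_x (cos (x + phi) * normal_pdf m s x) = normal_cos m s (phi + m) 1.
    by apply: eq_Rintegral => x _; congr (cos _ * _); ring.
  rewrite normal_cosE// expr1n mulr1 normrM (ger0_norm (expR_ge0 _)).
  by rewrite ler_piMl ?expR_ge0// ler_norml cos_geN1 cos_le1.
Qed.

Lemma centered_gaussian_rv_spec (X : T -> R) :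
  measurable_fun [set: T] X -> gaussian_rv P X -> \int[P]_w X w = 0 ->
  exists s : R, [/\ 0 <= s, s ^+ 2 = \int[P]_w (X w) ^+ 2,
    s != 0 -> forall A : set R, measurable A ->
      P (X @^-1` A) = normal_prob 0 s A &
    forall phi, `|\int[P]_w cos (X w + phi)| <= expR (- (s ^+ 2 / 2))].
Proof.
move=> mX gX EX; have [m [s [s0 PX _ [Em Es] Ec]]] := gaussian_rv_spec mX gX.
have m0 : m = 0 by rewrite -Em.
exists s; split => //.
- by rewrite -Es m0; apply: eq_Rintegral => w _; rewrite subr0.
- by move=> sn0 A mA; rewrite PX// (negbTE sn0) m0.
Qed.

Lemma gaussian_rv_integrable (X : T -> R) :
  measurable_fun [set: T] X -> gaussian_rv P X ->
  P.-integrable [set: T] (fun w => (X w)%:E) /\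
  P.-integrable [set: T] (fun w => (X w ^+ 2)%:E).
Proof. by move=> mX gX; have [m [s []]] := gaussian_rv_spec mX gX. Qed.

End gaussian.

(** * Small balls and tails of the normal law *)

Section normal_estimates.
Context {R : realType}.
Notation mu := (@lebesgue_measure R).

Lemma normal_prob_ball_le (s y e : R) : s != 0 -> 0 < e ->
  (normal_prob 0 s `[(y - e)%R, (y + e)%R] <= (normal_peak s * (2 * e))%:E)%E.
Proof.
move=> s0 e0; rewrite /normal_prob.
apply: (@le_trans _ _ (\int[mu]_(x in `[(y - e)%R, (y + e)%R]) (normal_peak s)%:E)%E).
  apply: ge0_le_integral => //.
  - by move=> x _; rewrite lee_fin normal_pdf_ge0.
  - by apply/measurable_funTS/measurable_EFinP; exact: measurable_normal_pdf.
  - by move=> x _; rewrite lee_fin normal_pdf_ub.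
rewrite integral_cst//= lebesgue_measure_itv/= lte_fin.
rewrite ifT; last by lra.
rewrite -EFinB -EFinM lee_fin.
by have -> : y + e - (y - e) = 2 * e by ring.
Qed.

Lemma normal_prob_ball_ge (s y e M : R) : s != 0 -> 0 < e -> `|y| + e <= M ->
  ((normal_pdf 0 s M * (2 * e))%:E <= normal_prob 0 s `[(y - e)%R, (y + e)%R])%E.
Proof.
move=> s0 e0 yM; rewrite /normal_prob.
apply: (@le_trans _ _ (\int[mu]_(x in `[(y - e)%R, (y + e)%R]) (normal_pdf 0 s M)%:E)%E).
  rewrite integral_cst//= lebesgue_measure_itv/= lte_fin.
  rewrite ifT; last by lra.
  rewrite -EFinB -EFinM lee_fin.
  by have -> : y + e - (y - e) = 2 * e by ring.
apply: ge0_le_integral => //.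
- by move=> x _; rewrite lee_fin normal_pdf_ge0.
- by apply/measurable_funTS/measurable_EFinP; exact: measurable_normal_pdf.
- move=> x /=; rewrite in_itv/= => /andP[x1 x2].
  rewrite lee_fin !normal_pdfE// ler_wpM2l ?normal_peak_ge0// ler_expR.
  rewrite ler_pM2r; last by rewrite invr_gt0 mulrn_wgt0// exprn_even_gt0.
  rewrite lerN2 !subr0 -[x ^+ 2]ger0_norm ?sqr_ge0// normrX lerXn2r// ?nnegrE//.
    by apply: le_trans yM; rewrite addr_ge0// ltW.
  apply: le_trans yM; rewrite ler_norml.
  by have := ler_norm y; have := ler_norm (- y); rewrite normrN; lra.
Qed.

(** Where [|y| > x], the density is at most [2 exp (- x^2 / (4 s^2))] times the density with
    standard deviation [2 s], whose total mass is 1. The constant in the exponent is not optimal;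
    only its order in [x / s] matters for the chaining. *)
Lemma normal_prob_tail (s x : R) : s != 0 -> 0 <= x ->
  (normal_prob 0 s [set y | (x < `|y|)%R] <=
   (2 * expR (- (x ^+ 2 / (4 * s ^+ 2))))%:E)%E.
Proof.
move=> s0 x0.
have s20 : 2 * s != 0 by rewrite mulf_neq0.
have s2 : 0 < s ^+ 2 by rewrite exprn_even_gt0.
have mA : measurable [set y : R | x < `|y|].
  have -> : [set y : R | x < `|y|] = setT `&` (Num.norm @^-1` [set` `]x, +oo[]).
    by apply/seteqP; split => y /=; rewrite in_itv/= andbT => // -[].
  exact: (@normr_measurable _ setT).
pose c := 2 * expR (- (x ^+ 2 / (4 * s ^+ 2))).
have c0 : 0 <= c by rewrite mulr_ge0 ?expR_ge0.
apply: (@le_trans _ _ (\int[mu]_(y in [set y : R | (x < `|y|)%R])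
    (c%:E * (normal_pdf 0 (2 * s) y)%:E))%E).
  apply: ge0_le_integral => //.
  - by move=> y _; rewrite lee_fin normal_pdf_ge0.
  - by apply/measurable_funTS/measurable_EFinP; exact: measurable_normal_pdf.
  - apply/measurable_funTS/measurable_EFinP; apply: measurable_funM => //.
    exact: measurable_normal_pdf.
  - move=> y /= xy; rewrite -EFinM lee_fin !normal_pdfE// /c.
    have -> : normal_peak (2 * s) = 2^-1 * normal_peak s.
      rewrite /normal_peak; rewrite exprMn -mulrA -mulrnAr sqrtrM ?sqr_ge0// invfM.
      by rewrite sqrtr_sqr ger0_norm.
    rewrite /normal_fun !subr0.
    set E1 := expR _; set E2 := expR _; set E3 := expR _.
    have -> : 2 * E2 * (2^-1 * normal_peak s * E3) = normal_peak s * (E2 * E3).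
      by field.
    rewrite ler_wpM2l ?normal_peak_ge0// /E1 /E2 /E3 -expRD ler_expR.
    have -> : s ^+ 2 *+ 2 = 2 * s ^+ 2 by rewrite mulr_natl.
    have -> : (2 * s) ^+ 2 *+ 2 = 8 * s ^+ 2 by rewrite -mulr_natl; ring.
    rewrite !mulNr -opprD lerN2.
    have xy2 : x ^+ 2 <= y ^+ 2.
      by rewrite -[y ^+ 2]ger0_norm ?sqr_ge0// normrX lerXn2r// ?nnegrE// ltW.
    have -> : x ^+ 2 / (4 * s ^+ 2) + y ^+ 2 / (8 * s ^+ 2) =
       (2 * x ^+ 2 + y ^+ 2) / (8 * s ^+ 2).
      by field; rewrite s0.
    have -> : y ^+ 2 / (2 * s ^+ 2) = (4 * y ^+ 2) / (8 * s ^+ 2).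
      by field; rewrite s0.
    have i0 : 0 <= (8 * s ^+ 2)^-1 by rewrite invr_ge0 mulr_ge0// ltW.
    rewrite ler_wpM2r//.
    by have := sqr_ge0 y; lra.
rewrite ge0_integralZl//.
- rewrite -[leRHS]mule1 lee_wpmul2l// -(integral_normal_pdf 0 (2 * s)).
  apply: ge0_subset_integral => //.
  + by apply/measurable_EFinP; exact: measurable_normal_pdf.
  + by move=> y _; rewrite lee_fin normal_pdf_ge0.
- by apply/measurable_funTS/measurable_EFinP; exact: measurable_normal_pdf.
- by move=> y _; rewrite lee_fin normal_pdf_ge0.
Qed.

End normal_estimates.

(** * Two-point small ball probabilities *)

Section fejer.
Context {R : realType}.

(* This kernel is nonnegative and at least n^2/4 for |u| <= 1/(2n), so it dominates
   a multiple of the indicator of a small ball, while its expectation at a Gaussian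
   argument only involves the characteristic function. *)
Definition fejer (n : nat) (u : R) : R :=
  \sum_(i : 'I_n * 'I_n) cos ((i.1%:R - i.2%:R) * u).

(** The squared modulus of the sum of [exp (i k u)] over [k < n]. This form shows nonnegativity, and
    its real part alone gives the lower bound near 0. *)
Lemma fejerE n (u : R) :
  fejer n u = (\sum_(k < n) cos (k%:R * u)) ^+ 2 + (\sum_(k < n) sin (k%:R * u)) ^+ 2.
Proof.
rewrite /fejer !expr2 !big_distrlr/= -big_split/=.
under [RHS]eq_bigr do rewrite -big_split/=.
rewrite pair_bigA/=; apply: eq_bigr => -[k l] _ /=.
by rewrite mulrBl cosB.
Qed.

Lemma fejer_ge0 n (u : R) : 0 <= fejer n u.
Proof. by rewrite fejerE addr_ge0 ?sqr_ge0. Qed.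

Lemma cos_ge_half (x : R) : `|x| <= 2^-1 -> 2^-1 <= cos x.
Proof.
wlog x0 : x / 0 <= x.
  move=> H; have [x0|/ltW x0] := leP 0 x; first exact: H.
  by rewrite -cosN -normrN; apply: H; rewrite oppr_ge0.
rewrite ger0_norm// => x1.
have [c _] := @MVT_segment R cos (fun x => - sin x) 0 x x0
  (fun x _ => is_derive_cos x) (continuous_subspaceT (@continuous_cos R)).
rewrite cos0 subr0 => /eqP; rewrite subr_eq => /eqP ->.
have := sin_le1 c; have := sin_geN1 c; nra.
Qed.

Lemma fejer_lb n (u : R) : n%:R * `|u| <= 2^-1 -> n%:R ^+ 2 / 4 <= fejer n u.
Proof.
move=> nu; rewrite fejerE.
have h : n%:R / 2 <= \sum_(k < n) cos (k%:R * u).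
  have -> : n%:R / 2 = \sum_(k < n) (2^-1 : R).
    by rewrite sumr_const card_ord -[RHS]mulr_natl.
  apply: ler_sum => k _; apply: cos_ge_half.
  rewrite normrM (le_trans _ nu)// ler_wpM2r// ger0_norm// ler_nat.
  exact: ltnW.
apply: (@le_trans _ _ ((\sum_(k < n) cos (k%:R * u)) ^+ 2)); last first.
  by rewrite lerDl sqr_ge0.
have -> : n%:R ^+ 2 / 4 = (n%:R / 2) ^+ 2 :> R by field.
by rewrite lerXn2r// nnegrE ?divr_ge0// (le_trans _ h)// divr_ge0.
Qed.

Lemma sum_geometric_le (n : nat) (r : R) : 0 <= r -> r < 1 ->
  \sum_(k < n) r ^+ k <= (1 - r)^-1.
Proof.
move=> r0 r1; rewrite -[leRHS]mul1r ler_pdivlMr ?subr_gt0//.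
have := subrX1 r n => h.
have -> : (\sum_(k < n) r ^+ k) * (1 - r) = 1 - r ^+ n by rewrite mulrC; lra.
by rewrite gerBl exprn_ge0.
Qed.

(** A Gaussian sum over a grid of mesh [s] costs [1 / s], uniformly in the length and the centre.
    Completing the square, [c y^2 >= y - 1 / (4 c)], reduces it to two geometric series of ratio
    [r = exp (- s)], each at most [2 / s] because [s <= 1]. *)
Lemma sum_gauss_le (c s : R) (n k : nat) : 0 < c -> 0 < s -> s <= 1 ->
  \sum_(l < n) expR (- (c * ((k%:R - l%:R) * s) ^+ 2)) <=
  4 * expR (4 * c)^-1 / s.
Proof.
move=> c0 s0 s1.
pose r := expR (- s).
have r0 : 0 <= r by exact: expR_ge0.
have r1 : r < 1 by rewrite /r expR_lt1 oppr_lt0.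
have rs : (1 - r)^-1 <= 2 / s.
  have h : r * (1 + s) <= 1.
    rewrite /r expRN mulrC ler_pdivrMr ?expR_gt0// mul1r; exact: expR_ge1Dx.
  rewrite -[2 / s]invrK lef_pV2 ?posrE ?invr_gt0 ?divr_gt0 ?subr_gt0//.
  rewrite invf_div; nra.
have pt (l : nat) : expR (- (c * ((k%:R - l%:R) * s) ^+ 2)) <=
    expR (4 * c)^-1 * (if (l <= k)%N then r ^+ (k - l) else r ^+ (l - k)).
  have E : (if (l <= k)%N then r ^+ (k - l) else r ^+ (l - k)) =
      expR (- (`|k%:R - l%:R| * s)).
    case: leqP => lk.
      rewrite -(natrB _ lk) normr_nat /r -expRM_natl; congr expR; ring.
    rewrite distrC -(natrB _ (ltnW lk)) normr_nat /r -expRM_natl; congr expR; ring.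
  rewrite E -expRD ler_expR.
  have -> : ((k%:R - l%:R) * s) ^+ 2 = (`|k%:R - l%:R| * s) ^+ 2.
    by rewrite !exprMn -normrX ger0_norm ?sqr_ge0.
  set y := `|_| * s.
  have : 0 <= c * (y - (2 * c)^-1) ^+ 2 by rewrite mulr_ge0 ?sqr_ge0// ltW.
  have -> : c * (y - (2 * c)^-1) ^+ 2 = c * y ^+ 2 - y + (4 * c)^-1.
    by field; rewrite gt_eqF.
  lra.
apply: (@le_trans _ _ (\sum_(l < n) expR (4 * c)^-1 *
   (if (l <= k)%N then r ^+ (k - l) else r ^+ (l - k)))).
  by apply: ler_sum => l _; exact: pt.
rewrite -mulr_sumr.
have h : \sum_(l < n) (if (l <= k)%N then r ^+ (k - l) else r ^+ (l - k)) <=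
    (1 - r)^-1 + (1 - r)^-1.
  pose F l := if (l <= k)%N then r ^+ (k - l) else r ^+ (l - k).
  have F0 l : 0 <= F l by rewrite /F; case: ifP => _; rewrite exprn_ge0.
  rewrite -(big_mkord xpredT F).
  apply: (@le_trans _ _ (\sum_(0 <= l < k.+1 + n) F l)).
    rewrite [leRHS](@big_cat_nat _ _ _ n)//= ?leq_addl//.
    by rewrite lerDl sumr_ge0.
  rewrite (@big_cat_nat _ _ _ k.+1)//= ?leq_addr//.
  apply: lerD.
    rewrite big_mkord (reindex_inj rev_ord_inj)/=.
    rewrite (eq_bigr (fun i : 'I_k.+1 => r ^+ i)); first exact: sum_geometric_le.
    move=> i _; rewrite /F subSS leq_subr subKn//.
    by rewrite -ltnS.
  rewrite -{1}[k.+1]add0n big_addn addKn big_mkord.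
  apply: (@le_trans _ _ (\sum_(i < n) r ^+ i)); last exact: sum_geometric_le.
  apply: ler_sum => i _; rewrite /F ifF; last by apply/negbTE; rewrite -ltnNge; lia.
  by rewrite ler_wiXn2l// ?ltW//; lia.
have e0 : 0 <= expR (4 * c)^-1 by exact: expR_ge0.
apply: (le_trans (ler_wpM2l e0 h)).
rewrite mulrAC -mulrA mulrCA; rewrite -[leLHS]mulrC.
have : (1 - r)^-1 + (1 - r)^-1 <= 4 / s by lra.
move=> h2; have := ler_wpM2r e0 h2; lra.
Qed.

End fejer.

Section pair_bound.
Context {disp : measure_display} {T : measurableType disp} {R : realType}.
Variable P : probability T R.

Lemma integrable_bounded (f : T -> R) (M : R) :
  measurable_fun [set: T] f -> (forall w, `|f w| <= M) ->
  P.-integrable [set: T] (EFin \o f).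
Proof.
move=> mf fM; apply: (@le_integrable _ _ _ P _ measurableT _ (cst M%:E)).
- exact/measurable_EFinP.
- by move=> w _; rewrite !abse_EFin lee_fin (le_trans (fM w))// ler_norm.
- exact: finite_measure_integrable_cst.
Qed.

Lemma Rintegral_sum (I : Type) (r : seq I) (F : I -> T -> R) :
  (forall i, P.-integrable [set: T] (EFin \o F i)) ->
  P.-integrable [set: T] (EFin \o (fun w => \sum_(i <- r) F i w)) /\
  \int[P]_w (\sum_(i <- r) F i w) = \sum_(i <- r) \int[P]_w F i w.
Proof.
move=> iF; elim: r => [|i r [IH1 IH2]].
  have -> : (fun w : T => \sum_(i <- [::]) F i w) = cst 0.
    by apply/funext => w; rewrite big_nil.
  split; first exact: finite_measure_integrable_cst.
  by rewrite big_nil Rintegral_prob_cst.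
have -> : (fun w : T => \sum_(j <- i :: r) F j w) =
    (fun w => F i w + \sum_(j <- r) F j w).
  by apply/funext => w; rewrite big_cons.
split.
  have -> : EFin \o (fun w => F i w + \sum_(j <- r) F j w) =
    (fun w => (F i w)%:E + (\sum_(j <- r) F j w)%:E)%E by [].
  by apply: integrableD => //; exact: iF.
by rewrite RintegralD// IH2 big_cons.
Qed.

Lemma Rintegral_prob_indic (A : set T) : measurable A ->
  \int[P]_w \1_A w = fine (P A).
Proof. by move=> mA; rewrite /Rintegral integral_indic// setIT. Qed.

(** Here 512 is 16 * 2 * 16: the two lower bounds [n^2 / 4] of the kernels, the mesh [tau / 2] in
    the second variable, and [1 / n <= 4 e] squared. *)
Definition pair_cst (c : R) : R := 512 * (4 * expR (4 * c)^-1) ^+ 2.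

(** Markov's inequality with a product of two Fejer kernels as test function: it is at least
    [n^4 / 16] on the event, and its mean is a sum of cosines whose bounds factor into two Gaussian
    grid sums. The window of [W] has half-width [2 e] because [W] will be an increment between two
    values each known up to [e]. *)
Lemma pair_small_ball (c tau : R) (U W : T -> R) (y z e : R) :
  measurable_fun [set: T] U -> measurable_fun [set: T] W ->
  0 < c -> 0 < tau -> tau <= 1 ->
  (forall p q phi : R, `|\int[P]_w cos (p * U w + q * W w + phi)| <=
     expR (- (c * (p ^+ 2 + (q * tau) ^+ 2)))) ->
  0 < e -> e <= 2^-1 ->
  fine (P [set w | `|U w - y| <= e /\ `|W w - z| <= 2 * e]) <=
  pair_cst c * e ^+ 2 / tau.
Proof.
move=> mU mW c0 t0 t1 H e0 e1.
set A := [set w | _].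
have mA : measurable A.
  have -> : A = ((fun w => `|U w - y|) @^-1` [set` `]-oo, e]]) `&`
                ((fun w => `|W w - z|) @^-1` [set` `]-oo, 2 * e]]).
    by apply/seteqP; split => w; rewrite /A /= !in_itv/=.
  apply: measurableI; rewrite -[X in measurable X]setTI.
    have m1 : measurable_fun [set: T] (fun w => `|U w - y|).
      by apply: measurableT_comp => //; exact: measurable_funB.
    by apply: m1.
  have m1 : measurable_fun [set: T] (fun w => `|W w - z|).
    by apply: measurableT_comp => //; exact: measurable_funB.
  by apply: m1.
(* The largest [n] with [n e <= 1/2], the condition for the lower bound of the kernels; being
   largest, it also satisfies [1 / n <= 4 e]. *)
pose n := Num.truncn (2 * e)^-1.
have n0 : (0 < n)%N by rewrite /n truncn_gt0 invf_ge1//; lra.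
have nR : (0 : R) < n%:R by rewrite ltr0n.
have /andP[ne1 ne2] : n%:R <= (2 * e)^-1 < n.+1%:R.
  by apply: truncn_itv; rewrite invr_ge0; lra.
have ne : n%:R * e <= 2^-1.
  have := ler_wpM2r (ltW e0) ne1.
  by have -> : (2 * e)^-1 * e = 2^-1 by field; rewrite gt_eqF.
have en : n%:R^-1 <= 4 * e.
  have h : 1 < n.+1%:R * (2 * e).
    by rewrite -ltr_pdivrMr ?mul1r// mulr_gt0.
  rewrite -[leLHS]mul1r ler_pdivrMr//.
  have : n.+1%:R <= 2 * n%:R :> R by rewrite -natrM ler_nat; lia.
  nra.
pose G w := fejer n (U w - y) * fejer n ((W w - z) / 2).
pose I := ('I_n * 'I_n)%type.
pose D (i : I) : R := i.1%:R - i.2%:R.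
(* [f1] and [f2] are the two cosines in the product formula for [cos u * cos v]; each is the cosine
   of one linear combination of [U] and [W], as the hypothesis requires. *)
pose f1 (x : I * I) w :=
   cos (D x.1 * U w + (D x.2 / 2) * W w + (- (D x.1 * y) - D x.2 / 2 * z)).
pose f2 (x : I * I) w :=
   cos (D x.1 * U w + (- (D x.2 / 2)) * W w + (- (D x.1 * y) + D x.2 / 2 * z)).
have GE w : G w = \sum_(x : I * I) 2^-1 * (f1 x w + f2 x w).
  rewrite /G /fejer big_distrlr/= pair_bigA/=; apply: eq_bigr => -[i j] _ /=.
  rewrite /f1 /f2 /=.
  set a := D i * _ + _ + _; set b := D i * _ + _ + _.
  have -> : a = D i * (U w - y) + D j * ((W w - z) / 2).
    by rewrite /a; ring.
  have -> : b = D i * (U w - y) - D j * ((W w - z) / 2).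
    by rewrite /b; ring.
  by rewrite cosD cosB /D; field.
have mlin (p q phi : R) : measurable_fun [set: T] (fun w => cos (p * U w + q * W w + phi)).
  apply: (measurableT_comp (continuous_measurable_fun (@continuous_cos R))).
  apply: measurable_funD => //; apply: measurable_funD; exact: measurable_funM.
have icos (p q phi : R) :
    P.-integrable [set: T] (EFin \o (fun w => cos (p * U w + q * W w + phi))).
  by apply: (@integrable_bounded _ 1) => // w; exact: cos_max.
have if12 (x : I * I) : P.-integrable [set: T]
    (EFin \o (fun w => 2^-1 * (f1 x w + f2 x w))).
  have -> : EFin \o (fun w => 2^-1 * (f1 x w + f2 x w)) =
     (fun w => (2^-1)%:E * ((f1 x w)%:E + (f2 x w)%:E))%E.
    by apply/funext => w; rewrite /= EFinM.
  by apply: integrableZl => //; apply: integrableD => //; exact: icos.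
have [iG EG] := Rintegral_sum (index_enum (I * I)%type) if12.
have GE' : G = (fun w => \sum_(x : I * I) 2^-1 * (f1 x w + f2 x w)).
  by apply/funext => w; exact: GE.
have GA : n%:R ^+ 4 / 16 * fine (P A) <= \int[P]_w G w.
  rewrite -Rintegral_prob_indic// -RintegralZl//; last first.
    by apply: (@integrable_bounded _ 1) => // w; rewrite indicE; case: (_ \in _); rewrite ?normr1 ?normr0.
  apply: le_Rintegral => //.
  - apply: (@integrable_bounded _ (n%:R ^+ 4 / 16)).
      by apply: measurable_funM.
    move=> w; rewrite normrM ger0_norm; last by rewrite divr_ge0// exprn_ge0.
    rewrite ler_piMr ?divr_ge0 ?exprn_ge0//.
    by rewrite indicE; case: (_ \in _); rewrite ?normr1 ?normr0.
  - by rewrite GE'.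
  - move=> w _; rewrite indicE; have [|_] := boolP (w \in A); last first.
      by rewrite mulr0 mulr_ge0 ?fejer_ge0.
    rewrite inE => -[Aw1 Aw2]; rewrite mulr1 /G.
    have -> : n%:R ^+ 4 / 16 = (n%:R ^+ 2 / 4) * (n%:R ^+ 2 / 4) :> R by field.
    apply: ler_pM; rewrite ?divr_ge0 ?exprn_ge0//.
      by apply: fejer_lb; rewrite (le_trans _ ne)// ler_wpM2l.
    apply: fejer_lb; rewrite (le_trans _ ne)// ler_wpM2l// normrM.
    by rewrite (ger0_norm (_ : 0 <= 2^-1))//; lra.
pose K : R := 4 * expR (4 * c)^-1.
have GB : \int[P]_w G w <= n%:R * K * (n%:R * (2 * K / tau)).
  rewrite GE' EG.
  apply: (@le_trans _ _ (\sum_(x : I * I)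
     expR (- (c * (D x.1 * 1) ^+ 2)) * expR (- (c * (D x.2 * (tau / 2)) ^+ 2)))).
    apply: ler_sum => x _.
    rewrite RintegralZl//; last first.
      rewrite (_ : EFin \o _ = fun w => (f1 x w)%:E + (f2 x w)%:E)%E//.
      by apply: integrableD => //; exact: icos.
    rewrite RintegralD//; [|exact: icos|exact: icos].
    have h1 := le_trans (ler_norm _) (H (D x.1) (D x.2 / 2) (- (D x.1 * y) - D x.2 / 2 * z)).
    have h2 := le_trans (ler_norm _) (H (D x.1) (- (D x.2 / 2)) (- (D x.1 * y) + D x.2 / 2 * z)).
    rewrite -expRD.
    set X := expR _ in h1; set Y := expR _ in h2.
    have -> : - (c * (D x.1 * 1) ^+ 2) + - (c * (D x.2 * (tau / 2)) ^+ 2) =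
      - (c * (D x.1 ^+ 2 + (D x.2 / 2 * tau) ^+ 2)) by field.
    rewrite -/X; have XY : Y = X by rewrite /X /Y; congr expR; field.
    rewrite XY in h2; move: h1 h2; rewrite /f1 /f2; lra.
  rewrite -(pair_bigA _ (fun i j : I => expR (- (c * (D i * 1) ^+ 2)) *
     expR (- (c * (D j * (tau / 2)) ^+ 2))))/=.
  rewrite -big_distrlr/=.
  (* Applied with mesh 1 for [U] and mesh [tau / 2] for the halved [W]; the latter yields the factor
     [1 / tau]. *)
  have S (s : R) : 0 < s -> s <= 1 ->
      \sum_(i : I) expR (- (c * (D i * s) ^+ 2)) <= n%:R * (K / s).
    move=> s0 s1.
    rewrite -(pair_bigA _ (fun k l : 'I_n => expR (- (c * ((k%:R - l%:R) * s) ^+ 2))))/=.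
    apply: (@le_trans _ _ (\sum_(k < n) K / s)).
      by apply: ler_sum => k _; exact: sum_gauss_le.
    by rewrite sumr_const card_ord mulr_natl.
  apply: ler_pM.
  - by apply: sumr_ge0 => i _; exact: expR_ge0.
  - by apply: sumr_ge0 => i _; exact: expR_ge0.
  - by have := S 1 ltr01 (lexx 1); rewrite divr1.
  - have := S (tau / 2); have -> : K / (tau / 2) = 2 * K / tau.
      by field; rewrite gt_eqF.
    by apply; lra.
have K0 : 0 <= K by rewrite mulr_ge0 ?expR_ge0.
have := le_trans GA GB.
rewrite -ler_pdivlMl; last by rewrite divr_gt0// exprn_gt0.
move=> h; apply: (le_trans h).
have -> : (n%:R ^+ 4 / 16)^-1 * (n%:R * K * (n%:R * (2 * K / tau))) =
   (32 * K ^+ 2 / tau) * (n%:R^-1) ^+ 2.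
  by field; rewrite !gt_eqF.
have -> : pair_cst c * e ^+ 2 / tau = (32 * K ^+ 2 / tau) * (4 * e) ^+ 2.
  by rewrite /pair_cst -/K; ring.
apply: ler_wpM2l.
  by rewrite divr_ge0 ?mulr_ge0 ?sqr_ge0// ltW.
rewrite lerXn2r ?nnegrE ?invr_ge0//.
by rewrite mulr_ge0// ltW.
Qed.

End pair_bound.

(** * Lower bound for the variance form of two values of the process *)

Section local_nondeterminism.
Context {R : realType}.

Lemma powR_le2l (r x y : R) : 0 <= r -> 0 <= x -> x <= y -> x `^ r <= y `^ r.
Proof.
by move=> r0 x0 xy; rewrite ge0_ler_powR ?nnegrE// (le_trans x0).
Qed.

Lemma powR_le1 (r x : R) : 0 <= r -> 0 <= x -> x <= 1 -> x `^ r <= 1.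
Proof. by move=> r0 x0 x1; have := powR_le2l r0 x0 x1; rewrite powR1. Qed.

Lemma sqr_le2 (x y : R) : 0 <= x -> x <= y -> x ^+ 2 <= y ^+ 2.
Proof. by move=> x0 xy; rewrite lerXn2r ?nnegrE// (le_trans x0). Qed.

(* Makes the triangle inequality between standard deviations strict, uniformly in
   s < t: this keeps the normalized determinant of (X s, X t) away from 0. *)
Lemma powR_increment_le (a H s t : R) : 0 < a -> 0 < H -> H < 1 ->
  a <= s -> s < t -> t <= 1 ->
  t `^ H <= s `^ H + (1 + a) `^ (H - 1) * (t - s) `^ H.
Proof.
move=> a0 H0 H1 as_ st t1.
have s0 : 0 < s by exact: lt_le_trans as_.
have t0 : 0 < t by exact: lt_trans st.
have h0 : 0 < t - s by rewrite subr_gt0.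
have K0 : 0 < 1 - H by rewrite subr_gt0.
(* Writing [t^H = (s + (t - s)) / t^(1 - H)], the first part is at most [s^H]; the second gains the
   factor because [(1 + a) (t - s) <= t], which holds as [t - s <= 1] and [a <= s]. *)
have E (x : R) : 0 < x -> x `^ H = x * (x `^ (1 - H))^-1.
  move=> x0; rewrite powRB ?gt_eqF ?implybT// powRr1 ?ltW// invf_div mulrCA.
  by rewrite divff ?mulr1// gt_eqF.
rewrite (E t)// {1}(_ : t = s + (t - s)); last by rewrite addrC subrK.
rewrite mulrDl; apply: lerD.
  rewrite (E s)//; apply: ler_wpM2l; first exact: ltW.
  by rewrite lef_pV2 ?posrE ?powR_gt0//; apply: powR_le2l; exact: ltW.
rewrite (E (t - s))// mulrCA; apply: ler_wpM2l; first exact: ltW.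
have -> : (1 + a) `^ (H - 1) = ((1 + a) `^ (1 - H))^-1.
  by rewrite -powRN opprB.
have a1 : 0 < 1 + a by rewrite addr_gt0.
rewrite -invfM lef_pV2 ?posrE ?mulr_gt0 ?powR_gt0//.
have hh : (t - s) * (1 + a) <= t.
  have : (t - s) * a <= 1 * a by apply: ler_wpM2r; lra.
  lra.
have h2 : 0 <= (t - s) * (1 + a) by apply: mulr_ge0; lra.
rewrite -powRM; [|lra|lra].
by apply: powR_le2l => //; rewrite 1?mulrC// ltW.
Qed.

(* Sylvester: for a positive semidefinite 2x2 matrix, lambda_min >= det / tr. *)
Lemma quadratic_form_lb (x y tau rho : R) (p q : R) :
  0 < x -> x <= 1 -> 0 < tau -> x <= y -> tau <= y -> y <= x + rho * tau -> rho <= 1 ->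
  (1 - rho) * x ^+ 2 / 4 * (p ^+ 2 + (q * tau) ^+ 2) <=
  p ^+ 2 * x ^+ 2 + p * q * (y ^+ 2 - x ^+ 2 - tau ^+ 2) + (q * tau) ^+ 2.
Proof.
move=> x0 x1 t0 xy ty yr r1.
(* For [x], [y], [tau] the standard deviations of [X s], [X t] and the increment, [g] is the
   covariance of [X s] with the increment normalized to variance 1. The matrix then has determinant
   [D = x^2 - g^2] and trace [x^2 + 1]. *)
pose g := (y ^+ 2 - x ^+ 2 - tau ^+ 2) / (2 * tau).
pose q' := q * tau.
have -> : p * q * (y ^+ 2 - x ^+ 2 - tau ^+ 2) = 2 * (p * q' * g).
  by rewrite /q' /g; field; rewrite gt_eqF.
rewrite -/q'.
set V := _ + _ + _.
pose D := x ^+ 2 - g ^+ 2.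
have VD : D * (p ^+ 2 + q' ^+ 2) <= (x ^+ 2 + 1) * V.
  rewrite -subr_ge0.
  have -> : (x ^+ 2 + 1) * V - D * (p ^+ 2 + q' ^+ 2) =
     (x ^+ 2 * p + g * q') ^+ 2 + (g * p + q') ^+ 2 by rewrite /V /D; ring.
  by rewrite addr_ge0 ?sqr_ge0.
(* Heron's factorization for a triangle with sides [x], [y], [tau]; the strict triangle inequality
   bounds its first factor below by [(1 - rho) tau]. *)
have DE : 4 * tau ^+ 2 * D = (x + tau - y) * (x + tau + y) * ((y - tau + x) * (y + tau - x)).
  by rewrite /D /g; field; rewrite gt_eqF.
have D0 : (1 - rho) * x ^+ 2 / 2 <= D.
  have t2 : 0 < 4 * tau ^+ 2 by rewrite mulr_gt0// exprn_gt0.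
  rewrite -(ler_pM2l t2) DE.
  have -> : 4 * tau ^+ 2 * ((1 - rho) * x ^+ 2 / 2) =
     ((1 - rho) * tau * (2 * x)) * (x * tau) by field.
  apply: ler_pM.
  - by rewrite !mulr_ge0 ?subr_ge0// ltW.
  - by rewrite mulr_ge0 ?ltW.
  - apply: ler_pM; [|lra|lra|lra].
    by apply: mulr_ge0; [rewrite subr_ge0|exact: ltW].
  - apply: ler_pM; lra.
have n0 : 0 <= p ^+ 2 + q' ^+ 2 by rewrite addr_ge0 ?sqr_ge0.
have V0 : 0 <= V.
  have h1 : 0 <= (x ^+ 2 + 1) * V.
    apply: le_trans VD; rewrite mulr_ge0// (le_trans _ D0)//.
    by rewrite divr_ge0// mulr_ge0 ?subr_ge0 ?sqr_ge0.
  by rewrite pmulr_rge0 in h1 => //; rewrite ltr_wpDl ?sqr_ge0.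
have x2 : x ^+ 2 <= 1 by rewrite exprn_ile1// ltW.
have h2 : (1 - rho) * x ^+ 2 / 2 * (p ^+ 2 + q' ^+ 2) <= 2 * V.
  apply: (le_trans (ler_wpM2r n0 D0)); apply: (le_trans VD).
  by apply: ler_wpM2r => //; lra.
lra.
Qed.

End local_nondeterminism.

(** * Estimates for one-dimensional fractional Brownian motion *)

Section fbm_one.
Context {disp : measure_display} {T : measurableType disp} {R : realType}.
Variables (P : probability T R) (H : R) (X : R -> {RV P >-> R}).
Hypotheses (H0 : 0 < H) (H1 : H < 1) (fX : is_real_fbm H X).

Definition fbm_kernel (s t : R) : R :=
  2^-1 * (`|t| `^ (2 * H) + `|s| `^ (2 * H) - `|t - s| `^ (2 * H)).

Lemma fbm_measurable t : measurable_fun [set: T] (X t).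
Proof. exact: measurable_funP. Qed.

Lemma fbm_comb_gaussian (s t p q : R) : s \in `[0, 1] -> t \in `[0, 1] ->
  gaussian_rv P (fun w => p * X s w + q * X t w).
Proof.
move=> s01 t01; have [gX _ _ _] := fX.
have := gX 2 (fun j => if j == ord0 then s else t) (fun j => if j == ord0 then p else q).
have -> : (fun w => p * X s w + q * X t w) = (fun w => \sum_(j < 2)
   (if j == ord0 then p else q) * X (if j == ord0 then s else t) w).
  by apply/funext => w; rewrite big_ord_recl big_ord1/=.
by apply => j; case: ifP.
Qed.

Lemma fbm_gaussian t : t \in `[0, 1] -> gaussian_rv P (X t).
Proof.
move=> t01; have := fbm_comb_gaussian 1 0 t01 t01.
by under [X in gaussian_rv P X]eq_fun do rewrite mul1r mul0r addr0.
Qed.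

Lemma fbm_integrable t : t \in `[0, 1] ->
  P.-integrable [set: T] (fun w => (X t w)%:E) /\
  P.-integrable [set: T] (fun w => (X t w ^+ 2)%:E).
Proof.
by move=> t01; apply: gaussian_rv_integrable; [exact: fbm_measurable|exact: fbm_gaussian].
Qed.

Lemma fbm_mean t : t \in `[0, 1] -> \int[P]_w X t w = 0.
Proof.
move=> t01; have [_ EX _ _] := fX.
by rewrite /Rintegral -expectation_def EX.
Qed.

Lemma fbm_covariance s t : s \in `[0, 1] -> t \in `[0, 1] ->
  P.-integrable [set: T] (fun w => (X s w * X t w)%:E) /\
  \int[P]_w (X s w * X t w) = fbm_kernel s t.
Proof.
move=> s01 t01; have [_ EX CX _] := fX.
have [_ s2] := fbm_integrable s01; have [_ t2] := fbm_integrable t01.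
split.
  apply: (@le_integrable _ _ _ P _ measurableT _
     (fun w => (X s w ^+ 2)%:E + (X t w ^+ 2)%:E)%E).
  - by apply/measurable_EFinP; apply: measurable_funM; exact: fbm_measurable.
  - move=> w _; rewrite -EFinD !abse_EFin lee_fin; apply: le_trans (ler_norm _).
    rewrite normrM -[X s w ^+ 2]ger0_norm ?sqr_ge0// -[X t w ^+ 2]ger0_norm ?sqr_ge0//.
    rewrite !normrX; have := sqr_ge0 (`|X s w| - `|X t w|).
    have : 0 <= `|X s w| by []. have : 0 <= `|X t w| by [].
    by rewrite !expr2; nra.
  - exact: integrableD.
have := CX s t s01 t01; rewrite unlock !EX// /= => h.
rewrite /fbm_kernel /Rintegral -[RHS]/(fine (_%:E)) -h unlock.
congr fine; apply: eq_integral => w _.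
change ((X s w * X t w)%:E = ((X s w - 0) * (X t w - 0))%:E).
by rewrite !subr0.
Qed.

Lemma fbm_comb_variance (s t p q : R) : s \in `[0, 1] -> t \in `[0, 1] ->
  \int[P]_w (p * X s w + q * X t w) = 0 /\
  \int[P]_w (p * X s w + q * X t w) ^+ 2 =
    p ^+ 2 * fbm_kernel s s + 2 * p * q * fbm_kernel s t + q ^+ 2 * fbm_kernel t t.
Proof.
move=> s01 t01.
have [is1 _] := fbm_integrable s01; have [it1 _] := fbm_integrable t01.
have iZ (f : T -> R) (k : R) : P.-integrable [set: T] (fun w => (f w)%:E) ->
    P.-integrable [set: T] (fun w => (k * f w)%:E).
  by move=> i; under eq_fun do rewrite EFinM; exact: integrableZl.
have iD (f g : T -> R) : P.-integrable [set: T] (fun w => (f w)%:E) ->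
    P.-integrable [set: T] (fun w => (g w)%:E) ->
    P.-integrable [set: T] (fun w => (f w + g w)%:E).
  by move=> i j; under eq_fun do rewrite EFinD; exact: integrableD.
split.
  rewrite (@RintegralD _ _ _ P _ (fun w => p * X s w) (fun w => q * X t w))//; [|exact: iZ..].
  by rewrite !RintegralZl// !fbm_mean// !mulr0 addr0.
have [iss Ess] := fbm_covariance s01 s01.
have [ist Est] := fbm_covariance s01 t01.
have [itt Ett] := fbm_covariance t01 t01.
transitivity (\int[P]_w ((p ^+ 2 * (X s w * X s w) + 2 * p * q * (X s w * X t w)) +
   q ^+ 2 * (X t w * X t w))).
  by apply: eq_Rintegral => w _; ring.
rewrite (@RintegralD _ _ _ P _ (fun w => p ^+ 2 * (X s w * X s w) + 2 * p * q * (X s w * X t w))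
  (fun w => q ^+ 2 * (X t w * X t w)))//; last 2 first.
- by apply: iD; exact: iZ.
- exact: iZ.
rewrite (@RintegralD _ _ _ P _ (fun w => p ^+ 2 * (X s w * X s w))
  (fun w => 2 * p * q * (X s w * X t w)))//; [|exact: iZ..].
by rewrite !RintegralZl// Ess Est Ett.
Qed.

Lemma fbm_kernel_diag (t : R) : 0 <= t -> fbm_kernel t t = t `^ (2 * H).
Proof.
move=> t0; rewrite /fbm_kernel subrr normr0 ger0_norm// powR0; last by rewrite mulf_neq0// gt_eqF.
by rewrite subr0; field.
Qed.

Lemma powR2 (t : R) : t `^ (2 * H) = (t `^ H) ^+ 2.
Proof. by rewrite mulrC powRrM powR_mulrn// powR_ge0. Qed.

Lemma fbm_law (t : R) (A : set R) : 0 < t -> t <= 1 -> measurable A ->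
  P (X t @^-1` A) = normal_prob 0 (t `^ H) A.
Proof.
move=> t0 t1 mA.
have t01 : t \in `[0, 1] by rewrite in_itv/= ltW.
have [s [s0 s2 law _]] :=
  centered_gaussian_rv_spec (fbm_measurable t) (fbm_gaussian t01) (fbm_mean t01).
have -> : t `^ H = s; last first.
  apply: law => //; apply/eqP => s00; move: s2; rewrite s00 expr0n/=.
  under eq_Rintegral do rewrite expr2.
  rewrite (fbm_covariance t01 t01).2 fbm_kernel_diag ?ltW// => /esym/eqP.
  by rewrite gt_eqF// powR_gt0.
move: s2; under eq_Rintegral do rewrite expr2.
rewrite (fbm_covariance t01 t01).2 fbm_kernel_diag ?ltW// powR2 => /eqP.
rewrite eqrXn2// ?powR_ge0// => /eqP.
by move->.
Qed.

Lemma fbm_increment_law (s t : R) (A : set R) : s \in `[0, 1] -> t \in `[0, 1] ->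
  s != t -> measurable A ->
  P ((fun w => X t w - X s w) @^-1` A) = normal_prob 0 (`|t - s| `^ H) A.
Proof.
move=> s01 t01 st mA.
have E : (fun w => X t w - X s w) = (fun w => (-1) * X s w + 1 * X t w).
  by apply/funext => w; ring.
have mZ : measurable_fun [set: T] (fun w => (-1) * X s w + 1 * X t w).
  by apply: measurable_funD; apply: measurable_funM => //; exact: fbm_measurable.
have [EZ VZ] := fbm_comb_variance (-1) 1 s01 t01.
have [r [r0 r2 law _]] := centered_gaussian_rv_spec mZ (fbm_comb_gaussian (-1) 1 s01 t01) EZ.
have r2E : r ^+ 2 = (`|t - s| `^ H) ^+ 2.
  rewrite r2 VZ -powR2; move: s01 t01; rewrite !in_itv/= => /andP[s0 _] /andP[t0 _].
  by rewrite !fbm_kernel_diag// /fbm_kernel (ger0_norm s0) (ger0_norm t0); field.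
have rE : r = `|t - s| `^ H.
  by apply/eqP; rewrite -(eqrXn2 (ltn0Sn 1))// ?powR_ge0//; exact/eqP.
rewrite E -rE; apply: law => //.
by rewrite rE gt_eqF// powR_gt0// normr_gt0 subr_eq0 eq_sym.
Qed.

Lemma fbm_ball_measurable (t y e : R) : measurable [set w | `|X t w - y| <= e].
Proof.
have -> : [set w | `|X t w - y| <= e] = X t @^-1` [set` `[y - e, y + e]].
  apply/seteqP; split => w /=; rewrite in_itv/= ler_norml => /andP[h1 h2]; apply/andP; split; lra.
rewrite -[X in measurable X]setTI; exact: fbm_measurable.
Qed.

Lemma fbm_ball_prob (t y e : R) : 0 < t -> t <= 1 ->
  P [set w | `|X t w - y| <= e] = normal_prob 0 (t `^ H) [set` `[y - e, y + e]].
Proof.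
move=> t0 t1; rewrite -fbm_law//; congr (P _).
by apply/seteqP; split => w /=; rewrite in_itv/= ler_norml => /andP[h1 h2]; apply/andP; split; lra.
Qed.

Lemma fbm_small_ball_le (a t y e : R) : 0 < a -> a <= t -> t <= 1 -> 0 < e ->
  (P [set w | (`|X t w - y| <= e)%R] <= (2 * normal_peak (a `^ H) * e)%:E)%E.
Proof.
move=> a0 at_ t1 e0; have t0 : 0 < t by exact: lt_le_trans at_.
rewrite fbm_ball_prob//; apply: le_trans (normal_prob_ball_le _ _ e0) _.
  by rewrite gt_eqF// powR_gt0.
rewrite lee_fin mulrCA mulrA; apply: ler_wpM2r; first exact: ltW.
rewrite ler_pM2l//.
rewrite /normal_peak lef_pV2 ?posrE ?sqrtr_gt0 ?pmulrn_lgt0 ?mulr_gt0 ?exprn_gt0 ?powR_gt0 ?pi_gt0//.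
rewrite ler_sqrt ?pmulrn_lgt0 ?mulr_gt0 ?exprn_gt0 ?powR_gt0 ?pi_gt0//.
  rewrite lerMn2r/= ler_wpM2r ?pi_ge0//.
  by apply: sqr_le2; rewrite ?powR_ge0//; apply: powR_le2l => //; exact: ltW.
by rewrite mulrn_wge0// mulr_ge0 ?sqr_ge0 ?pi_ge0.
Qed.

(** For uniformity over [[a, 1]] the peak is taken at the largest standard deviation, 1, and the
    exponent at the smallest, [a^H]. *)
Lemma fbm_small_ball_ge (a t y e M : R) : 0 < a -> a <= t -> t <= 1 -> 0 < e ->
  `|y| + e <= M ->
  ((2 * normal_peak 1 * expR (- M ^+ 2 / ((a `^ H) ^+ 2 *+ 2)) * e)%:E <=
   P [set w | (`|X t w - y| <= e)%R])%E.
Proof.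
move=> a0 at_ t1 e0 yM; have t0 : 0 < t by exact: lt_le_trans at_.
have tH : t `^ H != 0 by rewrite gt_eqF// powR_gt0.
rewrite fbm_ball_prob//; apply: le_trans (normal_prob_ball_ge tH e0 yM).
rewrite lee_fin normal_pdfE//.
rewrite [leRHS]mulrCA [leRHS]mulrA.
apply: ler_wpM2r; first exact: ltW.
rewrite -mulrA ler_pM2l//.
have tH0 : 0 < t `^ H by rewrite powR_gt0.
have aH0 : 0 < a `^ H by rewrite powR_gt0.
have tH1 : t `^ H <= 1.
  by apply: powR_le1 => //; exact: ltW.
have atH : a `^ H <= t `^ H by apply: powR_le2l => //; exact: ltW.
apply: ler_pM; rewrite ?normal_peak_ge0 ?expR_ge0//.
  rewrite /normal_peak lef_pV2 ?posrE ?sqrtr_gt0 ?pmulrn_lgt0 ?mulr_gt0 ?exprn_gt0 ?pi_gt0//.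
  rewrite ler_sqrt ?pmulrn_lgt0 ?mulr_gt0 ?exprn_gt0 ?pi_gt0//.
    rewrite lerMn2r/= ler_wpM2r ?pi_ge0//.
    by apply: sqr_le2 => //; exact: ltW.
  by rewrite mulrn_wge0// mulr_ge0 ?sqr_ge0 ?pi_ge0.
rewrite /normal_fun subr0 ler_expR !mulNr lerN2 ler_wpM2l ?sqr_ge0//.
rewrite lef_pV2 ?posrE ?pmulrn_lgt0 ?exprn_gt0// lerMn2r/=.
by apply: sqr_le2 => //; exact: ltW.
Qed.

(** Only an upper bound [r] of the distance enters, as chaining knows just the length of a piece.
    Equal times are set apart since their increment is degenerate. *)
Lemma fbm_increment_tail (s t r x : R) : s \in `[0, 1] -> t \in `[0, 1] ->
  `|t - s| <= r -> 0 < r -> 0 <= x ->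
  (P [set w | (x < `|X t w - X s w|)%R] <=
   (2 * expR (- (x ^+ 2 / (4 * (r `^ H) ^+ 2))))%:E)%E.
Proof.
move=> s01 t01 tsr r0 x0.
have [->|st] := eqVneq s t.
  rewrite (_ : [set w | _] = set0) ?measure0 ?lee_fin ?mulr_ge0 ?expR_ge0//.
  by apply/seteqP; split => w //=; rewrite subrr normr0 ltNge x0.
have mA : measurable [set y : R | x < `|y|].
  have -> : [set y : R | x < `|y|] = setT `&` (Num.norm @^-1` [set` `]x, +oo[]).
    by apply/seteqP; split => y /=; rewrite in_itv/= andbT => // -[].
  exact: (@normr_measurable _ setT).
have ts0 : 0 < `|t - s| by rewrite normr_gt0 subr_eq0 eq_sym.
have d0 : 0 < `|t - s| `^ H by rewrite powR_gt0.
rewrite -[X in P X]/((fun w => X t w - X s w) @^-1` [set y : R | x < `|y|]).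
rewrite fbm_increment_law//; apply: (le_trans (normal_prob_tail _ x0)).
  by rewrite gt_eqF.
rewrite lee_fin ler_pM2l// ler_expR lerN2 ler_wpM2l ?sqr_ge0//.
rewrite lef_pV2 ?posrE ?mulr_gt0 ?exprn_gt0 ?powR_gt0// ler_pM2l//.
by apply: sqr_le2; rewrite ?powR_ge0//; apply: powR_le2l => //; exact: ltW.
Qed.

(** The constant of the quadratic form with [rho = (1 + a)^(H - 1)], halved by the [1/2] in the
    exponent of the characteristic function. *)
Definition fbm_lnd_cst (a : R) : R :=
  (1 - (1 + a) `^ (H - 1)) * (a `^ H) ^+ 2 / 8.

Lemma fbm_lnd_cst_gt0 (a : R) : 0 < a -> 0 < fbm_lnd_cst a.
Proof.
move=> a0; rewrite divr_gt0// mulr_gt0 ?exprn_gt0 ?powR_gt0// subr_gt0.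
have -> : H - 1 = - (1 - H) by rewrite opprB.
rewrite powRN invf_lt1 ?powR_gt0 ?addr_gt0//.
have h : 0 < 1 - H by rewrite subr_gt0.
have := @gt0_ltr_powR _ (1 - H) h 1 (1 + a).
by rewrite powR1; apply; rewrite ?nnegrE ?addr_ge0 ?ltW ?ltrDl.
Qed.

(** Local nondeterminism in Fourier form. In the coordinates [X s] and [X t - X s] the variance is
    comparable to a diagonal form, so the exponential splits over the two frequencies. *)
Lemma fbm_pair_cos (a s t p q phi : R) : 0 < a -> a <= s -> s < t -> t <= 1 ->
  `|\int[P]_w cos (p * X s w + q * (X t w - X s w) + phi)| <=
  expR (- (fbm_lnd_cst a * (p ^+ 2 + (q * (t - s) `^ H) ^+ 2))).
Proof.
move=> a0 as_ st t1.
have s0 : 0 < s by exact: lt_le_trans as_.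
have t0 : 0 < t by exact: lt_trans st.
have s01 : s \in `[0, 1] by rewrite in_itv/= ltW//= (le_trans (ltW st)).
have t01 : t \in `[0, 1] by rewrite in_itv/= ltW.
have -> : \int[P]_w cos (p * X s w + q * (X t w - X s w) + phi) =
   \int[P]_w cos (((p - q) * X s w + q * X t w) + phi).
  by apply: eq_Rintegral => w _; congr (cos (_ + _)); ring.
have mZ : measurable_fun [set: T] (fun w => (p - q) * X s w + q * X t w).
  by apply: measurable_funD; apply: measurable_funM => //; exact: fbm_measurable.
have [EZ VZ] := fbm_comb_variance (p - q) q s01 t01.
have [r [r0 r2 _ bnd]] := centered_gaussian_rv_spec mZ (fbm_comb_gaussian (p - q) q s01 t01) EZ.
apply: (le_trans (bnd phi)); rewrite ler_expR lerN2 r2 VZ.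
rewrite (fbm_kernel_diag (ltW s0)) (fbm_kernel_diag (ltW t0)) /fbm_kernel.
rewrite !gtr0_norm ?subr_gt0// !powR2.
have rho1 : (1 + a) `^ (H - 1) <= 1.
  have := fbm_lnd_cst_gt0 a0; rewrite /fbm_lnd_cst pmulr_lgt0// pmulr_lgt0 ?exprn_gt0 ?powR_gt0//.
  by rewrite subr_gt0 => /ltW.
have xy : s `^ H <= t `^ H by apply: powR_le2l; exact: ltW.
have ty : (t - s) `^ H <= t `^ H.
  by apply: powR_le2l; [exact: ltW|rewrite subr_ge0 ltW|rewrite gerBl ltW].
have x1 : s `^ H <= 1.
  apply: powR_le1; first exact: ltW.
    by lra.
  by lra.
have ts0 : 0 < (t - s) `^ H by rewrite powR_gt0 ?subr_gt0.
have := quadratic_form_lb p q (powR_gt0 H s0) x1 ts0 xy ty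
  (powR_increment_le a0 H0 H1 as_ st t1) rho1.
have ax : (a `^ H) ^+ 2 <= (s `^ H) ^+ 2.
  by apply: sqr_le2; rewrite ?powR_ge0//; apply: powR_le2l => //; exact: ltW.
rewrite /fbm_lnd_cst.
move: (s `^ H) (t `^ H) ((t - s) `^ H) (a `^ H) ((1 + a) `^ (H - 1)) rho1 ax => x y tau al rho r1 ax h.
have h3 : (1 - rho) * al ^+ 2 / 8 * (p ^+ 2 + (q * tau) ^+ 2) <=
   (1 - rho) * x ^+ 2 / 8 * (p ^+ 2 + (q * tau) ^+ 2).
  apply: ler_wpM2r; first by rewrite addr_ge0 ?sqr_ge0.
  apply: ler_wpM2r => //; apply: ler_wpM2l => //; by rewrite subr_ge0.
apply: (le_trans h3).
have := h; lra.
Qed.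

(** Two values known up to [e] determine their increment up to [2 e]; the estimate for the pair of
    value and increment then applies with [tau = (t - s)^H]. *)
Lemma fbm_pair_small_ball (a s t y z e : R) : 0 < a ->
  a <= s -> s <= 1 -> a <= t -> t <= 1 -> s != t -> 0 < e -> e <= 2^-1 ->
  (P ([set w | (`|X s w - y| <= e)%R] `&` [set w | (`|X t w - z| <= e)%R]) <=
  (pair_cst (fbm_lnd_cst a) * e ^+ 2 / `|s - t| `^ H)%:E)%E.
Proof.
move=> a0; wlog st : s t y z / s < t.
  move=> W as_ s1 at_ t1 st e0 e1; have [lt|lt|E] := ltgtP s t.
  - exact: W.
  - by rewrite setIC distrC; apply: W => //; rewrite eq_sym.
  - by rewrite E eqxx in st.
move=> as_ s1 at_ t1 _ e0 e1.
have s0 : 0 < s by exact: lt_le_trans as_.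
pose A := [set w | `|X s w - y| <= e /\ `|(X t w - X s w) - (z - y)| <= 2 * e].
have mW : measurable_fun [set: T] (fun w => X t w - X s w).
  by apply: measurable_funB; exact: fbm_measurable.
have ts1 : (t - s) `^ H <= 1.
  apply: powR_le1; first exact: ltW.
    by lra.
  by lra.
have ts0 : 0 < (t - s) `^ H by rewrite powR_gt0 ?subr_gt0.
have := pair_small_ball y (z - y) (fbm_measurable s) mW (fbm_lnd_cst_gt0 a0) ts0 ts1
   (fun p q phi => fbm_pair_cos p q phi a0 as_ st t1) e0 e1.
rewrite -/A distrC (gtr0_norm (_ : 0 < t - s)) ?subr_gt0// => h.
have mA : measurable A.
  have -> : A = [set w | `|X s w - y| <= e] `&`
      ((fun w => X t w - X s w) @^-1` [set` `[(z - y) - 2 * e, (z - y) + 2 * e]]).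
    by apply/seteqP; split => w; rewrite /A /= in_itv/= !ler_norml => -[-> /andP[h1 h2]];
      split => //; apply/andP; split; lra.
  apply: measurableI; first exact: fbm_ball_measurable.
  by rewrite -[X in measurable X]setTI; exact: mW.
apply: (@le_trans _ _ (P A)).
  apply: le_measure; rewrite ?inE//.
    by apply: measurableI; exact: fbm_ball_measurable.
  move=> w [/= h1 h2]; split => //.
  by move: h1 h2; rewrite !ler_norml => /andP[? ?] /andP[? ?]; apply/andP; split; lra.
rewrite -lee_fin fineK in h; first exact: h.
exact: fin_num_measure.
Qed.

End fbm_one.

(** * Cantor sets as ranges of jump functions *)

Section jump_function.
Context {R : realType}.

Definition dyadic_trunc (j : nat) (u : R) : nat := Num.truncn (2 ^+ j * u).

Definition dyadic_floor (n : nat) (u : R) : R := (dyadic_trunc n u)%:R / 2 ^+ n.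

Lemma pow2_gt0 n : 0 < 2 ^+ n :> R. Proof. by rewrite exprn_gt0. Qed.
Hint Resolve pow2_gt0 : core.

Lemma dyadic_truncP j (u : R) : 0 <= u ->
  (dyadic_trunc j u)%:R <= 2 ^+ j * u < (dyadic_trunc j u).+1%:R.
Proof. by move=> u0; apply: truncn_itv; rewrite mulr_ge0// ltW. Qed.

Lemma le_dyadic_trunc j (u v : R) : u <= v -> (dyadic_trunc j u <= dyadic_trunc j v)%N.
Proof. by move=> uv; apply: le_truncn; rewrite ler_pM2l. Qed.

Lemma dyadic_trunc_ge j (u : R) k : 0 <= u -> (k <= dyadic_trunc j u)%N = (k%:R <= 2 ^+ j * u).
Proof. by move=> u0; rewrite truncn_ge_nat// mulr_ge0// ltW. Qed.

Lemma dyadic_trunc_lt j (u : R) : 0 <= u -> u < 1 -> (dyadic_trunc j u < 2 ^ j)%N.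
Proof.
move=> u0 u1; rewrite /dyadic_trunc truncn_lt_nat; last by rewrite mulr_ge0// ltW.
by rewrite natrX -[ltRHS]mulr1 ltr_pM2l.
Qed.

Lemma dyadic_floor_ge0 n (u : R) : 0 <= dyadic_floor n u.
Proof. by rewrite divr_ge0// ltW. Qed.

Lemma dyadic_floor_le n (u : R) : 0 <= u -> dyadic_floor n u <= u.
Proof.
move=> u0; rewrite ler_pdivrMr// mulrC.
by have /andP[] := dyadic_truncP n u0.
Qed.

(** Passing to a coarser level means passing to an ancestor, so the binary tree of nodes is handled
    by integer division. *)
Lemma dyadic_trunc_coarse m n i : (m <= n)%N ->
  dyadic_trunc m (i%:R / 2 ^+ n : R) = (i %/ 2 ^ (n - m))%N.
Proof.
move=> mn; apply: truncn_def.
have -> : 2 ^+ m * (i%:R / 2 ^+ n) = i%:R / (2 ^ (n - m))%:R :> R.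
  rewrite natrX -{1}(subnK mn) exprD; field.
  by rewrite !gt_eqF.
have p : (0 < 2 ^ (n - m))%N by rewrite expn_gt0.
rewrite ler_pdivlMr ?ltr0n// ltr_pdivrMr ?ltr0n// -!natrM ler_nat ltr_nat.
by rewrite leq_divM/= ltn_ceil.
Qed.

Variables (a : R) (delta : nat -> R).
Hypothesis delta_gt0 : forall j, 0 < delta j.

(* A dyadic point of exact level j is a jump of size sum_(i >= j) delta i. *)
Definition jump_sum (u : R) (N : nat) : R :=
  \sum_(j < N) delta j * (dyadic_trunc j u)%:R.

Definition jump_fun (u : R) : R := a + limn (jump_sum u).

(** The range misses its left limits at the dyadic points, where it jumps; the closure supplies them
    and makes the set compact. *)
Definition jump_set : set R := closure (jump_fun @` [set` `[0, 1[]).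

Variable b : R.
Hypothesis delta_sum : forall N, \sum_(j < N) delta j * 2 ^+ j <= b - a.

Lemma jump_sum_le u N : 0 <= u -> u < 1 -> jump_sum u N <= b - a.
Proof.
move=> u0 u1; apply: le_trans (delta_sum N); apply: ler_sum => j _.
rewrite ler_pM2l// -natrX ler_nat ltnW//; exact: dyadic_trunc_lt.
Qed.

Lemma jump_sum_ge0 u N : 0 <= jump_sum u N.
Proof. by apply: sumr_ge0 => j _; rewrite mulr_ge0// ltW. Qed.

Lemma jump_sum_cvg u : 0 <= u -> u < 1 -> cvgn (jump_sum u).
Proof.
move=> u0 u1; apply: nondecreasing_is_cvgn.
  apply/nondecreasing_seqP => N; rewrite /jump_sum big_ord_recr/= lerDl.
  by rewrite mulr_ge0// ltW.
by exists (b - a) => _ [N _ <-]; exact: jump_sum_le.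
Qed.

Lemma jump_fun_diff_ge u v (c : R) (N0 : nat) : 0 <= u -> u < 1 -> 0 <= v -> v < 1 ->
  (forall N, (N0 <= N)%N -> c <= jump_sum v N - jump_sum u N) ->
  c <= jump_fun v - jump_fun u.
Proof.
move=> u0 u1 v0 v1 h; rewrite /jump_fun opprD addrACA subrr add0r.
rewrite -limB; [|exact: jump_sum_cvg..].
apply: limr_ge; first by apply: is_cvgB; exact: jump_sum_cvg.
by near=> N; apply: h; near: N; exists N0.
Unshelve. all: by end_near. Qed.

Lemma jump_fun_diff_le u v (c : R) : 0 <= u -> u < 1 -> 0 <= v -> v < 1 ->
  (forall N, jump_sum v N - jump_sum u N <= c) ->
  jump_fun v - jump_fun u <= c.
Proof.
move=> u0 u1 v0 v1 h; rewrite /jump_fun opprD addrACA subrr add0r.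
rewrite -limB; [|exact: jump_sum_cvg..].
apply: limr_le; first by apply: is_cvgB; exact: jump_sum_cvg.
by near=> N; apply: h.
Unshelve. all: by end_near. Qed.

Lemma jump_sumB u v N : jump_sum v N - jump_sum u N =
  \sum_(j < N) delta j * ((dyadic_trunc j v)%:R - (dyadic_trunc j u)%:R).
Proof. by rewrite /jump_sum -sumrB; apply: eq_bigr => j _; rewrite mulrBr. Qed.

(** Every term of the series of the difference is nonnegative, and the term of level [j] alone is at
    least [delta j]. *)
Lemma jump_fun_gap u v j : 0 <= u -> u <= v -> v < 1 ->
  (dyadic_trunc j u < dyadic_trunc j v)%N -> delta j <= jump_fun v - jump_fun u.
Proof.
move=> u0 uv v1 h; apply: (@jump_fun_diff_ge _ _ _ j.+1) => //.
- exact: le_lt_trans v1.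
- exact: le_trans uv.
move=> N jN; rewrite jump_sumB (bigD1 (Ordinal jN))//=.
apply: (@le_trans _ _ (delta j * ((dyadic_trunc j v)%:R - (dyadic_trunc j u)%:R))).
  apply: ler_peMr; first exact: ltW.
  by rewrite lerBrDr addrC natr1 ler_nat.
rewrite lerDl; apply: sumr_ge0 => i _.
apply: mulr_ge0; first exact: ltW.
by rewrite subr_ge0 ler_nat le_dyadic_trunc.
Qed.

Lemma jump_fun_nondecreasing u v : 0 <= u -> u <= v -> v < 1 -> jump_fun u <= jump_fun v.
Proof.
move=> u0 uv v1; rewrite -subr_ge0; apply: (@jump_fun_diff_ge _ _ _ 0%N) => //.
- exact: le_lt_trans v1.
- exact: le_trans uv.
move=> N _; rewrite jump_sumB; apply: sumr_ge0 => i _.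
apply: mulr_ge0; first exact: ltW.
by rewrite subr_ge0 ler_nat le_dyadic_trunc.
Qed.

Lemma jump_fun_itv u : 0 <= u -> u < 1 -> a <= jump_fun u <= b.
Proof.
move=> u0 u1; rewrite /jump_fun lerDl; apply/andP; split.
  apply: limr_ge; first exact: jump_sum_cvg.
  by near=> N; exact: jump_sum_ge0.
rewrite addrC -lerBrDr; apply: limr_le; first exact: jump_sum_cvg.
by near=> N; exact: jump_sum_le.
Unshelve. all: by end_near. Qed.

(** Rounding [u] down to level [n] is invisible at the levels [j <= n]; at a finer level it stays
    within one level-n cell, which has [2^(j - n)] subcells. *)
Lemma dyadic_trunc_floor_le n j u : 0 <= u ->
  (dyadic_trunc j u)%:R - (dyadic_trunc j (dyadic_floor n u))%:R <=
  (if (n < j)%N then 2 ^+ (j - n) else 0) :> R.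
Proof.
move=> u0; have f0 := dyadic_floor_ge0 n u.
have /andP[n1 n2] := dyadic_truncP n u0; have /andP[j1 j2] := dyadic_truncP j u0.
case: ltnP => nj; last first.
  rewrite subr_le0 ler_nat dyadic_trunc_ge// /dyadic_floor.
  rewrite mulrA ler_pdivlMr//.
  have -> : (dyadic_trunc j u)%:R * 2 ^+ n = 2 ^+ j * (dyadic_trunc j u * 2 ^ (n - j))%:R :> R.
    by rewrite natrM natrX mulrCA; congr (_ * _); rewrite -exprD subnKC.
  rewrite ler_pM2l// ler_nat dyadic_trunc_ge// natrM natrX.
  have -> : 2 ^+ n = 2 ^+ j * 2 ^+ (n - j) :> R by rewrite -exprD subnKC.
  by rewrite mulrAC ler_pM2r.
rewrite lerBlDr.
have E : 2 ^+ j = 2 ^+ n * 2 ^+ (j - n) :> R by rewrite -exprD subnKC// ltnW.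
have h1 : ((dyadic_trunc n u * 2 ^ (j - n))%N <= dyadic_trunc j (dyadic_floor n u))%N.
  rewrite dyadic_trunc_ge// /dyadic_floor natrM natrX E.
  by rewrite le_eqVlt; apply/orP; left; apply/eqP; field; rewrite gt_eqF.
have h2 : (dyadic_trunc j u <= (dyadic_trunc n u).+1 * 2 ^ (j - n))%N.
  rewrite -(ler_nat R) (le_trans j1)// natrM natrX E mulrAC.
  by rewrite ler_pM2r// ltW.
rewrite -natrX -natrD ler_nat (leq_trans h2)// mulSn leq_add2l//.
Qed.

Lemma jump_fun_floor n u (c : R) : 0 <= u -> u < 1 ->
  (forall N, \sum_(j < N | (n < j)%N) delta j * 2 ^+ (j - n) <= c) ->
  0 <= jump_fun u - jump_fun (dyadic_floor n u) <= c.
Proof.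
move=> u0 u1 h; have f0 := dyadic_floor_ge0 n u; have fu := dyadic_floor_le n u0.
have f1 : dyadic_floor n u < 1 by exact: le_lt_trans u1.
rewrite subr_ge0 jump_fun_nondecreasing//=.
apply: jump_fun_diff_le => // N; apply: le_trans (h N).
rewrite jump_sumB [leRHS]big_mkcond; apply: ler_sum => j _.
have := dyadic_trunc_floor_le n j u0; case: ifPn => _ hj.
  by rewrite ler_pM2l.
by rewrite pmulr_rle0.
Qed.

Lemma jump_set_near x (e : R) : jump_set x -> 0 < e ->
  exists2 u : R, 0 <= u < 1 & `|x - jump_fun u| < e.
Proof.
move=> Kx e0; have [_ [[u + <-] xu]] := Kx (ball x e) (nbhsx_ballx x e e0).
by rewrite /= in_itv/= => u01; exists u.
Qed.

Lemma jump_set_fun u : 0 <= u -> u < 1 -> jump_set (jump_fun u).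
Proof.
by move=> u0 u1; apply: subset_closure; exists u => //=; rewrite in_itv/= u0.
Qed.

Lemma jump_set_closed : closed jump_set.
Proof. exact: closed_closure. Qed.

Lemma jump_set_itv : jump_set `<=` [set` `[a, b]].
Proof.
rewrite [X in _ `<=` X](closure_id _).1; last exact: itv_closed.
apply: closure_subset.
by move=> _ [u /=+ <-]; rewrite !in_itv/= => /andP[u0 u1]; exact: jump_fun_itv.
Qed.

Lemma jump_set_measurable : measurable jump_set.
Proof. by apply: closed_measurable; exact: jump_set_closed. Qed.

Definition jump_node (n i : nat) : R := jump_fun (i%:R / 2 ^+ n).

Lemma node_itv n i : (i < 2 ^ n)%N -> 0 <= (i%:R / 2 ^+ n : R) < 1.
Proof.
move=> i2; rewrite divr_ge0//= ?ltr_pdivrMr ?mul1r// ?ltW//.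
by rewrite -natrX ltr_nat.
Qed.

Lemma jump_fun_node n u (c : R) : 0 <= u -> u < 1 ->
  (forall N, \sum_(j < N | (n < j)%N) delta j * 2 ^+ (j - n) <= c) ->
  exists2 i, (i < 2 ^ n)%N & 0 <= jump_fun u - jump_node n i <= c.
Proof.
move=> u0 u1 h; exists (dyadic_trunc n u); first exact: dyadic_trunc_lt.
exact: jump_fun_floor.
Qed.

(** Let [m] be the first level that separates [u] and [v]. They share a cell of level [m - 1], so
    [|u - v| <= 2 / 2^m], while their images are at least [delta m] apart; the hypothesis compares
    these two quantities. *)
Lemma jump_fun_holder (s c : R) u v : 0 < s -> 0 < c ->
  (forall j, c <= delta j `^ s * 2 ^+ j) ->
  0 <= u -> u < 1 -> 0 <= v -> v < 1 ->
  `|u - v| <= 2 / c * `|jump_fun u - jump_fun v| `^ s.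
Proof.
move=> s0 c0 h; wlog uv : u v / u < v.
  move=> W u0 u1 v0 v1; have [uv|uv|->] := ltgtP u v.
  - exact: W.
  - by rewrite distrC (distrC (jump_fun u)); exact: W.
  - by rewrite subrr normr0 mulr_ge0 ?powR_ge0// divr_ge0// ltW.
move=> u0 u1 v0 v1.
have vu : 0 < v - u by rewrite subr_gt0.
(* Once [2^m (v - u) > 1] the truncations differ; [m + 1 <= 2^m] provides such an [m]. *)
have ex : exists m, (dyadic_trunc m u < dyadic_trunc m v)%N.
  pose m := Num.truncn (v - u)^-1; exists m.
  have vui : 0 <= (v - u)^-1 by rewrite invr_ge0 ltW.
  have /andP[_ h1] := truncn_itv vui.
  have h2 : m.+1%:R <= 2 ^+ m :> R by rewrite -natrX ler_nat ltn_expl.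
  have h3 : 1 < 2 ^+ m * (v - u).
    by rewrite -ltr_pdivrMr// mul1r (lt_le_trans h1).
  have /andP[u2 _] := dyadic_truncP m u0.
  rewrite dyadic_trunc_ge// -natr1.
  lra.
case: (ex_minnP ex) => m hm mmin.
have m0 : (0 < m)%N.
  case: m hm {mmin} => // ; rewrite ltnNge.
  have := dyadic_trunc_lt 0 v0 v1; rewrite expn0 ltnS leqn0 => /eqP ->.
  by rewrite leq0n.
have eqm : dyadic_trunc m.-1 u = dyadic_trunc m.-1 v.
  apply/eqP; rewrite eqn_leq le_dyadic_trunc ?ltW//= leqNgt; apply/negP => /mmin.
  by rewrite leqNgt prednK// leqnn.
have g1 := jump_fun_gap u0 (ltW uv) v1 hm.
have uvm : (v - u) * 2 ^+ m <= 2.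
  have /andP[hu _] := dyadic_truncP m.-1 u0; have /andP[_ hv] := dyadic_truncP m.-1 v0.
  rewrite -eqm -natr1 in hv.
  rewrite -(prednK m0) exprS; lra.
rewrite distrC (gtr0_norm vu) distrC ger0_norm; last first.
  by rewrite subr_ge0 jump_fun_nondecreasing// ltW.
apply: (@le_trans _ _ (2 / c * delta m `^ s)); last first.
  apply: ler_wpM2l; first by rewrite divr_ge0// ltW.
  apply: ge0_ler_powR; rewrite ?nnegrE ?(ltW s0) ?(ltW (delta_gt0 m))//.
  by rewrite (le_trans _ g1)// ltW.
have := h m => hm'.
rewrite -(ler_pM2r (pow2_gt0 m)) (le_trans uvm)//.
rewrite -[leRHS]mulrA; apply: (@le_trans _ _ (2 / c * c)); first by rewrite divfK// gt_eqF.
by apply: ler_wpM2l => //; rewrite divr_ge0// ltW.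
Qed.

End jump_function.

(** * Hausdorff measure: lower bounds from a Hoelder inverse, upper bounds from covers *)

Section hausdorff.
Context {R : realType}.
Notation mu := (@lebesgue_measure R).

(** The mass distribution principle for the image of Lebesgue measure under [g]: a cover of [K]
    pulls back to a cover of [[0, 1[] by intervals of length [2 C diam^s], whose lengths add up to
    at least 1. One scale suffices, as the measure is a supremum over scales. *)
Lemma hausdorff_measure_neq0 (g : R -> R) (K : set R) (s C : R) :
  0 <= s -> 0 < C -> (forall u, 0 <= u < 1 -> K (g u)) ->
  (forall u v, 0 <= u < 1 -> 0 <= v < 1 -> `|u - v| <= C * `|g u - g v| `^ s) ->
  hausdorff_measure s K != 0%E.
Proof.
move=> s0 C0 gK gC; apply/eqP => H0.
have P0 : (hausdorff_premeasure s 1 K <= 0)%E.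
  by rewrite -H0; apply: ereal_sup_ubound; exists 1 => //=.
suff h : ((2 * C)^-1%:E <= hausdorff_premeasure s 1 K)%E.
  by have := le_trans h P0; rewrite lee_fin leNgt invr_gt0 mulr_gt0.
apply: le_ereal_inf_tmp => _ [U [KU dU] <-].
have dx k x y : U k x -> U k y -> (`|x - y|%:E <= diam (U k))%E.
  by move=> Ux Uy; apply: ereal_sup_ubound; exists x => //; exists y.
pose V k := [set u : R | 0 <= u < 1 /\ U k (g u)].
have dp0 k : (0 <= diam_pow s (U k))%E.
  by rewrite /diam_pow; case: ifP => // _; exact: poweR_ge0.
have VI k : exists I : set R, [/\ measurable I, V k `<=` I &
    (mu I <= (2 * C)%:E * diam_pow s (U k))%E].
  have [V0|/set0P[u0 [u01 Uu]]] := eqVneq (V k) set0.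
    exists set0; split => //; first by rewrite V0.
    by rewrite measure0 mule_ge0// lee_fin mulr_ge0// ltW.
  have Une : U k != set0 by apply/set0P; exists (g u0).
  have dfin : diam (U k) \is a fin_num.
    rewrite fin_numE; apply/andP; split.
      apply/eqP => dE; have := dx k _ _ Uu Uu; rewrite dE leeNy_eq.
      by [].
    by apply/eqP => dE; have := dU k; rewrite dE leye_eq.
  (* The preimage [V k] may fail to be measurable, so it is enclosed in an interval centred at one
     of its points. *)
  pose L := C * fine (diam (U k)) `^ s.
  have L0 : 0 <= L by rewrite mulr_ge0 ?powR_ge0// ltW.
  exists [set` `[u0 - L, u0 + L]]; split => //.
    move=> v [v01 Uv] /=; rewrite in_itv/= -ler_distl distrC.
    apply: (le_trans (gC _ _ u01 v01)); rewrite ler_pM2l//.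
    apply: ge0_ler_powR; rewrite ?nnegrE//.
      by rewrite fine_ge0// (le_trans _ (dx k _ _ Uu Uv)).
    by rewrite -lee_fin fineK//; exact: dx.
  rewrite /= lebesgue_measure_itv/= lte_fin /diam_pow (negbTE Une).
  rewrite -(fineK dfin) poweR_EFin -EFinM.
  case: ifPn => _; last by rewrite lee_fin mulr_ge0 ?powR_ge0// mulr_ge0// ltW.
  rewrite -EFinB lee_fin -/L -mulrA -/L.
  by have -> : u0 + L - (u0 - L) = 2 * L by ring.
have [I HI] := choice VI.
have sub : [set` `[(0 : R), 1[] `<=` \bigcup_k I k.
  move=> u /=; rewrite in_itv/= => u01.
  have [k _ Uk] := KU _ (gK u u01).
  by exists k => //; have [_ VIk _] := HI k; apply: VIk.
have h1 : (1%:E <= \sum_(0 <= k <oo) mu (I k))%E.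
  have <- : mu [set` `[(0 : R), 1[] = 1%:E.
    by rewrite lebesgue_measure_itv/= lte_fin ltr01 oppr0 adde0.
  by apply: measure_sigma_subadditive => // k; have [] := HI k.
have h2 : (\sum_(0 <= k <oo) mu (I k) <=
    (2 * C)%:E * \sum_(0 <= k <oo) diam_pow s (U k))%E.
  rewrite -nneseriesZl//; apply: lee_nneseries => // k _.
  by have [] := HI k.
have := le_trans h1 h2.
rewrite -lee_pdivrMl ?mulr_gt0// mule1.
by [].
Qed.

Lemma hausdorff_measure_eq0 (K : set R) (s : R) :
  0 < s ->
  (forall e : R, 0 < e -> exists (N : nat) (c : nat -> R) (r : R),
     [/\ 0 <= r, r <= e, N%:R * (2 * r) `^ s <= e &
       forall x, K x -> exists2 i, (i < N)%N & `|x - c i| <= r]) ->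
  hausdorff_measure s K = 0%E.
Proof.
move=> s0 cov.
have dp0 (U : set R) : (0 <= diam_pow s U)%E.
  by rewrite /diam_pow; case: ifP => // _; exact: poweR_ge0.
have pm0 d : 0 < d -> hausdorff_premeasure s d K = 0%E.
  move=> d0; apply/eqP; rewrite eq_le; apply/andP; split; last first.
    apply: le_ereal_inf_tmp => _ [U _ <-].
    by apply: nneseries_ge0 => k _ _; exact: dp0.
  apply/lee_addgt0Pr => e e0; rewrite add0e.
  (* The bound [r <= d / 2] makes the pieces, of diameter at most [2 r], admissible at scale [d]. *)
  have m0 : 0 < Num.min (d / 2) e by rewrite lt_min divr_gt0.
  have [N [c [r [r0 re Nr Kc]]]] := cov _ m0.
  move: re; rewrite le_min => /andP[rd _].
  have {}Nr : N%:R * (2 * r) `^ s <= e by rewrite (le_trans Nr)// ge_min lexx orbT.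
  pose U k : set R := if (k < N)%N then [set` `[c k - r, c k + r]] else set0.
  have dU k : (k < N)%N -> (diam (U k) <= (2 * r)%:E)%E.
    move=> kN; apply: ge_ereal_sup => _ [x + [y + <-]]; rewrite /U kN /= !in_itv/=.
    move=> /andP[x1 x2] /andP[y1 y2]; rewrite lee_fin ler_norml; apply/andP; split; lra.
  apply: ereal_inf_le.
  exists (\sum_(0 <= k <oo) diam_pow s (U k))%E.
    exists U => //; split.
      move=> x /Kc[i iN]; rewrite ler_distl => xi.
      by exists i => //; rewrite /U iN /= in_itv/=.
    move=> k; have [kN|Nk] := ltnP k N.
      by apply: (le_trans (dU k kN)); rewrite lee_fin; lra.
    rewrite /U ltnNge Nk/= /diam (_ : [set _ | _ in _ & _ in _] = set0) ?ereal_sup0 ?leNye//.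
    by apply/seteqP; split => // z [].
  rewrite (@nneseries_split _ _ 0%N N)//.
  rewrite eseries0 ?adde0; last first.
    by move=> k Nk _; rewrite /diam_pow /U ltnNge Nk/= eqxx.
  apply: (@le_trans _ _ (\sum_(0 <= k < N) ((2 * r) `^ s)%:E)%E).
    rewrite add0n !big_nat; apply: lee_sum => k /andP[_ kN].
    rewrite /diam_pow; case: ifPn => // Une.
      by rewrite lee_fin powR_ge0.
    rewrite -poweR_EFin; apply: gt0_ler_poweR => //; rewrite ?in_itv/= ?leey ?andbT.
    - exact: ltW.
    - move/set0P : Une => [x Ux]; rewrite /diam; apply: ereal_sup_ge.
      by exists `|x - x|%:E; [exists x => //; exists x|rewrite lee_fin].
    - by rewrite lee_fin mulr_ge0.
    - exact: dU.
  by rewrite sumEFin lee_fin sumr_const_nat subn0 -[_ *+ N]mulr_natl.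
apply/eqP; rewrite eq_le; apply/andP; split.
  by apply: ge_ereal_sup => _ [d /= d0 <-]; rewrite pm0.
apply: ereal_sup_ge; exists (hausdorff_premeasure s 1 K); last by rewrite pm0.
by exists 1 => //=.
Qed.

Lemma hausdorff_dimE (K : set R) (al : R) : 0 <= al ->
  (forall s, 0 <= s -> s < al -> hausdorff_measure s K != 0%E) ->
  (forall s, al < s -> hausdorff_measure s K = 0%E) ->
  hausdorff_dim K = al%:E.
Proof.
move=> al0 lo up; apply/eqP; rewrite eq_le; apply/andP; split.
  apply/lee_addgt0Pr => e e0; rewrite -EFinD.
  apply: ereal_inf_lbound; exists (al + e) => //; split; first by rewrite addr_ge0// ltW.
  by apply: up; rewrite ltrDl.
apply: le_ereal_inf_tmp => _ [s [s0 Hs] <-]; rewrite lee_fin leNgt.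
by apply/negP => sal; have := lo s s0 sal; rewrite Hs eqxx.
Qed.

End hausdorff.

(** * Dimension of the jump sets *)

Section dimension_of_jump_set.
Context {R : realType}.

(** A single term of the exponential series at [m.+1 * ln x]. It makes the polynomial weights
    negligible against any geometric rate, hence invisible to the dimension. *)
Lemma poly_le_exp (q : nat) (x : R) : 1 < x ->
  exists2 C, 0 < C & forall m : nat, m.+1%:R ^+ q <= C * x ^+ m.
Proof.
move=> x1; have x0 : 0 < x by exact: lt_trans x1.
pose y := ln x; have y0 : 0 < y by exact: ln_gt0.
have f0 : 0 < (q.+1)`!%:R :> R by rewrite ltr0n fact_gt0.
exists ((q.+1)`!%:R / y ^+ q.+1 * x).
  by rewrite mulr_gt0// divr_gt0// exprn_gt0.
move=> m.
have m1 : 1 <= m.+1%:R :> R by rewrite ler1n.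
apply: (@le_trans _ _ (m.+1%:R ^+ q.+1)); first by rewrite ler_weXn2l.
have -> : (q.+1)`!%:R / y ^+ q.+1 * x * x ^+ m = (q.+1)`!%:R * x ^+ m.+1 / y ^+ q.+1.
  by rewrite [x ^+ m.+1]exprS; ring.
rewrite ler_pdivlMr ?exprn_gt0// -exprMn.
have my : 0 <= m.+1%:R * y by rewrite mulr_ge0// ltW.
have := expR_ge1Dxn q my.
have -> : expR (m.+1%:R * y) = x ^+ m.+1.
  by rewrite expRM_natl lnK// posrE.
move=> h; have {}h : (m.+1%:R * y) ^+ q.+1 / (q.+1)`!%:R <= x ^+ m.+1.
  by apply: le_trans h; rewrite lerDr.
by move: h; rewrite ler_pdivrMr// [leRHS]mulrC.
Qed.

Lemma sum_tail_geometric_le (y : R) (n N : nat) : 0 <= y -> y < 1 ->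
  \sum_(j < N | (n < j)%N) y ^+ (j - n) <= (1 - y)^-1.
Proof.
move=> y0 y1; rewrite -(big_mkord (fun j => n < j)%N (fun j => y ^+ (j - n))).
have p0 j : 0 <= y ^+ (j - n) by exact: exprn_ge0.
apply: (@le_trans _ _ (\sum_(0 <= j < n + N | (n < j)%N) y ^+ (j - n))).
  rewrite [leRHS](@big_cat_nat _ _ _ N)//= ?leq_addl//.
  by rewrite lerDl sumr_ge0.
rewrite (@big_cat_nat _ _ _ n)//= ?leq_addr//.
rewrite big_nat_cond big1 ?add0r; last by move=> j /andP[/andP[_ h1]]; rewrite ltnNge ltnW.
rewrite -{1}[n]add0n big_addn addKn big_mkord.
apply: (@le_trans _ _ (\sum_(i < N) y ^+ i)); last exact: sum_geometric_le.
rewrite big_mkcond; apply: ler_sum => i _; case: ifP => _.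
  by rewrite addnK.
exact: exprn_ge0.
Qed.

(** The geometric bound is required beyond [n] only, so [C] may depend on [n]; a decreasing weight
    is thereby frozen at its value at [n]. *)
Lemma tail_sum_le (delta : nat -> R) (C x : R) (n N : nat) : 0 <= C -> 0 <= x -> 2 * x < 1 ->
  (forall j, (n < j)%N -> delta j <= C * x ^+ j) ->
  \sum_(j < N | (n < j)%N) delta j * 2 ^+ (j - n) <= C / (1 - 2 * x) * x ^+ n.
Proof.
move=> C0 x0 x2 hC.
apply: (@le_trans _ _ (\sum_(j < N | (n < j)%N) C * x ^+ n * (2 * x) ^+ (j - n))).
  apply: ler_sum => j nj.
  have -> : C * x ^+ n * (2 * x) ^+ (j - n) = C * x ^+ j * 2 ^+ (j - n).
    by rewrite exprMn -[in RHS](subnKC (ltnW nj)) exprD addKn; ring.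
  by apply: ler_wpM2r; [rewrite exprn_ge0|exact: hC].
rewrite -mulr_sumr [leRHS]mulrAC; apply: ler_wpM2l; first by rewrite mulr_ge0 ?exprn_ge0.
by apply: sum_tail_geometric_le => //; rewrite mulr_ge0.
Qed.

Lemma geometric_small (C x e : R) : 0 <= x -> x < 1 -> 0 < e ->
  \forall n \near \oo, C * x ^+ n <= e.
Proof.
move=> x0 x1 e0.
have cv : (fun n => C * x ^+ n) @ \oo --> C * 0.
  apply: cvgMr; apply: cvg_expr; by rewrite ger0_norm.
by rewrite mulr0 in cv; apply: (cvgr_le _ cv).
Qed.

Lemma powR_exprAC (x s : R) n : 0 <= x -> (x ^+ n) `^ s = (x `^ s) ^+ n.
Proof. by move=> x0; rewrite -(powR_mulrn n x0) -(powR_mulrn n (powR_ge0 x s)) powRAC. Qed.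

Lemma pow2N_lt (s t : R) : s < t -> 2 `^ (- t) < 2 `^ (- s) :> R.
Proof. move=> st; rewrite /powR !ifF ?pnatr_eq0//.
by rewrite ltr_expR ltr_pM2r ?ltrN2// ln_gt0// ltr1n. Qed.

Lemma pow2N1 : 2 `^ (- 1) = 2^-1 :> R.
Proof. by rewrite powRN powRr1. Qed.

(** Only the exponential rate of [delta] is compared with [2^(-1 / al)]: any slower decay serves in
    the upper bound, any faster one in the lower bound. *)
Lemma jump_set_dim (a b al : R) (delta : nat -> R) :
  (forall j, 0 < delta j) ->
  (forall N, \sum_(j < N) delta j * 2 ^+ j <= b - a) ->
  0 < al -> al < 1 ->
  (forall x, 2 `^ (- al^-1) < x -> exists2 C, 0 < C & forall j, delta j <= C * x ^+ j) ->
  (forall x, 0 < x -> x < 2 `^ (- al^-1) ->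
    exists2 c, 0 < c & forall j, c * x ^+ j <= delta j) ->
  hausdorff_dim (jump_set a delta) = al%:E.
Proof.
move=> d0 dS al0 al1 up lo; apply: hausdorff_dimE; first exact: ltW.
- move=> s s0 sal.
  (* The rate [2^(-1 / s)] has no meaning at [s = 0], where the Hoelder bound just says
     [|u - v| <= 1]. *)
  have [s00|sp] := eqVneq s 0.
    apply: (@hausdorff_measure_neq0 _ (jump_fun a delta) _ _ 1) => //.
      by move=> u /andP[u0 u1]; exact: jump_set_fun.
    move=> u v /andP[u0 u1] /andP[v0 v1]; rewrite s00 powRr0 mulr1 ler_norml.
    by apply/andP; split; lra.
  have {}sp : 0 < s by rewrite lt_neqAle eq_sym sp.
  (* This rate is the one for which [(c x^j)^s 2^j] is the constant [c^s]; it lies below the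
     critical rate because [s < al]. *)
  have [|c c0 hc] := lo (2 `^ (- s^-1)) (powR_gt0 _ (ltr0Sn _ 1)).
    by apply: pow2N_lt; rewrite ltf_pV2.
  apply: (@hausdorff_measure_neq0 _ (jump_fun a delta) _ _ (2 / c `^ s)) => //.
  + by rewrite divr_gt0// powR_gt0.
  + by move=> u /andP[u0 u1]; exact: jump_set_fun.
  move=> u v /andP[u0 u1] /andP[v0 v1].
  apply: (@jump_fun_holder _ a delta d0 b dS) => //; first exact: powR_gt0.
  move=> j; apply: (@le_trans _ _ ((c * (2 `^ (- s^-1)) ^+ j) `^ s * 2 ^+ j)).
    rewrite powRM; [|exact: ltW|by rewrite exprn_ge0 ?powR_ge0].
    rewrite powR_exprAC ?powR_ge0// -powRrM mulNr mulVf ?gt_eqF// pow2N1.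
    by rewrite -mulrA -exprMn mulVf// expr1n mulr1.
  apply: ler_wpM2r; first by rewrite exprn_ge0.
  apply: powR_le2l => //.
  by rewrite mulr_ge0 ?exprn_ge0 ?powR_ge0// ltW.
- move=> s als.
  (* The rate [x = 2^(-1 / s1)] must meet three demands: [s1 > al] lets it bound [delta], [s1 < 1]
     gives [2 x < 1] and summable tails, [s1 < s] gives [2 x^s < 1] and makes the sum over the cover
     vanish. *)
  pose s1 := (al + Num.min s 1) / 2.
  have [s1a s1b s1c] : [/\ al < s1, s1 < 1 & s1 < s].
    rewrite /s1; have [h|h] := leP s 1; split; lra.
  have s10 : 0 < s1 by exact: lt_trans s1a.
  have s0 : 0 < s by exact: lt_trans als.
  pose x := 2 `^ (- s1^-1) : R.
  have x0 : 0 < x by exact: powR_gt0.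
  have [|C C0 hC] := up x; first by apply: pow2N_lt; rewrite ltf_pV2.
  have x2 : 2 * x < 1.
    have : x < 2^-1 by rewrite -pow2N1; apply: pow2N_lt; rewrite invf_gt1.
    lra.
  have xs : 2 * x `^ s < 1.
    have : x `^ s < 2^-1.
      rewrite -pow2N1 /x -powRrM mulNr; apply: pow2N_lt.
      by rewrite mulrC ltr_pdivlMr ?mul1r.
    lra.
  pose D := C / (1 - 2 * x).
  have D0 : 0 < D by rewrite divr_gt0// subr_gt0.
  have tail n N : \sum_(j < N | (n < j)%N) delta j * 2 ^+ (j - n) <= D * x ^+ n.
    by apply: tail_sum_le => //; exact: ltW.
  apply: hausdorff_measure_eq0 => // e e0.
  have h1 := geometric_small (2 * D) (ltW x0) (_ : x < 1) e0.
  near \oo => n.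
  exists (2 ^ n)%N, (jump_node a delta n), (2 * D * x ^+ n); split.
  + by rewrite ltW// mulr_gt0 ?exprn_gt0// mulr_gt0.
  + near: n; apply: h1; lra.
  + have -> : (2 ^ n)%:R * (2 * (2 * D * x ^+ n)) `^ s = (4 * D) `^ s * (2 * x `^ s) ^+ n.
      have -> : 2 * (2 * D * x ^+ n) = 4 * D * x ^+ n by ring.
      rewrite powRM; [|by rewrite mulr_ge0// ltW|by rewrite exprn_ge0// ltW].
      by rewrite powR_exprAC 1?ltW// natrX exprMn; ring.
    near: n; apply: geometric_small => //; by rewrite mulr_ge0 ?powR_ge0.
  + move=> z Kz.
    have Dx : 0 < D * x ^+ n by rewrite mulr_gt0 ?exprn_gt0.
    have [u /andP[u0 u1] zu] := jump_set_near Kz Dx.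
    have [i i2 /andP[ui1 ui2]] := jump_fun_node d0 dS u0 u1 (tail n).
    exists i => //.
    have -> : z - jump_node a delta n i = (z - jump_fun a delta u) + (jump_fun a delta u - jump_node a delta n i).
      by rewrite addrA subrK.
    apply: (le_trans (ler_normD _ _)).
    rewrite (ger0_norm ui1); lra.
Unshelve. all: by end_near. Qed.

Lemma exists_jump_set (a b al : R) (w : nat -> R) :
  a < b -> 0 < al -> al < 1 -> (forall j, 0 < w j) ->
  (forall x, 1 < x -> exists2 C, 0 < C & forall j, w j <= C * x ^+ j) ->
  (forall x, 1 < x -> exists2 C, 0 < C & forall j, 1 <= C * x ^+ j * w j) ->
  exists2 kap : R, 0 < kap &
    let delta j := kap * (2 `^ (- al^-1)) ^+ j * w j in
    [/\ forall j, 0 < delta j,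
        forall N, \sum_(j < N) delta j * 2 ^+ j <= b - a &
        hausdorff_dim (jump_set a delta) = al%:E].
Proof.
move=> ab al0 al1 w0 wup wlo.
pose lam := 2 `^ (- al^-1) : R.
have lam0 : 0 < lam by exact: powR_gt0.
have lam2 : lam < 2^-1 by rewrite -pow2N1; apply: pow2N_lt; rewrite invf_gt1.
(* Any rate strictly between [lam] and [1/2] absorbs the weight and keeps the sum of [(2 x)^j]
   finite; dividing [b - a] by the resulting bound [D] gives the scale [kap] that fits the set into
   [[a, b]]. *)
pose x := (lam + 2^-1) / 2.
have [xl x2] : lam < x /\ x < 2^-1 by rewrite /x; split; lra.
have up y : lam < y -> exists2 C, 0 < C & forall j, lam ^+ j * w j <= C * y ^+ j.
  move=> ly; have [|C C0 hC] := wup (y / lam).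
    by rewrite ltr_pdivlMr// mul1r.
  exists C => // j; rewrite mulrC -ler_pdivlMr ?exprn_gt0//.
  by rewrite -mulrA -expr_div_n.
have lo y : 0 < y -> y < lam -> exists2 c, 0 < c & forall j, c * y ^+ j <= lam ^+ j * w j.
  move=> y0 yl; have [|C C0 hC] := wlo (lam / y).
    by rewrite ltr_pdivlMr// mul1r.
  exists C^-1 => [|j]; first by rewrite invr_gt0.
  rewrite mulrC ler_pdivrMr// -[leLHS]mul1r -ler_pdivlMr ?exprn_gt0//.
  have -> : lam ^+ j * w j * C / y ^+ j = C * (lam / y) ^+ j * w j.
    by rewrite expr_div_n; ring.
  exact: hC.
have [C C0 hC] := up x xl.
pose D := C / (1 - 2 * x).
have D0 : 0 < D by rewrite divr_gt0//; lra.
have k0 : 0 < (b - a) / D by rewrite divr_gt0// subr_gt0.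
exists ((b - a) / D) => //=; rewrite -/lam.
have dp j : 0 < (b - a) / D * lam ^+ j * w j by rewrite mulr_gt0// mulr_gt0// exprn_gt0.
have dS N : \sum_(j < N) (b - a) / D * lam ^+ j * w j * 2 ^+ j <= b - a.
  apply: (@le_trans _ _ (\sum_(j < N) (b - a) / D * (C * (2 * x) ^+ j))).
    apply: ler_sum => j _; rewrite -!mulrA mulrA [leRHS]mulrA; apply: ler_wpM2l; first exact: ltW.
    rewrite mulrA exprMn mulrCA [leRHS]mulrC; apply: ler_wpM2r; first by rewrite exprn_ge0.
    exact: hC.
  rewrite -!mulr_sumr.
  have h := @sum_geometric_le _ N (2 * x).
  apply: (@le_trans _ _ ((b - a) / D * D)); last by rewrite divfK// gt_eqF.
  apply: ler_wpM2l; first exact: ltW.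
  rewrite /D; apply: ler_wpM2l; first exact: ltW.
  by apply: h; lra.
split => //.
apply: (jump_set_dim dp dS) => //; rewrite -/lam => y.
- move=> /up[C1 C10 h1]; exists ((b - a) / D * C1); first exact: mulr_gt0.
  by move=> j; rewrite -!mulrA mulrA [leRHS]mulrA; apply: ler_wpM2l; [exact: ltW|exact: h1].
- move=> y0 /(lo _ y0)[c1 c10 h1]; exists ((b - a) / D * c1); first exact: mulr_gt0.
  by move=> j; rewrite -!mulrA mulrA [leRHS]mulrA; apply: ler_wpM2l; [exact: ltW|exact: h1].
Qed.

End dimension_of_jump_set.

(** * Hitting probabilities *)

Section second_moment.
Context {disp : measure_display} {T : measurableType disp} {R : realType}.
Variable P : probability T R.

(* 2 lam N - lam ^ 2 N ^ 2 <= 1_{N > 0} holds pointwise; integrate. *)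
Lemma second_moment (N : nat) (A : nat -> set T) (lam : R) :
  (forall i, measurable (A i)) ->
  2 * lam * (\sum_(i < N) fine (P (A i))) -
    lam ^+ 2 * (\sum_(i < N) \sum_(j < N) fine (P (A i `&` A j))) <=
  fine (P (\bigcup_(i < N) A i)).
Proof.
move=> mA.
have mU : measurable (\bigcup_(i < N) A i) by apply: bigcup_measurable => i _.
have bi (E : set T) (c : R) : measurable E -> P.-integrable [set: T] (EFin \o (fun w => c * \1_E w)).
  move=> mE; apply: (@integrable_bounded _ _ _ P _ `|c|).
    exact: measurable_funM.
  move=> w; rewrite normrM ler_piMr// indicE.
  by case: (_ \in _); rewrite ?normr1 ?normr0.
pose F (i : 'I_N) w : R := 2 * lam * \1_(A i) w.
pose G (ij : 'I_N * 'I_N) w : R := lam ^+ 2 * \1_(A ij.1 `&` A ij.2) w.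
have [iF EF] := @Rintegral_sum _ _ _ P _ (index_enum 'I_N) F (fun i => bi _ _ (mA i)).
have [iG EG] := @Rintegral_sum _ _ _ P _ (index_enum ('I_N * 'I_N)%type) G
  (fun ij => bi _ _ (measurableI _ _ (mA ij.1) (mA ij.2))).
have -> : 2 * lam * (\sum_(i < N) fine (P (A i))) -
    lam ^+ 2 * (\sum_(i < N) \sum_(j < N) fine (P (A i `&` A j))) =
   \int[P]_w (\sum_(i : 'I_N) F i w - \sum_(ij : 'I_N * 'I_N) G ij w).
  rewrite RintegralB// EF EG pair_bigA/= !mulr_sumr; congr (_ - _).
    apply: eq_bigr => i _; rewrite RintegralZl//; last first.
      have := bi _ 1 (mA i); apply: eq_integrable => // w _ /=.
      by rewrite mul1r.
    by rewrite Rintegral_prob_indic.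
  apply: eq_bigr => -[i j] _ /=; rewrite RintegralZl//; last first.
    have := bi _ 1 (measurableI _ _ (mA i) (mA j)); apply: eq_integrable => // w _ /=.
    by rewrite mul1r.
  by rewrite Rintegral_prob_indic//; exact: measurableI.
rewrite -Rintegral_prob_indic//; apply: le_Rintegral => //.
- have -> : EFin \o (fun w => \sum_(i : 'I_N) F i w - \sum_(ij : 'I_N * 'I_N) G ij w) =
    (fun w => (\sum_(i : 'I_N) F i w)%:E - (\sum_(ij : 'I_N * 'I_N) G ij w)%:E)%E by [].
  exact: integrableB.
- have := bi _ 1 mU; apply: eq_integrable => // w _ /=.
  by rewrite mul1r.
move=> w _.
pose S : R := \sum_(i < N) \1_(A i) w.
have -> : \sum_(i : 'I_N) F i w = 2 * lam * S by rewrite /F -mulr_sumr.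
have -> : \sum_(ij : 'I_N * 'I_N) G ij w = lam ^+ 2 * S ^+ 2.
  rewrite /G -mulr_sumr [S ^+ 2]expr2 /S big_distrlr/= pair_bigA/=; congr (_ * _).
  by apply: eq_bigr => -[i j] _ /=; rewrite indicI.
rewrite [leRHS]indicE; have [wU|wU] := boolP (w \in \bigcup_(i < N) A i).
  have -> : true%:R = 1 :> R by [].
  by have := sqr_ge0 (1 - lam * S); lra.
have -> : S = 0.
  apply: big1 => i _; rewrite indicE memNset// => Aw; move/negP: wU; apply.
  by rewrite inE; exists i => //=.
by rewrite expr0n/= !mulr0 subrr.
Qed.

End second_moment.

(** * Probability of being close to a point at one or two given times *)

Section near_events.
Context {disp : measure_display} {T : measurableType disp} {R : realType}.
Variables (P : probability T R) (H : R) (d : nat).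
Variables (B : 'I_d -> R -> {RV P >-> R}) (f : R -> 'rV[R]_d).
Hypotheses (H0 : 0 < H) (H1 : H < 1) (fB : is_fbm H B).

(** A box in the maximum norm, so that it is an intersection over the independent components; the
    drift is moved into the centre of the box. *)
Definition near_event (x : 'rV[R]_d) (e s : R) : set T :=
  [set w | forall i : 'I_d, `|B i s w - (x ord0 i - f s ord0 i)| <= e].

Let ball i (s y e : R) := [set w | `|B i s w - y| <= e].

Lemma near_eventE (x : 'rV[R]_d) (e s : R) : near_event x e s =
  \bigcap_(i in [set: 'I_d]) ball i s (x ord0 i - f s ord0 i) e.
Proof. by apply/seteqP; split => w h i; [move=> _; exact: h|exact: h]. Qed.

Lemma near_event_measurable (x : 'rV[R]_d) (e s : R) : measurable (near_event x e s).
Proof.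
rewrite near_eventE; apply: fin_bigcap_measurable => // i _.
exact: fbm_ball_measurable.
Qed.

Lemma ball_process_sigma_algebra i (s y e : R) : s \in `[0, 1] ->
  process_sigma_algebra (B i) (ball i s y e).
Proof.
move=> s01; apply: sub_sigma_algebra; exists s => //.
exists [set` `[y - e, y + e]]; first exact: measurable_itv.
rewrite setTI; apply/seteqP; split => w; rewrite /ball /= in_itv/= ler_norml => /andP[h1 h2];
  apply/andP; split; lra.
Qed.

Lemma independent_prod (E : 'I_d -> set T) :
  (forall i, process_sigma_algebra (B i) (E i)) ->
  P (\bigcap_(i in [set: 'I_d]) E i) = (\prod_(i < d) P (E i))%E.
Proof.
move=> hE; have [_ ind] := fB.
have := ind [set: 'I_d]%SET E (fun i _ => hE i).
rewrite (eq_bigl xpredT); last by move=> i; rewrite inE.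
move=> <-; congr (P _); apply/seteqP; split => w h i _; apply: h => //=.
by rewrite inE.
Qed.

Lemma prode_le (p : 'I_d -> \bar R) (c : R) : (forall i, 0 <= p i)%E ->
  (forall i, p i <= c%:E)%E -> (\prod_(i < d) p i <= (c ^+ d)%:E)%E.
Proof.
move=> p0 pc.
have pf i : p i \is a fin_num by rewrite ge0_fin_numE// (le_lt_trans (pc i)) ?ltry.
have -> : (\prod_(i < d) p i = (\prod_(i < d) fine (p i))%:E)%E.
  by rewrite -prodEFin; apply: eq_bigr => i _; rewrite fineK.
rewrite lee_fin; have -> : c ^+ d = \prod_(i < d) c by rewrite prodr_const card_ord.
apply: ler_prod => i _; rewrite fine_ge0//=.
by rewrite -lee_fin fineK.
Qed.

Lemma prode_ge (p : 'I_d -> \bar R) (c : R) : 0 <= c -> (forall i, p i \is a fin_num) ->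
  (forall i, c%:E <= p i)%E -> ((c ^+ d)%:E <= \prod_(i < d) p i)%E.
Proof.
move=> c0 pf pc.
have -> : (\prod_(i < d) p i = (\prod_(i < d) fine (p i))%:E)%E.
  by rewrite -prodEFin; apply: eq_bigr => i _; rewrite fineK.
rewrite lee_fin; have -> : c ^+ d = \prod_(i < d) c by rewrite prodr_const card_ord.
apply: ler_prod => i _; rewrite c0/=.
by rewrite -lee_fin fineK.
Qed.

Variable a : R.
Hypothesis a0 : 0 < a.

Let in01 t : a <= t -> t <= 1 -> t \in `[0, 1].
Proof. by move=> at_ t1; rewrite in_itv/= t1 andbT (le_trans (ltW a0)). Qed.

Let fX i : is_real_fbm H (B i). Proof. by case: fB. Qed.

Definition near_cst : R := 2 * normal_peak (a `^ H).

Lemma near_event_le (x : 'rV[R]_d) (e s : R) : a <= s -> s <= 1 -> 0 < e ->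
  (P (near_event x e s) <= ((near_cst * e) ^+ d)%:E)%E.
Proof.
move=> as_ s1 e0; rewrite near_eventE independent_prod; last first.
  by move=> i; exact: ball_process_sigma_algebra (in01 as_ s1).
by apply: prode_le => i; [exact: measure_ge0|exact: fbm_small_ball_le].
Qed.

Definition near_low_cst (M : R) : R :=
  2 * normal_peak 1 * expR (- M ^+ 2 / ((a `^ H) ^+ 2 *+ 2)).

Lemma near_low_cst_gt0 M : 0 < near_low_cst M.
Proof. by rewrite mulr_gt0 ?expR_gt0// mulr_gt0// normal_peak_gt0. Qed.

Lemma near_event_ge (x : 'rV[R]_d) (e s M : R) : a <= s -> s <= 1 -> 0 < e ->
  (forall i, `|x ord0 i - f s ord0 i| + e <= M) ->
  (((near_low_cst M * e) ^+ d)%:E <= P (near_event x e s))%E.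
Proof.
move=> as_ s1 e0 hM; rewrite near_eventE independent_prod; last first.
  by move=> i; exact: ball_process_sigma_algebra (in01 as_ s1).
apply: prode_ge.
- by rewrite mulr_ge0 1?ltW// near_low_cst_gt0.
- by move=> i; apply: fin_num_measure; exact: fbm_ball_measurable.
- by move=> i; apply: fbm_small_ball_ge.
Qed.

Definition pair_near_cst : R := pair_cst (fbm_lnd_cst H a).

(** For each component the events at [s] and [t] both belong to the sigma-algebra of its path, so
    independence of the processes factors the intersection. The [d]-th power produces the kernel
    [|s - t|^(- H d)] of the energy. *)
Lemma near_event_pair_le (x : 'rV[R]_d) (e s t : R) : a <= s -> s <= 1 -> a <= t -> t <= 1 -> s != t ->
  0 < e -> e <= 2^-1 ->
  (P (near_event x e s `&` near_event x e t) <=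
   ((pair_near_cst * e ^+ 2 / `|s - t| `^ H) ^+ d)%:E)%E.
Proof.
move=> as_ s1 at_ t1 st e0 e1; rewrite !near_eventE -bigcapI independent_prod; last first.
  move=> i; apply: (@measurableI _ (g_sigma_algebraType
    (\bigcup_(t in `[0, 1]) preimage_set_system setT (B i t) measurable))).
    by exact: ball_process_sigma_algebra (in01 as_ s1).
  by exact: ball_process_sigma_algebra (in01 at_ t1).
by apply: prode_le => i; [exact: measure_ge0|exact: fbm_pair_small_ball].
Qed.

End near_events.

(** * Hitting a compact set as a limit of events at countably many nodes *)

Section hitting_events.
Context {disp : measure_display} {T : measurableType disp} {R : realType}.
Variables (P : probability T R) (H : R) (d : nat).
Variables (B : 'I_d -> R -> {RV P >-> R}) (f : R -> 'rV[R]_d).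
Hypotheses (H0 : 0 < H) (H1 : H < 1) (fB : is_fbm H B) (hf : hoelder_on01 H f).

Lemma coord_le_euclidean_norm (x : 'rV[R]_d) i : `|x ord0 i| <= euclidean_norm x.
Proof.
rewrite -sqrtr_sqr ler_sqrt; last by apply: sumr_ge0 => j _; exact: sqr_ge0.
rewrite (bigD1 i)//= lerDl; apply: sumr_ge0 => j _; exact: sqr_ge0.
Qed.

Lemma hoelder_coord : exists2 C, 0 <= C & forall i (s t : R), s \in `[0, 1] -> t \in `[0, 1] ->
  `|f s ord0 i - f t ord0 i| <= C * `|s - t| `^ H.
Proof.
have [C hC] := hf; exists `|C| => // i s t s01 t01.
apply: (@le_trans _ _ (C * `|s - t| `^ H)); last by rewrite ler_wpM2r ?powR_ge0// ler_norm.
apply: le_trans (hC s t s01 t01); have := coord_le_euclidean_norm (f s - f t) i.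
by rewrite !mxE.
Qed.

(** The [l^1] distance from [(B + f) s] to [x]: a real function of time, continuous on [[0, 1]],
    whose zeros are the hits. *)
Definition deviation (x : 'rV[R]_d) (w : T) (s : R) : R :=
  \sum_(i < d) `|B i s w - (x ord0 i - f s ord0 i)|.

Lemma deviation_ge0 x w s : 0 <= deviation x w s.
Proof. exact: sumr_ge0. Qed.

Lemma deviation_near x e s w : deviation x w s <= e -> near_event B f x e s w.
Proof.
move=> h i; apply: le_trans h; rewrite /deviation (bigD1 i)//= lerDl.
exact: sumr_ge0.
Qed.

Lemma near_deviation x e s w : near_event B f x e s w -> deviation x w s <= e *+ d.
Proof.
move=> h; rewrite -[X in _ *+ X]card_ord -sumr_const.
by apply: ler_sum => i _; exact: h.
Qed.

Lemma hitting_eventP (E : set R) x w :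
  hitting_event B f E x w <-> exists2 s, E s & deviation x w s = 0.
Proof.
split=> -[s Es hs]; exists s => //.
  rewrite /deviation big1// => i _.
  by rewrite -hs !mxE addrK subrr normr0.
apply/rowP => i; rewrite !mxE.
have /eqP := hs; rewrite psumr_eq0; last by [].
move=> /allP/(_ i); rewrite mem_index_enum => /(_ isT)/=.
by rewrite normr_eq0 subr_eq0 => /eqP ->; rewrite subrK.
Qed.

Lemma deviation_continuous x w : {within `[0, 1], continuous (deviation x w)}.
Proof.
have [C C0 hC] := hoelder_coord.
have -> : deviation x w =
   \sum_(i < d) (fun s => `|B i s w - (x ord0 i - f s ord0 i)|).
  by apply/funext => s; rewrite fct_sumE.
apply: (big_ind (fun g : R -> R => {within `[0, 1], continuous g})).
- by move=> s; exact: cvg_cst.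
- by move=> g h cg ch s; apply: cvgD; [exact: cg|exact: ch].
move=> i _ s; apply: cvg_norm.
apply: cvgB; first by have [/(_ i)[_ _ _ cB] _] := fB; exact: cB.
apply: cvgB; first exact: cvg_cst.
move: s; apply/subspace_continuousP => s s01.
apply/cvgrPdist_le => e e0.
have K0 : 0 < C + 1 by rewrite ltr_wpDl.
have r0 : 0 < (e / (C + 1)) `^ H^-1 by rewrite powR_gt0// divr_gt0.
near=> t.
have t01 : t \in `[0, 1] by near: t; exact: withinT.
have st : `|s - t| <= (e / (C + 1)) `^ H^-1.
  by near: t; apply: cvg_within; exists ((e / (C + 1)) `^ H^-1) => //= z /ltW.
apply: (le_trans (hC _ _ _ s01 t01)).
apply: (@le_trans _ _ ((C + 1) * ((e / (C + 1)) `^ H^-1) `^ H)).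
  apply: ler_pM; rewrite ?powR_ge0// ?lerDl//.
  by apply: powR_le2l => //; exact: ltW.
rewrite -powRrM mulVf ?gt_eqF// powRr1; last by rewrite divr_ge0// ltW.
by rewrite mulrC divfK// gt_eqF.
Unshelve. all: by end_near. Qed.

Variables (K : set R) (node : nat -> nat -> R).
Hypotheses (K01 : K `<=` [set` `[0, 1]]) (Kclosed : closed K).
Hypothesis nodeK : forall n i, (i < 2 ^ n)%N -> K (node n i).
Hypothesis node_dense : forall s e : R, K s -> 0 < e ->
  exists n i, (i < 2 ^ n)%N /\ `|s - node n i| < e.

Lemma deviation_modulus (x : 'rV[R]_d) w (s e : R) : K s -> 0 < e ->
  exists2 r, 0 < r & forall t, t \in `[0, 1] -> `|s - t| < r ->
    `|deviation x w s - deviation x w t| < e.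
Proof.
move=> Ks e0.
have /subspace_continuousP/(_ s (K01 Ks)) := @deviation_continuous x w.
move/cvgrPdist_lt/(_ e e0); rewrite near_withinE => -[r /= r0 hr].
by exists r => // t t01 st; apply: hr.
Qed.

(** The radius starts at [1/2], the largest one allowed in the two-point estimate. *)
Definition hit_level x (k : nat) : set T :=
  \bigcup_n \bigcup_(i < 2 ^ n) near_event B f x k.+2%:R^-1 (node n i).

(** A hit is seen at nearby nodes by continuity and density. Conversely, near hits at nodes put 0 in
    the closure of the image of [K] under the deviation, which is compact. Besides the limit
    argument, this makes an uncountable union measurable. *)
Lemma hitting_eventE x : hitting_event B f K x = \bigcap_k hit_level x k.
Proof.
apply/seteqP; split => w.
  move=> /hitting_eventP[s Ks ds] k _.
  have e0 : 0 < k.+2%:R^-1 :> R by rewrite invr_gt0.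
  have [r r0 hr] := deviation_modulus x w Ks e0.
  have [n [i [i2 sn]]] := node_dense Ks r0.
  exists n => //; exists i => //; apply: deviation_near.
  have := hr _ (K01 (nodeK i2)) sn; rewrite ds sub0r normrN.
  by rewrite ger0_norm ?deviation_ge0// => /ltW.
move=> h; apply/hitting_eventP.
have cK : compact K.
  by apply: (subclosed_compact Kclosed (@segment_compact R 0 1)).
have cD : compact (deviation x w @` K).
  apply: continuous_compact cK; apply: continuous_subspaceW (@deviation_continuous x w).
  exact: K01.
have clD : closed (deviation x w @` K) by apply: compact_closed.
suff : (deviation x w @` K) 0 by move=> [s Ks ds]; exists s.
apply: clD => V [e /= e0 eV].
have [k hk] : exists k : nat, k.+2%:R^-1 *+ d < e.
  exists (Num.truncn (d%:R / e)); set k := Num.truncn _.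
  have de : 0 <= d%:R / e by rewrite divr_ge0// ltW.
  have /andP[_] := truncn_itv de; rewrite -/k => h1.
  rewrite ltr_pdivrMr// in h1.
  rewrite -[_ *+ d]mulr_natr mulrC ltr_pdivrMr// (lt_le_trans h1)// mulrC.
  by rewrite ler_pM2l// ler_nat.
have [n _ [i /= i2 /near_deviation di]] := h k I.
exists (deviation x w (node n i)); split; first by exists (node n i) => //; exact: nodeK.
apply: eV; rewrite /= sub0r normrN ger0_norm ?deviation_ge0//.
exact: le_lt_trans hk.
Qed.

Lemma hit_level_measurable x k : measurable (hit_level x k).
Proof.
apply: bigcup_measurable => n _; apply: bigcup_measurable => i _.
exact: near_event_measurable.
Qed.

Lemma hitting_event_measurable x : measurable (hitting_event B f K x).
Proof. by rewrite hitting_eventE; apply: bigcap_measurable => // k _; exact: hit_level_measurable. Qed.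

(** The levels decrease to the hitting event, so a uniform lower bound survives by continuity from
    above. *)
Lemma hitting_event_gt0 x (c : R) : 0 < c ->
  (forall k, c%:E <= P (hit_level x k))%E -> (0 < P (hitting_event B f K x))%E.
Proof.
move=> c0 hc; apply: (@lt_le_trans _ _ c%:E); first by rewrite lte_fin.
rewrite hitting_eventE.
have ni : nonincreasing_seq (hit_level x).
  apply/nonincreasing_seqP => k; apply/subsetPset => w [n _ [i i2 h]].
  exists n => //; exists i => // j; apply: (le_trans (h j)).
  by rewrite lef_pV2 ?posrE// ler_nat.
have := @nonincreasing_cvg_mu _ _ _ P (hit_level x).
move=> /(_ _ (hit_level_measurable x) _ ni) cv.
have {}cv : P \o hit_level x @ \oo --> P (\bigcap_n hit_level x n).
  apply: cv.
    by rewrite ltey_eq fin_num_measure//; exact: hit_level_measurable.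
  by apply: bigcap_measurable => // k _; exact: hit_level_measurable.
rewrite -(cvg_lim _ cv)//; apply: lime_ge; first by apply/cvg_ex; eexists; exact: cv.
by near=> k; exact: hc.
Unshelve. all: by end_near. Qed.

End hitting_events.

(** * Energy of the uniform measure on the nodes of a level *)

Section node_energy.
Context {R : realType}.
Variables (a b : R) (delta : nat -> R).
Hypotheses (delta_gt0 : forall j, 0 < delta j)
  (delta_sum : forall N, \sum_(j < N) delta j * 2 ^+ j <= b - a).

(** [m] is the last level at which [i] and [j] have a common ancestor; they separate at level
    [m + 1], whence the index of [delta]. *)
Lemma node_gap n i j : (i < j)%N -> (j < 2 ^ n)%N ->
  exists m, [/\ (m < n)%N, (i %/ 2 ^ (n - m) = j %/ 2 ^ (n - m))%N &
    delta m.+1 <= jump_node a delta n j - jump_node a delta n i].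
Proof.
move=> ij j2.
have /andP[u0 u1] := @node_itv R n i (ltn_trans ij j2).
have /andP[v0 v1] := @node_itv R n j j2.
have uv : i%:R / 2 ^+ n <= j%:R / 2 ^+ n :> R.
  by rewrite ler_pM2r ?invr_gt0 ?exprn_gt0// ler_nat ltnW.
have ex : exists m, (m <= n)%N && (i %/ 2 ^ (n - m) < j %/ 2 ^ (n - m))%N.
  by exists n; rewrite leqnn subnn expn0 !divn1.
case: (ex_minnP ex) => m /andP[mn hm] mmin.
have m0 : (0 < m)%N.
  case: m hm {mmin mn} => //; rewrite subn0 !divn_small//.
  exact: ltn_trans j2.
exists m.-1; split.
- by rewrite prednK.
- apply/anti_leq/andP; split; first by apply: leq_div2r; exact: ltnW.
  rewrite leqNgt; apply/negP => h.
  have := mmin m.-1; rewrite h andbT => /(_ (leq_trans (leq_pred _) mn)).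
  by rewrite leqNgt prednK// leqnn.
- rewrite prednK//; apply: (jump_fun_gap delta_gt0 delta_sum) => //.
  by rewrite !dyadic_trunc_coarse.
Qed.

(** Within one block the remainder modulo [M] is injective. *)
Lemma sum_divn_eq_le (L M c : nat) : (0 < M)%N ->
  \sum_(j < L) (c == (j %/ M)%N)%:R <= M%:R :> R.
Proof.
move=> M0; rewrite -natr_sum ler_nat.
have -> : (\sum_(j < L) (c == j %/ M) = #|[pred j : 'I_L | c == j %/ M]|)%N.
  by rewrite -sum1_card [RHS]big_mkcond/=; apply: eq_bigr => j _; rewrite inE; case: eqP.
pose g (j : 'I_L) : 'I_M := Ordinal (ltn_pmod j M0).
rewrite -(@card_in_image _ _ g); last first.
  move=> j k; rewrite !inE => /eqP cj /eqP ck /(congr1 val)/= jk.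
  by apply: val_inj; rewrite /= (divn_eq j M) (divn_eq k M) -cj -ck jk.
by rewrite -[X in (_ <= X)%N]card_ord max_card.
Qed.

(** The kernel at [(i, j)] is bounded by a sum over all levels at which the two share an ancestor,
    the last of which suffices. For fixed [i] and level [m] at most [2^(n - m)] indices [j]
    contribute, which gives [2^n] times the series bounded by [S]. *)
Lemma node_energy (al S : R) n : 0 < al ->
  (forall N, \sum_(m < N) (2 ^+ m * delta m.+1 `^ al)^-1 <= S) ->
  \sum_(i < 2 ^ n) \sum_(j < 2 ^ n | i != j)
    (`|jump_node a delta n i - jump_node a delta n j| `^ al)^-1 <= (2 ^+ n) ^+ 2 * S.
Proof.
move=> al0 hS.
have dal m : 0 < delta m `^ al by rewrite powR_gt0.
have pt (i j : 'I_(2 ^ n)) : i != j ->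
    (`|jump_node a delta n i - jump_node a delta n j| `^ al)^-1 <=
    \sum_(m < n) ((i %/ 2 ^ (n - m))%N == (j %/ 2 ^ (n - m))%N)%:R * (delta m.+1 `^ al)^-1.
  move=> ij.
  have [m [mn e g]] : exists m, [/\ (m < n)%N, (i %/ 2 ^ (n - m) = j %/ 2 ^ (n - m))%N &
      delta m.+1 <= `|jump_node a delta n i - jump_node a delta n j|].
    have [lt|lt|E] := ltngtP i j.
    - have [m [mn e g]] := node_gap lt (ltn_ord j); exists m; split => //.
      by rewrite distrC; apply: (le_trans g); exact: ler_norm.
    - have [m [mn e g]] := node_gap lt (ltn_ord i); exists m; split => //.
      by apply: (le_trans g); exact: ler_norm.
    - by move: ij; rewrite (val_inj E) eqxx.
  apply: (@le_trans _ _ (delta m.+1 `^ al)^-1).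
    rewrite lef_pV2 ?posrE//; last by rewrite powR_gt0// (lt_le_trans _ g).
    by apply: powR_le2l => //; exact: ltW.
  rewrite (bigD1 (Ordinal mn))//= e eqxx mul1r lerDl; apply: sumr_ge0 => k _.
  by rewrite mulr_ge0// invr_ge0 ltW.
apply: (@le_trans _ _ (\sum_(i < 2 ^ n) \sum_(j < 2 ^ n)
    \sum_(m < n) ((i %/ 2 ^ (n - m))%N == (j %/ 2 ^ (n - m))%N)%:R * (delta m.+1 `^ al)^-1)).
  apply: ler_sum => i _; rewrite big_mkcond; apply: ler_sum => j _.
  case: ifP => [ij|_]; first exact: pt.
  by apply: sumr_ge0 => k _; rewrite mulr_ge0// invr_ge0 ltW.
apply: (@le_trans _ _ (\sum_(i < 2 ^ n) 2 ^+ n * S)); last first.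
  by rewrite sumr_const card_ord -[_ *+ (2 ^ n)]mulr_natl natrX expr2 mulrA.
apply: ler_sum => i _; rewrite exchange_big/=.
apply: (@le_trans _ _ (\sum_(m < n) 2 ^+ n * (2 ^+ m * delta m.+1 `^ al)^-1)); last first.
  by rewrite -mulr_sumr ler_pM2l ?exprn_gt0.
apply: ler_sum => m _; rewrite -mulr_suml invfM mulrA.
apply: ler_wpM2r; first by rewrite invr_ge0 ltW.
have M0 : (0 < 2 ^ (n - m))%N by rewrite expn_gt0.
apply: (le_trans (sum_divn_eq_le _ _ M0)).
rewrite natrX ler_pdivlMr ?exprn_gt0// -exprD subnK//.
exact: ltnW.
Qed.

End node_energy.

Section union_bound.
Context {disp : measure_display} {T : measurableType disp} {R : realType}.
Variable P : probability T R.

Lemma union_bound (I : eqType) (s : seq I) (A : I -> set T) (c : R) :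
  (forall i, measurable (A i)) -> (forall i, i \in s -> (P (A i) <= c%:E)%E) ->
  measurable [set w | exists2 i, i \in s & A i w] /\
  (P [set w | exists2 i, i \in s & A i w] <= ((size s)%:R * c)%:E)%E.
Proof.
move=> mA; elim: s => [|i s IH] hc.
  have -> : [set w | exists2 i, i \in [::] & A i w] = set0.
    by apply/seteqP; split => w // [].
  by split => //; rewrite measure0 mul0r.
have [mS PS] := IH (fun j js => hc j (mem_behead (s := i :: s) js)).
have -> : [set w | exists2 j, j \in i :: s & A j w] =
    A i `|` [set w | exists2 j, j \in s & A j w].
  apply/seteqP; split => w.
    move=> [j]; rewrite inE => /orP[/eqP->|js] Aj; [by left|right].
    by exists j.
  by move=> [Ai|[j js Aj]]; [exists i; rewrite ?mem_head|exists j; rewrite ?inE ?js ?orbT].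
split; first exact: measurableU.
apply: (le_trans (measureU2 _ (mA i) mS)).
rewrite /= -natr1 mulrDl mul1r addrC EFinD; apply: leeD => //.
by apply: hc; rewrite mem_head.
Qed.

End union_bound.

Lemma pair_cst_ge0 (R : realType) (c : R) : 0 <= pair_cst c.
Proof. by apply: mulr_ge0; [exact: ler0n|exact: sqr_ge0]. Qed.

(** * Lower bound for the hitting probability by the second moment method *)

Section positive_hitting.
Context {disp : measure_display} {T : measurableType disp} {R : realType}.
Variables (P : probability T R) (H : R) (d : nat).
Variables (B : 'I_d -> R -> {RV P >-> R}) (f : R -> 'rV[R]_d).
Hypotheses (H0 : 0 < H) (H1 : H < 1) (fB : is_fbm H B) (hf : hoelder_on01 H f).
Variables (a b : R) (delta : nat -> R).
Hypotheses (a0 : 0 < a) (b1 : b <= 1).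
Hypotheses (delta_gt0 : forall j, 0 < delta j)
  (delta_sum : forall N, \sum_(j < N) delta j * 2 ^+ j <= b - a).

Notation node := (jump_node a delta).

Lemma node_ab n i : (i < 2 ^ n)%N -> a <= node n i <= b.
Proof. by move=> /(@node_itv R)/andP[]; exact: jump_fun_itv. Qed.

(** The off-diagonal pairs contribute at most the energy times [(2^n e^d)^2], the diagonal ones a
    multiple of [2^n e^d]. The latter are harmless once [2^n e^d >= 1], and this ties the level [n]
    to the radius [e]. *)
Lemma hit_level_ge (S : R) (x : 'rV[R]_d) : (0 < d)%N ->
  (forall N, \sum_(m < N) (2 ^+ m * delta m.+1 `^ (H * d%:R))^-1 <= S) ->
  exists2 c : R, 0 < c & forall k, (c%:E <= P (hit_level B f node x k))%E.
Proof.
move=> d0 hS.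
have al0 : 0 < H * d%:R by rewrite mulr_gt0// ltr0n.
have [Cf Cf0 hCf] := hoelder_coord hf.
(* Bounds [|x - f s| + e] in every coordinate: [f s] stays within [Cf] of [f 0] on [[0, 1]], and
   [e <= 1]. *)
pose M : R := \sum_(i < d) (`|x ord0 i| + `|f 0 ord0 i|) + Cf + 1.
pose cl := near_low_cst H a M.
pose Cu := near_cst H a.
pose Cp := pair_near_cst H a.
have cl0 : 0 < cl by exact: near_low_cst_gt0.
have Cu0 : 0 < Cu by rewrite mulr_gt0// normal_peak_gt0// gt_eqF// powR_gt0.
have Cp0 : 0 <= Cp by exact: pair_cst_ge0.
have S0 : 0 <= S by have := hS 0%N; rewrite big_ord0.
pose G := Cu ^+ d + Cp ^+ d * S.
have G0 : 0 < G by rewrite ltr_pwDl ?exprn_gt0// mulr_ge0 ?exprn_ge0.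
pose L := cl ^+ d.
have L0 : 0 < L by rewrite exprn_gt0.
exists (L ^+ 2 / G); first by rewrite divr_gt0 ?exprn_gt0.
move=> k.
pose e : R := k.+2%:R^-1.
have e0 : 0 < e by rewrite invr_gt0.
have e1 : e <= 2^-1 by rewrite lef_pV2 ?posrE// ler_nat.
have ed0 : 0 < e ^+ d by rewrite exprn_gt0.
(* Generous, but enough: [n + 1 <= 2^n] gives [2^n e^d >= 1], and no upper bound on [2^n e^d] is
   used. *)
pose n := Num.truncn (e ^+ d)^-1.
have ei : 0 <= (e ^+ d)^-1 by rewrite invr_ge0 ltW.
have /andP[_ hn] := truncn_itv ei; rewrite -/n in hn.
have Ne : 1 <= 2 ^+ n * e ^+ d.
  rewrite -ler_pdivrMr// mul1r (le_trans (ltW hn))// -natrX ler_nat; exact: ltn_expl.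
set N : R := 2 ^+ n in Ne.
have N0 : 0 < N by rewrite exprn_gt0.
pose A i := near_event B f x e (node n i).
have mA i : measurable (A i) by exact: near_event_measurable.
pose mu := L / G.
have mu0 : 0 < mu by rewrite divr_gt0.
have nodes (i : 'I_(2 ^ n)) : a <= node n i /\ node n i <= 1.
  by have /andP[h1 h2] := node_ab (ltn_ord i); split => //; exact: le_trans b1.
have in01 (i : 'I_(2 ^ n)) : node n i \in `[0, 1].
  by have [h1 h2] := nodes i; rewrite in_itv/= h2 andbT (le_trans (ltW a0)).
have finP (E : set T) : measurable E -> P E \is a fin_num by move=> mE; exact: fin_num_measure.
have lowA (i : 'I_(2 ^ n)) : L * e ^+ d <= fine (P (A i)).
  have [h1 h2] := nodes i.
  rewrite -lee_fin fineK ?finP// /L -exprMn; apply: near_event_ge => // l.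
  have h3 := hCf l 0 (node n i) _ (in01 i).
  have {}h3 : `|f 0 ord0 l - f (node n i) ord0 l| <= Cf.
    apply: le_trans (h3 _) _; first by rewrite in_itv/= lexx ler01.
    rewrite -[leRHS]mulr1; apply: ler_wpM2l => //; apply: powR_le1 => //; first exact: ltW.
    by rewrite sub0r normrN ger0_norm// (le_trans (ltW a0)).
  have h4 : `|x ord0 l| + `|f 0 ord0 l| <= \sum_(i < d) (`|x ord0 i| + `|f 0 ord0 i|).
    by rewrite (bigD1 l)//= lerDl; apply: sumr_ge0 => j _; rewrite addr_ge0.
  have -> : x ord0 l - f (node n i) ord0 l = (x ord0 l - f 0 ord0 l) + (f 0 ord0 l - f (node n i) ord0 l).
    by rewrite addrA subrK.
  have h5 := ler_normD (x ord0 l - f 0 ord0 l) (f 0 ord0 l - f (node n i) ord0 l).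
  have h6 := ler_normB (x ord0 l) (f 0 ord0 l).
  rewrite /M; lra.
have upA (i : 'I_(2 ^ n)) : fine (P (A i)) <= Cu ^+ d * e ^+ d.
  have [h1 h2] := nodes i.
  by rewrite -lee_fin fineK ?finP// -exprMn; apply: near_event_le.
have neq (i j : 'I_(2 ^ n)) : i != j -> node n i != node n j.
  move=> ij; have [lt|lt|E] := ltngtP i j.
  - have [m [_ _ h]] := node_gap delta_gt0 delta_sum lt (ltn_ord j).
    by rewrite eq_sym -subr_eq0 gt_eqF// (lt_le_trans _ h).
  - have [m [_ _ h]] := node_gap delta_gt0 delta_sum lt (ltn_ord i).
    by rewrite -subr_eq0 gt_eqF// (lt_le_trans _ h).
  - by move: ij; rewrite (val_inj E) eqxx.
have pairA (i j : 'I_(2 ^ n)) : i != j -> fine (P (A i `&` A j)) <=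
    Cp ^+ d * (e ^+ d) ^+ 2 * (`|node n i - node n j| `^ (H * d%:R))^-1.
  move=> ij; have [h1 h2] := nodes i; have [h3 h4] := nodes j.
  rewrite -lee_fin fineK ?finP//; last exact: measurableI.
  have hp := near_event_pair_le f H0 H1 fB a0 x h1 h2 h3 h4 (neq _ _ ij) e0 e1.
  apply: (le_trans hp).
  rewrite lee_fin expr_div_n exprMn -/Cp powRrM powR_mulrn ?powR_ge0//.
  by rewrite -!exprM mulnC.
have mom2 : \sum_(i < 2 ^ n) \sum_(j < 2 ^ n) fine (P (A i `&` A j)) <=
    (N * e ^+ d) ^+ 2 * G.
  apply: (@le_trans _ _ (\sum_(i < 2 ^ n) (Cu ^+ d * e ^+ d + \sum_(j < 2 ^ n | i != j)
      Cp ^+ d * (e ^+ d) ^+ 2 * (`|node n i - node n j| `^ (H * d%:R))^-1))).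
    apply: ler_sum => i _; rewrite (bigD1 i)//= setIid; apply: lerD => //.
    rewrite (eq_bigl (fun j => i != j)); last by move=> j; rewrite eq_sym.
    by apply: ler_sum => j ij; exact: pairA.
  rewrite big_split/= sumr_const card_ord -[_ *+ (2 ^ n)]mulr_natl natrX -/N.
  under [X in _ + X <= _]eq_bigr do rewrite -mulr_sumr.
  rewrite -mulr_sumr.
  have en := node_energy delta_gt0 delta_sum n al0 hS.
  have h1 : Cp ^+ d * (e ^+ d) ^+ 2 * \sum_(i < 2 ^ n) \sum_(j < 2 ^ n | i != j)
     (`|node n i - node n j| `^ (H * d%:R))^-1 <= Cp ^+ d * (e ^+ d) ^+ 2 * (N ^+ 2 * S).
    by apply: ler_wpM2l => //; rewrite mulr_ge0 ?exprn_ge0// ltW.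
  apply: (le_trans (lerD (lexx _) h1)).
  have h2 : N * (Cu ^+ d * e ^+ d) <= (N * e ^+ d) ^+ 2 * Cu ^+ d.
    have -> : N * (Cu ^+ d * e ^+ d) = (N * e ^+ d) * Cu ^+ d by ring.
    apply: ler_wpM2r; first by rewrite exprn_ge0// ltW.
    by rewrite expr2 ler_peMr// ltW// mulr_gt0.
  apply: (le_trans (lerD h2 (lexx _))).
  by rewrite /G le_eqVlt; apply/orP; left; apply/eqP; ring.
have mom1 : N * (L * e ^+ d) <= \sum_(i < 2 ^ n) fine (P (A i)).
  have -> : N * (L * e ^+ d) = \sum_(i < 2 ^ n) L * e ^+ d.
    by rewrite sumr_const card_ord -[_ *+ (2 ^ n)]mulr_natl natrX.
  by apply: ler_sum => i _; exact: lowA.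
(* After scaling by [N e^d] the lower bound reads [2 mu L - mu^2 G], maximal at [mu = L / G] with
   value [L^2 / G]. *)
pose lam := mu / (N * e ^+ d).
have Ned0 : 0 < N * e ^+ d by rewrite mulr_gt0.
have sm := second_moment P (2 ^ n) lam mA.
have h : L ^+ 2 / G <= fine (P (\bigcup_(i < 2 ^ n) A i)).
  apply: le_trans sm.
  have h1 : 2 * lam * (N * (L * e ^+ d)) <= 2 * lam * \sum_(i < 2 ^ n) fine (P (A i)).
    by apply: ler_wpM2l => //; rewrite mulr_ge0// divr_ge0// ltW.
  have h2 : lam ^+ 2 * (\sum_(i < 2 ^ n) \sum_(j < 2 ^ n) fine (P (A i `&` A j))) <=
      lam ^+ 2 * ((N * e ^+ d) ^+ 2 * G).
    by apply: ler_wpM2l => //; rewrite sqr_ge0.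
  have E1 : 2 * lam * (N * (L * e ^+ d)) = 2 * mu * L.
    by rewrite /lam; field; rewrite !gt_eqF.
  have E2 : lam ^+ 2 * ((N * e ^+ d) ^+ 2 * G) = mu ^+ 2 * G.
    by rewrite /lam; field; rewrite !gt_eqF.
  have E3 : 2 * mu * L - mu ^+ 2 * G = L ^+ 2 / G.
    by rewrite /mu; field; rewrite gt_eqF.
  lra.
have mU : measurable (\bigcup_(i < 2 ^ n) A i) by apply: bigcup_measurable => i _.
apply: (@le_trans _ _ (P (\bigcup_(i < 2 ^ n) A i))).
  by rewrite -[leRHS]fineK ?finP// lee_fin.
apply: le_measure; rewrite ?inE//.
  exact: hit_level_measurable.
by move=> w [i i2 Ai]; exists n => //; exists i.
Qed.

End positive_hitting.

Section nodes.
Context {R : realType}.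
Variables (a b : R) (delta : nat -> R).
Hypotheses (delta_gt0 : forall j, 0 < delta j)
  (delta_sum : forall N, \sum_(j < N) delta j * 2 ^+ j <= b - a).

(** A close node is found at all large levels, not merely at one: chaining must start from a node at
    or beyond a prescribed level. *)
Lemma jump_node_dense (s e : R) : jump_set a delta s -> 0 < e ->
  \forall n \near \oo, exists2 i, (i < 2 ^ n)%N & `|s - jump_node a delta n i| < e.
Proof.
move=> Ks e0; have e20 : 0 < e / 2 by rewrite divr_gt0.
have tail n N : \sum_(j < N | (n < j)%N) delta j * 2 ^+ (j - n) <= (b - a) * 2^-1 ^+ n.
  rewrite exprVn -ler_pdivrMr ?invr_gt0 ?exprn_gt0// invrK mulr_suml.
  apply: le_trans (delta_sum N); rewrite big_mkcond; apply: ler_sum => j _.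
  case: ifP => nj; last by rewrite mulr_ge0 ?exprn_ge0// ltW.
  by rewrite -mulrA -exprD subnK// ltnW.
have [u /andP[u0 u1] su] := jump_set_near Ks e20.
have e40 : 0 < e / 4 by rewrite divr_gt0.
have h := @geometric_small R (b - a) 2^-1 _ _ _ e40.
near=> n.
have [i i2 /andP[h1 h2]] := jump_fun_node delta_gt0 delta_sum u0 u1 (tail n).
exists i => //.
have h3 : (b - a) * 2^-1 ^+ n <= e / 4 by near: n; apply: h; lra.
move: (su); rewrite !ltr_norml => /andP[h4 h5]; apply/andP; split; lra.
Unshelve. all: by end_near. Qed.

Lemma jump_set_nodes : 0 <= a -> b <= 1 ->
  [/\ jump_set a delta `<=` [set` `[0, 1]],
      forall n i, (i < 2 ^ n)%N -> jump_set a delta (jump_node a delta n i) &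
      forall s e : R, jump_set a delta s -> 0 < e ->
        exists n i, (i < 2 ^ n)%N /\ `|s - jump_node a delta n i| < e].
Proof.
move=> a0 b1; split.
- move=> s /(jump_set_itv delta_gt0 delta_sum); rewrite /= !in_itv/= => /andP[h1 h2].
  by rewrite (le_trans a0)//= (le_trans h2).
- by move=> n i /(@node_itv R)/andP[]; exact: jump_set_fun.
- move=> s e Ks e0.
  have [N _ /(_ N (leqnn N))[i i2 h]] := jump_node_dense Ks e0.
  by exists N, i.
Qed.

Lemma jump_node_coarse n k i (c : R) : (i < 2 ^ (n + k))%N ->
  (forall N, \sum_(j < N | (n < j)%N) delta j * 2 ^+ (j - n) <= c) ->
  `|jump_node a delta (n + k) i - jump_node a delta n (i %/ 2 ^ k)| <= c.
Proof.
move=> i2 hc; have /andP[u0 u1] := @node_itv R _ _ i2.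
have := jump_fun_floor delta_gt0 delta_sum u0 u1 hc.
rewrite /dyadic_floor dyadic_trunc_coarse ?leq_addr// addKn => /andP[h1 h2].
by rewrite ger0_norm.
Qed.

End nodes.

(** * Vanishing hitting probability by chaining *)

Section null_hitting.
Context {disp : measure_display} {T : measurableType disp} {R : realType}.
Variables (P : probability T R) (H : R) (d : nat).
Variables (B : 'I_d -> R -> {RV P >-> R}) (f : R -> 'rV[R]_d).
Hypotheses (H0 : 0 < H) (H1 : H < 1) (fB : is_fbm H B) (hf : hoelder_on01 H f).
Hypothesis d0 : (0 < d)%N.
Variables (a b : R) (delta : nat -> R).
Hypotheses (a0 : 0 < a) (b1 : b <= 1).
Hypotheses (delta_gt0 : forall j, 0 < delta j)
  (delta_sum : forall N, \sum_(j < N) delta j * 2 ^+ j <= b - a).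
Variables (rho : nat -> R) (nu A : R).
Hypotheses (rho_gt0 : forall n, 0 < rho n)
  (rho_tail : forall n N, \sum_(j < N | (n < j)%N) delta j * 2 ^+ (j - n) <= rho n)
  (nu_gt0 : 0 < nu) (nud : nu ^+ d = 2^-1) (A_gt0 : 0 < A)
  (rho_le : forall n, rho n `^ H <= A * (nu ^+ n / n.+1%:R ^+ 2)).

Notation node := (jump_node a delta).

(** Compared with the bound on [rho n] to the power [H], one of the two factors [n + 1] is given up
    to the Gaussian tail; the remaining one makes [2^n theta^d] equal to [(n + 1)^(-d)]. *)
Let theta n : R := nu ^+ n / n.+1%:R.

Let theta_gt0 n : 0 < theta n.
Proof. by rewrite divr_gt0// exprn_gt0. Qed.

Let nu_lt1 : nu < 1.
Proof.
rewrite ltNge; apply/negP => h; have : 1 <= nu ^+ d by rewrite exprn_ege1.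
by rewrite nud; lra.
Qed.

Let node01 n i : (i < 2 ^ n)%N -> node n i \in `[0, 1].
Proof.
move=> /(node_ab delta_gt0 delta_sum)/andP[h1 h2].
by rewrite in_itv/= (le_trans (ltW a0))//= (le_trans h2).
Qed.

(* Node i of level n.+1 has parent i %/ 2 in level n; there are 2 ^ n.+1 such pairs, each
   contributing exp (- c n ^ 2) because theta n exceeds the deviation by a factor n. *)
Definition large_increment n : set T :=
  [set w | exists2 il, il \in [seq (i, l) | i <- iota 0 (2 ^ n.+1), l <- enum 'I_d] &
    [set w | theta n < `|B il.2 (node n.+1 il.1) w - B il.2 (node n (il.1 %/ 2)) w|] w].

Lemma large_increment_le : exists C : R, forall n,
  measurable (large_increment n) /\ (P (large_increment n) <= (C * 2^-1 ^+ n)%:E)%E.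
Proof.
(* From the tail exponent [theta^2 / (4 rho^(2 H))] and [(n + 1) rho^H <= A theta]. *)
pose c : R := (4 * A ^+ 2)^-1.
have c0 : 0 < c by rewrite invr_gt0 mulr_gt0// exprn_gt0.
exists (2 * d%:R * expR c^-1) => n.
have [mL PL] : measurable (large_increment n) /\ (P (large_increment n) <=
    ((size [seq (i, l) | i <- iota 0 (2 ^ n.+1), l <- enum 'I_d])%:R *
     (2 * expR (- (c * n.+1%:R ^+ 2))))%:E)%E.
  apply: union_bound => [[i l]|[i l] /allpairsP[[i' l'] /= [hi _ [-> ->]]]] /=.
    rewrite [X in measurable X](_ : _ =
        setT `&` (fun w => `|B l (node n.+1 i) w - B l (node n (i %/ 2)) w|) @^-1` [set` `]theta n, +oo[]); last first.
      by apply/seteqP; split => w /=; rewrite in_itv/= andbT => // -[].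
    apply: (@measurableT_comp _ _ _ _ _ _ (@Num.norm _ R)) => //.
    by apply: measurable_funB; exact: measurable_funP.
  have i2 : (i' < 2 ^ n.+1)%N by move: hi; rewrite mem_iota.
  have i1 : (i' %/ 2 < 2 ^ n)%N by rewrite ltn_divLR// -expnSr.
  have fX : is_real_fbm H (B l') by case: fB.
  have inc : `|node n.+1 i' - node n (i' %/ 2)| <= rho n.
    by have := @jump_node_coarse R a b delta delta_gt0 delta_sum n 1 i' (rho n);
      rewrite addn1 expn1; apply.
  apply: (le_trans (fbm_increment_tail H0 fX (node01 i1) (node01 i2) inc (rho_gt0 n) (ltW (theta_gt0 n)))).
  rewrite lee_fin; apply: ler_wpM2l => //; rewrite ler_expR lerN2.
  have r0 : 0 < rho n `^ H by rewrite powR_gt0.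
  rewrite ler_pdivlMr; last by rewrite mulr_gt0// exprn_gt0.
  have h : A * theta n >= n.+1%:R * rho n `^ H.
    rewrite mulrC -ler_pdivlMr// (le_trans (rho_le n))// /theta.
    by rewrite expr2 invfM !mulrA.
  have h2 : (n.+1%:R * rho n `^ H) ^+ 2 <= (A * theta n) ^+ 2.
    by apply: sqr_le2 => //; rewrite mulr_ge0// ltW.
  have -> : c * n.+1%:R ^+ 2 * (4 * (rho n `^ H) ^+ 2) = (n.+1%:R * rho n `^ H) ^+ 2 / A ^+ 2.
    by rewrite /c; field; rewrite gt_eqF.
  by rewrite ler_pdivrMr ?exprn_gt0// [leRHS]mulrC -exprMn.
split=> //; apply: (le_trans PL); rewrite lee_fin size_allpairs size_iota size_enum_ord natrM.
(* The target [2^(-n)] is split off, leaving an extra [2^n] to be beaten. With [y = n + 1] both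
   powers of 2 are at most [exp (2 y)] together, and [2 y - c y^2 <= 1 / c]. *)
have -> : (2 ^ n.+1)%:R * d%:R * (2 * expR (- (c * n.+1%:R ^+ 2))) =
    2 * d%:R * ((2 ^+ n.+1 * 2 ^+ n) * expR (- (c * n.+1%:R ^+ 2)) * 2^-1 ^+ n) :> R.
  rewrite exprVn natrX; field.
  by rewrite expf_neq0.
rewrite -[leRHS]mulrA; apply: ler_wpM2l => //.
apply: ler_wpM2r; first by rewrite exprn_ge0.
have e4 : 2 ^+ n.+1 * 2 ^+ n <= expR (2 * n.+1%:R) :> R.
  apply: (@le_trans _ _ (2 ^+ n.+1 * 2 ^+ n.+1)).
    by rewrite ler_pM2l ?exprn_gt0// ler_eXn2l// ltr1n.
  rewrite -exprD addnn -mul2n -natrM -[(2 * n.+1)%:R]mulr1 expRM_natl.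
  by rewrite lerXn2r ?nnegrE ?expR_ge0// (le_trans _ (expR_ge1Dx 1)).
apply: (@le_trans _ _ (expR (2 * n.+1%:R) * expR (- (c * n.+1%:R ^+ 2)))).
  by apply: ler_wpM2r => //; exact: expR_ge0.
rewrite -expRD ler_expR.
set y : R := n.+1%:R.
have -> : 2 * y + - (c * y ^+ 2) = c^-1 - c * (y - c^-1) ^+ 2.
  by field; rewrite gt_eqF.
by rewrite gerBl mulr_ge0 ?sqr_ge0// ltW.
Qed.

Let large_tail n := \bigcup_k large_increment (n + k).

Lemma large_tail_le : exists C : R, forall n,
  measurable (large_tail n) /\ (P (large_tail n) <= (C * 2^-1 ^+ n)%:E)%E.
Proof.
have [C hC] := large_increment_le; exists (C * 2) => n.
have mL k : measurable (large_increment k) by case: (hC k).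
have mT : measurable (large_tail n) by apply: bigcup_measurable.
have C0 : 0 <= C.
  have [_ h] := hC 0%N; rewrite expr0 mulr1 in h.
  by rewrite -lee_fin (le_trans _ h).
split => //.
have := measure_sigma_subadditive P (A := large_tail n) (F := fun k => large_increment (n + k)%N).
move=> /(_ (fun k => mL (n + k)%N) mT (fun w => id)) h; apply: (le_trans h).
apply: lime_le; first by apply: is_cvg_nneseries => k _ _; exact: measure_ge0.
near=> N; rewrite big_mkord.
apply: (@le_trans _ _ (\sum_(k < N) (C * 2^-1 ^+ (n + k))%:E)%E).
  by apply: lee_sum => k _; case: (hC (n + k)%N).
rewrite sumEFin lee_fin.
under eq_bigr do rewrite exprD mulrA.
rewrite -mulr_sumr [leRHS]mulrAC; apply: ler_wpM2l; first by rewrite mulr_ge0// exprn_ge0.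
by have := @sum_geometric_le R N 2^-1; rewrite (_ : (1 - 2^-1)^-1 = 2 :> R); [apply; lra|field].
Unshelve. all: by end_near. Qed.

(** Telescoping along the ancestors of node [i] down to level [n]; off the exceptional event the
    steps are at most [theta (n + j) <= theta n * nu^j]. *)
Lemma chaining n k i l w : ~ large_tail n w -> (i < 2 ^ (n + k))%N ->
  `|B l (node (n + k) i) w - B l (node n (i %/ 2 ^ k)) w| <= theta n * (1 - nu)^-1.
Proof.
move=> hw i2; apply: (@le_trans _ _ (theta n * \sum_(j < k) nu ^+ j)); last first.
  by apply: ler_wpM2l; [exact: ltW|apply: sum_geometric_le => //; exact: ltW].
elim: k i i2 => [|k IH] i i2.
  by rewrite big_ord0 addn0 expn0 divn1 subrr normr0 mulr0.
have i1 : (i %/ 2 < 2 ^ (n + k))%N by rewrite ltn_divLR// -expnSr -addnS.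
have := IH _ i1; rewrite -divnMA -expnS => {}IH.
rewrite big_ord_recr/= mulrDr [leRHS]addrC.
have -> : B l (node (n + k.+1) i) w - B l (node n (i %/ 2 ^ k.+1)) w =
  (B l (node (n + k.+1) i) w - B l (node (n + k) (i %/ 2)) w) +
  (B l (node (n + k) (i %/ 2)) w - B l (node n (i %/ 2 ^ k.+1)) w) by rewrite addrA subrK.
apply: (le_trans (ler_normD _ _)); apply: lerD => //.
apply: (@le_trans _ _ (theta (n + k))); last first.
  rewrite /theta exprD [leRHS]mulrAC; apply: ler_wpM2l; first by rewrite mulr_ge0// exprn_ge0// ltW.
  by rewrite lef_pV2 ?posrE// ler_nat ltnS leq_addr.
rewrite leNgt; apply/negP => h; apply: hw; exists k => //.
exists (i, l) => /=; last by rewrite -addnS.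
by apply/allpairsP; exists (i, l); rewrite /= mem_iota mem_enum -addnS.
Qed.

Lemma hitting_event_eq0 x : P (hitting_event B f (jump_set a delta) x) = 0%E.
Proof.
have [Cf Cf0 hCf] := hoelder_coord hf.
have [K01 nodeK dense] := jump_set_nodes delta_gt0 delta_sum (ltW a0) b1.
have mK := hitting_event_measurable H0 fB hf K01 (@jump_set_closed _ _ _) nodeK dense x.
(* Three errors in units of [theta n]: from the hit to a fine node, from that node to its ancestor
   of level [n] along [B], and the same passage along [f]. *)
pose Ct : R := 1 + (1 - nu)^-1 + Cf * A.
have nu1 : 0 < 1 - nu by rewrite subr_gt0.
have Ct0 : 0 < Ct by rewrite ltr_pwDl ?mulr_ge0//; [rewrite addr_gt0// invr_gt0|exact: ltW].
have [C hC] := large_tail_le.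
have C0 : 0 <= C.
  have [_ h] := hC 0%N; rewrite expr0 mulr1 in h.
  by rewrite -lee_fin (le_trans _ h).
pose G : R := (near_cst H a * Ct) ^+ d.
have G0 : 0 <= G by rewrite exprn_ge0// mulr_ge0 ?ltW// mulr_gt0 ?normal_peak_gt0// gt_eqF// powR_gt0.
pose near_node n := [set w | exists2 i, i \in iota 0 (2 ^ n) & near_event B f x (Ct * theta n) (node n i) w].
have sub n : hitting_event B f (jump_set a delta) x `<=` large_tail n `|` near_node n.
  move=> w /hitting_eventP[s Ks ds].
  have [h|hw] := pselect (large_tail n w); [by left|right].
  have [r r0 hr] := deviation_modulus H0 fB hf K01 x w Ks (theta_gt0 n).
  (* Chaining controls [B] along nodes only; path continuity bridges from the hit [s] to a
     sufficiently fine node, whose depth may depend on [w]. *)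
  have [N _ /(_ (n + N)%N (leq_addl _ _))[i i2 si]] := jump_node_dense delta_gt0 delta_sum Ks r0.
  set t := node (n + N) i in si.
  have t01 : t \in `[0, 1] := node01 i2.
  have := hr t t01 si; rewrite ds sub0r normrN ger0_norm ?deviation_ge0// => /ltW/deviation_near dt.
  have j2 : (i %/ 2 ^ N < 2 ^ n)%N by rewrite ltn_divLR ?expn_gt0// -expnD.
  exists (i %/ 2 ^ N)%N; first by rewrite mem_iota.
  move=> l; set t' := node n _.
  have g1 := dt l.
  have g2 := chaining l hw i2; rewrite -/t -/t' in g2.
  have g3 : `|f t ord0 l - f t' ord0 l| <= Cf * (A * theta n).
    apply: (le_trans (hCf l t t' t01 (node01 j2))); apply: ler_wpM2l => //.
    have h1 : `|t - t'| `^ H <= rho n `^ H.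
      by apply: powR_le2l => //; [exact: ltW|exact: jump_node_coarse].
    apply: (le_trans h1); apply: (le_trans (rho_le n)).
    apply: ler_wpM2l; first exact: ltW.
    rewrite /theta; apply: ler_wpM2l; first by rewrite exprn_ge0// ltW.
    by rewrite lef_pV2 ?posrE ?exprn_gt0// ler_eXnr// ler1n.
  have -> : B l t' w - (x ord0 l - f t' ord0 l) =
    (B l t w - (x ord0 l - f t ord0 l)) - (B l t w - B l t' w) - (f t ord0 l - f t' ord0 l) by ring.
  have -> : Ct * theta n = theta n + theta n * (1 - nu)^-1 + Cf * (A * theta n).
    by rewrite /Ct; ring.
  apply: (le_trans (ler_normB _ _)); apply: lerD => //.
  by apply: (le_trans (ler_normB _ _)); apply: lerD.
(* Both contributions, [2^(-n)] and [2^n theta^d = (n + 1)^(-d)], are at most [1 / (n + 1)], the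
   second because [d > 0]. *)
have bd n : (P (hitting_event B f (jump_set a delta) x) <= ((C + G) / n.+1%:R)%:E)%E.
  have [mL PL] := hC n.
  have [mN PN] : measurable (near_node n) /\
      (P (near_node n) <= ((size (iota 0 (2 ^ n)))%:R * (G * theta n ^+ d))%:E)%E.
    apply: union_bound => [i|i]; first exact: near_event_measurable.
    rewrite mem_iota/= add0n => i2.
    have /andP[h1 h2] := node_ab delta_gt0 delta_sum i2.
    have := near_event_le f H0 fB a0 x h1 (le_trans h2 b1) (mulr_gt0 Ct0 (theta_gt0 n)).
    by rewrite (mulrA (near_cst H a)) exprMn.
  apply: (le_trans (le_measure _ _ _ (@sub n))); rewrite ?inE//; first exact: measurableU.
  apply: (le_trans (measureU2 _ mL mN)).
  apply: (le_trans (leeD PL PN)).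
  rewrite -EFinD lee_fin mulrDl; apply: lerD.
    apply: ler_wpM2l => //; rewrite exprVn lef_pV2 ?posrE ?exprn_gt0//.
    by rewrite -natrX ler_nat ltn_expl.
  rewrite size_iota natrX mulrCA; apply: ler_wpM2l => //.
  rewrite /theta expr_div_n -exprM mulnC exprM nud mulrA exprVn mulfV ?expf_neq0// mul1r.
  by rewrite lef_pV2 ?posrE ?exprn_gt0// ler_eXnr// ler1n.
apply/eqP; rewrite eq_le measure_ge0 andbT.
have CG0 : 0 <= C + G by rewrite addr_ge0.
apply/lee_addgt0Pr => e e0; rewrite add0e.
have h0 : 0 <= (C + G) / e by rewrite divr_ge0// ltW.
have /andP[_ h] := truncn_itv h0.
apply: (le_trans (bd (Num.truncn ((C + G) / e)))).
by rewrite lee_fin ler_pdivrMr// mulrC -ler_pdivrMr// ltW.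
Qed.

End null_hitting.

(** * Choice of the weights and the two sets *)

Section hitting_sets.
Context {disp : measure_display} {T : measurableType disp} {R : realType}.

Lemma ex_nat_ge2 (s : R) : 0 < s -> exists q : nat, 2 <= q%:R * s.
Proof.
move=> s0; exists (Num.truncn (2 / s)).+1.
have h : 0 <= 2 / s by rewrite divr_ge0// ltW.
by have /andP[_ /ltW] := truncn_itv h; rewrite ler_pdivrMr.
Qed.

Lemma sqr_le_powR (x s : R) (q : nat) : 1 <= x -> 2 <= q%:R * s -> x ^+ 2 <= (x ^+ q) `^ s.
Proof.
move=> x1 qs; have x0 : 0 <= x := le_trans ler01 x1.
by rewrite -(powR_mulrn q x0) -powRrM -(powR_mulrn 2 x0); exact: ler_powR.
Qed.

(** Telescoping with [1 / (m + 2)^2 <= 1 / (m + 1) - 1 / (m + 2)]. *)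
Lemma sum_inv_sqr_le1 N : \sum_(m < N) (m.+2%:R ^+ 2)^-1 <= 1 :> R.
Proof.
apply: (@le_trans _ _ (1 - N.+1%:R^-1)); last by rewrite gerBl.
elim: N => [|N IH]; first by rewrite big_ord0 invr1 subrr.
rewrite big_ord_recr/=; apply: (le_trans (lerD IH (lexx _))).
have h1 : 0 < N.+1%:R :> R by [].
have -> : N.+2%:R = N.+1%:R + 1 :> R by rewrite natr1.
set y : R := N.+1%:R in h1 *.
have y1 : 0 < y + 1 by rewrite addr_gt0.
have -> : 1 - (y + 1)^-1 = 1 - y^-1 + (y * (y + 1))^-1.
  by field; rewrite !gt_eqF.
by rewrite lerD2l lef_pV2 ?posrE ?exprn_gt0 ?mulr_gt0// expr2 ler_pM2r// lerDl.
Qed.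

Variables (P : probability T R) (H a b : R) (d : nat).
Variables (B : 'I_d -> R -> {RV P >-> R}) (f : R -> 'rV[R]_d).
Hypotheses (H0 : 0 < H) (H1 : H < 1) (fB : is_fbm H B) (hf : hoelder_on01 H f).
Hypotheses (d0 : (0 < d)%N) (Hd1 : H * d%:R < 1) (a0 : 0 < a) (ab : a < b) (b1 : b <= 1).

Let al := H * d%:R.
Let lam : R := 2 `^ (- al^-1).

Let al0 : 0 < al. Proof. by rewrite mulr_gt0// ltr0n. Qed.

Let lam0 : 0 < lam. Proof. exact: powR_gt0. Qed.

Let lam2 : 2 * lam < 1.
Proof.
have : lam < 2^-1 by rewrite -pow2N1; apply: pow2N_lt; rewrite invf_gt1.
by lra.
Qed.

Let lam_al : lam `^ al = 2^-1.
Proof. by rewrite -powRrM mulNr mulVf ?gt_eqF// pow2N1. Qed.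

Lemma jump_set_hitting_measurable (delta : nat -> R) x :
  (forall j, 0 < delta j) -> (forall N, \sum_(j < N) delta j * 2 ^+ j <= b - a) ->
  measurable (hitting_event B f (jump_set a delta) x).
Proof.
move=> dp dS; have [K01 nodeK dense] := jump_set_nodes dp dS (ltW a0) b1.
exact: (hitting_event_measurable H0 fB hf K01 (@jump_set_closed _ _ _) nodeK dense).
Qed.

Lemma exists_null_hitting_set : exists E : set R,
  [/\ measurable E, E `<=` [set` `[a, b]], hausdorff_dim E = al%:E &
    forall x, measurable (hitting_event B f E x) /\ P (hitting_event B f E x) = 0%E].
Proof.
have [q qH] := ex_nat_ge2 H0.
have [|||kap kap0] := @exists_jump_set R a b al (fun j => (j.+1%:R ^+ q)^-1) ab al0 Hd1.
- by move=> j; rewrite invr_gt0 exprn_gt0.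
- move=> x x1; exists 1 => // j; rewrite mul1r.
  apply: (@le_trans _ _ 1); last by rewrite exprn_ege1// ltW.
  by rewrite invf_le1 ?exprn_gt0// exprn_ege1// ler1n.
- move=> x /(poly_le_exp q)[C C0 hC]; exists C => // j.
  by rewrite ler_pdivlMr ?exprn_gt0// mul1r.
rewrite -/lam; set delta := fun j => _ => /= -[dp dS dE].
exists (jump_set a delta); split => //.
- exact: jump_set_measurable.
- exact: (jump_set_itv dp dS).
move=> x; split; first exact: jump_set_hitting_measurable.
pose D := kap / (1 - 2 * lam).
have D0 : 0 < D by rewrite divr_gt0// subr_gt0.
(* The weight decreases, so beyond level [n] it is at most [(n + 1)^(-q)], and what remains is a
   geometric tail with ratio [2 lam < 1]. *)
pose rho n : R := D / n.+1%:R ^+ q * lam ^+ n.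
have r0 n : 0 < rho n by rewrite mulr_gt0 ?exprn_gt0// divr_gt0// exprn_gt0.
(* [nu = lam^H] works because [lam^(H d) = 1/2]; in [rho^H] the weight becomes at most
   [(n + 1)^(-2)] by the choice of [q]. *)
apply: (@hitting_event_eq0 _ _ _ P H d B f H0 fB hf d0 a b delta a0 b1 dp dS rho
  (lam `^ H) (D `^ H)) => //.
- move=> n N; rewrite /rho /D (mulrAC kap).
  apply: tail_sum_le => //; [by rewrite mulr_ge0 ?invr_ge0 ?exprn_ge0// ltW|exact: ltW|].
  move=> j nj; rewrite /delta mulrAC; apply: ler_wpM2r; first by rewrite exprn_ge0// ltW.
  apply: ler_wpM2l; first exact: ltW.
  by rewrite lef_pV2 ?posrE ?exprn_gt0// lerXn2r ?nnegrE// ler_nat ltnS ltnW.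
- exact: powR_gt0.
- by rewrite -(powR_mulrn d (powR_ge0 _ _)) -powRrM lam_al.
- exact: powR_gt0.
- move=> n; rewrite /rho.
  have q0 : 0 < n.+1%:R ^+ q :> R by rewrite exprn_gt0.
  rewrite powRM ?exprn_ge0 ?powR_ge0//; last by rewrite divr_ge0// ltW.
  rewrite powRM ?invr_ge0; [|exact: ltW|exact: ltW].
  rewrite powR_exprAC ?powR_ge0// -mulrA; apply: ler_wpM2l; first exact: powR_ge0.
  rewrite mulrC; apply: ler_wpM2l; first by rewrite exprn_ge0// powR_ge0.
  have -> : (n.+1%:R ^+ q)^-1 `^ H = ((n.+1%:R ^+ q) `^ H)^-1 :> R.
    by rewrite -[(_ ^+ q)^-1]powR_inv1 ?ltW// -powRrM mulN1r powRN.
  rewrite lef_pV2 ?posrE ?exprn_gt0 ?powR_gt0//.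
  by apply: sqr_le_powR => //; rewrite ler1n.
Qed.

Lemma exists_positive_hitting_set : exists E : set R,
  [/\ measurable E, E `<=` [set` `[a, b]], hausdorff_dim E = al%:E &
    forall x, measurable (hitting_event B f E x) /\ (0 < P (hitting_event B f E x))%E].
Proof.
have [q qal] := ex_nat_ge2 al0.
have [|||kap kap0] := @exists_jump_set R a b al (fun j => j.+1%:R ^+ q) ab al0 Hd1.
- by move=> j; rewrite exprn_gt0.
- by move=> x /(poly_le_exp q).
- move=> x x1; exists 1 => // j; rewrite mul1r.
  by rewrite mulr_ege1// exprn_ege1 ?ler1n// ltW.
rewrite -/lam; set delta := fun j => _ => /= -[dp dS dE].
exists (jump_set a delta); split => //.
- exact: jump_set_measurable.
- exact: (jump_set_itv dp dS).
move=> x; split; first exact: jump_set_hitting_measurable.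
have k0 : 0 < kap `^ al by exact: powR_gt0.
(* As [lam^al = 1/2], the geometric factors of [2^m delta_(m + 1)^al] cancel up to [1/2]. Only the
   weight is left, at least [(m + 2)^2] by the choice of [q], so the energy series converges. *)
have en N : \sum_(m < N) (2 ^+ m * delta m.+1 `^ al)^-1 <= 2 / kap `^ al.
  apply: (@le_trans _ _ (\sum_(m < N) 2 / kap `^ al * (m.+2%:R ^+ 2)^-1)).
    apply: ler_sum => m _.
    have -> : delta m.+1 `^ al = kap `^ al * 2^-1 ^+ m.+1 * (m.+2%:R ^+ q) `^ al.
      rewrite /delta powRM ?exprn_ge0// ?mulr_ge0 ?exprn_ge0 ?ltW//.
      by rewrite powRM ?exprn_ge0 ?ltW// powR_exprAC ?ltW// lam_al.
    have h : m.+2%:R ^+ 2 <= (m.+2%:R ^+ q) `^ al :> R by apply: sqr_le_powR => //; rewrite ler1n.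
    have m0 : 0 < m.+2%:R ^+ 2 :> R by rewrite exprn_gt0.
    have -> : 2 ^+ m * (kap `^ al * 2^-1 ^+ m.+1 * (m.+2%:R ^+ q) `^ al) =
        (2 / kap `^ al)^-1 * (m.+2%:R ^+ q) `^ al.
      by rewrite exprVn exprS; field; rewrite expf_neq0//= gt_eqF.
    rewrite invfM invrK; apply: ler_wpM2l; first by rewrite divr_ge0// ltW.
    by rewrite lef_pV2 ?posrE// (lt_le_trans m0).
  rewrite -mulr_sumr -[leRHS]mulr1; apply: ler_wpM2l; first by rewrite divr_ge0// ltW.
  exact: sum_inv_sqr_le1.
have [c c0 hc] := hit_level_ge H0 H1 fB hf a0 b1 dp dS x d0 en.
have [K01 nodeK dense] := jump_set_nodes dp dS (ltW a0) b1.
exact: (hitting_event_gt0 H0 fB hf K01 (@jump_set_closed _ _ _) nodeK dense c0 hc).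
Qed.

End hitting_sets.

Theorem proposition6p1 (R : realType) (disp : measure_display)
    (T : measurableType disp) (P : probability T R) (a b H : R) (d : nat)
    (B : 'I_d -> R -> {RV P >-> R}) (f : R -> 'rV[R]_d) :
  measure_is_complete P ->
  0 < a -> a < b -> b <= 1 ->
  0 < H -> H < 1 -> (0 < d)%N -> H * d%:R < 1 ->
  is_fbm H B -> hoelder_on01 H f ->
  exists E1 E2 : set R,
    [/\ measurable E1 /\ E1 `<=` `[a, b],
        measurable E2 /\ E2 `<=` `[a, b],
        hausdorff_dim E1 = (H * d%:R)%:E /\ hausdorff_dim E2 = (H * d%:R)%:E
      & forall x : 'rV[R]_d,
          (measurable (hitting_event B f E1 x) /\
           P (hitting_event B f E1 x) = 0%E) /\
          (measurable (hitting_event B f E2 x) /\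
           (0 < P (hitting_event B f E2 x))%E)].
Proof.
move=> _ a0 ab b1 H0 H1 d0 Hd fB hf.
have [E1 [m1 s1 e1 h1]] := exists_null_hitting_set H0 fB hf d0 Hd a0 ab b1.
have [E2 [m2 s2 e2 h2]] := exists_positive_hitting_set H0 H1 fB hf d0 Hd a0 ab b1.
by exists E1, E2; split.
Qed.
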